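(* Let $\alpha\in\mathbb R$. For $x\in\mathbb R$ set $$L_x(u)=\big((1-xK_u^2)^{-1}(u)\,\big|\,u\big)-\alpha\big((1-xK_u^2)^{-1}(1)\,\big|\,1\big).$$ If $u$ is a solution of $i\partial_tu=\Pi(|u|^2u)+\alpha(u|1)$, then $L_x(u(t))$ is conserved. Moreover, for every $x,y$, $$\{L_x,L_y\}=0 .$$
   Context: $L^2_+=L^2_+(\mathbb S^1)$ is the Hardy space of $L^2$ functions with only nonnegative frequencies; $\Pi:L^2(\mathbb S^1)\to L^2_+$ is the orthogonal projector; $(u|v)=\int_{\mathbb S^1}u\bar v\,\frac{d\theta}{2\pi}$. For $u\in H^{1/2}_+=H^{1/2}(\mathbb S^1)\cap L^2_+$, $H_u(h)=\Pi(u\bar h)$ is an antilinear operator on $L^2_+$, $S$ is the shift $Sh=zh$, and $K_u:=S^*H_u$; $K_u^2$ is linear, positive, self-adjoint and trace class. $L_x(u)$ is considered at those $u$ for which $1-xK_u^2$ is invertible. $L^2_+$ carries the symplectic form $\omega(u,v)=4\,\mathrm{Im}(u|v)$; the Hamiltonian vector field $X_F$ of a function $F$ is defined by $dF(u)\cdot h=\omega(h,X_F(u))$, and the Poisson bracket is $\{F,G\}(u)=dG(u)\cdot X_F(u)$. The equation is globally well-posed in $H^{1/2}_+$. *)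

(* Defs.v *)
From HB Require Import structures.
From mathcomp Require Import all_boot all_order all_algebra.
From mathcomp Require Import all_classical all_reals all_analysis.
From mathcomp Require Import complex.
Import Order.TTheory GRing.Theory Num.Theory.
Import numFieldNormedType.Exports.

Set Implicit Arguments.
Unset Strict Implicit.
Unset Printing Implicit Defensive.

Local Open Scope classical_set_scope.
Local Open Scope ring_scope.

Local Notation Re := complex.Re.
Local Notation Im := complex.Im.

(* A complex function on the unit circle is represented by a function
   f : R -> R[i] of the angle theta, of which only the values on [0, 2 pi]
   matter. Elements of L^2 are such functions up to equality almost
   everywhere on [0, 2 pi]; equalities between elements of L^2 are therefore
   stated with [aeq]. *)

Section Circle.
Context {R : realType}.
Implicit Types (f g h u v w : R -> R[i]) (n : int).

Definition circle : set R := `[0, 2 * pi]%classic.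

Definition aeq f g : Prop :=
  {ae @lebesgue_measure R, forall t, circle t -> f t = g t}.

(* The mean of f with respect to dtheta / (2 pi). *)
Definition cmean f : R[i] :=
  Complex ((2 * pi)^-1 * \int[lebesgue_measure]_(t in circle) Re (f t))
          ((2 * pi)^-1 * \int[lebesgue_measure]_(t in circle) Im (f t)).

Definition normsq (z : R[i]) : R := Re z ^+ 2 + Im z ^+ 2.

Definition L2 f : Prop :=
  [/\ measurable_fun circle (fun t => Re (f t)),
      measurable_fun circle (fun t => Im (f t)) &
      lebesgue_measure.-integrable circle (fun t => (normsq (f t))%:E)].

Definition ip f g : R[i] := cmean (fun t => f t * conjc (g t)).

Definition L2norm f : R := Num.sqrt (Re (ip f f)).

Definition expi n : R -> R[i] :=
  fun t => Complex (cos (n%:~R * t)) (sin (n%:~R * t)).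

Definition cst1 : R -> R[i] := fun=> 1.

Definition fourier f n : R[i] := ip f (expi n).

Definition hardy f : Prop := L2 f /\ forall n, n < 0 -> fourier f n = 0.

Definition H12_sum f : \bar R :=
  (\esum_(n in [set: int]) ((1 + `|n|%:~R) * normsq (fourier f n))%:E)%E.

Definition H12norm f : R := Num.sqrt (fine (H12_sum f)).

Definition H12plus f : Prop := hardy f /\ (H12_sum f < +oo)%E.

(* Orthogonality of f - g to every expi n with n >= 0, which for f in L^2 means
   that g is the orthogonal projection of f on the Hardy space. It is phrased
   with Fourier coefficients because the Hankel operators project a product of
   two L^2 functions, which is a priori only integrable. *)
Definition is_szego f g : Prop :=
  hardy g /\ forall n, 0 <= n -> fourier g n = fourier f n.

Definition szego f : R -> R[i] := xget (fun=> 0) [set g | is_szego f g].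

Definition hankel u h : R -> R[i] := szego (fun t => u t * conjc (h t)).

Definition shift h : R -> R[i] := fun t => expi 1 t * h t.

Definition is_adjoint_shift f g : Prop :=
  hardy g /\ forall h, hardy h -> ip g h = ip f (shift h).

Definition shift_adj f : R -> R[i] :=
  xget (fun=> 0) [set g | is_adjoint_shift f g].

Definition Kop u h : R -> R[i] := shift_adj (hankel u h).

Definition one_sub_xK2 (x : R) u w : R -> R[i] :=
  fun t => w t - x%:C%C * Kop u (Kop u w) t.

(* Surjective and bounded below, i.e. bijective on the Hardy space with a
   bounded inverse. *)
Definition invertible_at (x : R) u : Prop :=
  (forall f, hardy f -> exists2 w, hardy w & aeq (one_sub_xK2 x u w) f) /\
  (exists C : R, forall w, hardy w -> L2norm w <= C * L2norm (one_sub_xK2 x u w)).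

(* Only meaningful when [invertible_at x u] holds. *)
Definition resolvent (x : R) u f : R -> R[i] :=
  xget (fun=> 0) [set w | hardy w /\ aeq (one_sub_xK2 x u w) f].

Definition Lfun_x (alpha x : R) u : R[i] :=
  ip (resolvent x u u) u - alpha%:C%C * ip (resolvent x u cst1) cst1.

Definition szego_rhs (alpha : R) u : R -> R[i] := fun t =>
  szego (fun s => (normsq (u s))%:C%C * u s) t + alpha%:C%C * ip u cst1.

(* Solutions in C(R, H^{1/2}_+), the right-hand side then being in L^2_+ and
   the time derivative being taken in L^2. *)
Definition is_solution (alpha : R) (u : R -> R -> R[i]) : Prop :=
  [/\ forall s : R, H12plus (u s),
      forall s : R, H12norm (fun t => u r t - u s t) @[r --> s] --> (0 : R) &
      forall s : R,
        L2norm (fun t => 'i%C * ((r^-1)%:C%C * (u (s + r) t - u s t))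
                         - szego_rhs alpha (u s) t) @[r --> 0^'] --> (0 : R)].

Definition omega u v : R := 4 * Im (ip u v).

(* D is the differential at u of a real function F defined near u in H^{1/2}_+.
   Since omega is a form on L^2_+, the relation dF(u).h = omega(h, X_F(u))
   makes dF(u) continuous for the L^2 norm, and X_F(u) lies in L^2_+ but need
   not lie in H^{1/2}_+; D is therefore the (unique) continuous extension of
   the differential to L^2_+, which gives a meaning to dG(u).X_F(u). *)
Definition is_differential (F : (R -> R[i]) -> R) u (D : (R -> R[i]) -> R) :
    Prop :=
  [/\ forall (a : R) f g, hardy f -> hardy g ->
        D (fun t => a%:C%C * f t + g t) = a * D f + D g,
      exists C : R, forall f, hardy f -> `|D f| <= C * L2norm f &
      forall e : R, 0 < e -> exists2 d : R, 0 < d &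
        forall h, H12plus h -> H12norm h < d ->
          `|F (fun t => u t + h t) - F u - D h| <= e * H12norm h].

Definition is_hamiltonian_vector (D : (R -> R[i]) -> R) X : Prop :=
  hardy X /\ forall h, hardy h -> D h = omega h X.

Definition is_poisson_bracket (F G : (R -> R[i]) -> R) u (b : R) : Prop :=
  exists dF dG X, [/\ is_differential F u dF, is_differential G u dG,
    is_hamiltonian_vector dF X & b = dG X].

End Circle.

(* Main.v *)
Require Import Defs.
From HB Require Import structures.
From mathcomp Require Import all_boot all_order all_algebra.
From mathcomp Require Import all_classical all_reals all_analysis.
From mathcomp Require Import complex.
From mathcomp Require Import measurable_realfun ring lra.
Import Order.TTheory GRing.Theory Num.Theory.
Import numFieldNormedType.Exports.
Set Implicit Arguments.
Unset Strict Implicit.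
Unset Printing Implicit Defensive.
Local Open Scope classical_set_scope.
Local Open Scope ring_scope.
Local Notation Re := complex.Re.
Local Notation Im := complex.Im.

(** Everything takes place on Fourier coefficients: the Hardy space is the space
    of square summable sequences indexed by the nonnegative integers, [K_u] is
    the antilinear operator with Hankel matrix [u_(n + k + 1)], and [1 - x K_u^2]
    is symmetric. Hence [L_x = (a | u) - alpha (b | 1)], where
    [(1 - x K_u^2) a = u] and [(1 - x K_u^2) b = 1].

    Symmetry gives an exact formula for the increment of [(a | u)] when
    [u] becomes [u + h]: writing [a'] for the new solution it is
    [(h | a) + (a' | h) + x ((K_(u+h)^2 - K_u^2) a' | a)] (lemma [dot_increment]).
    To first order this is [2 Re (h | a + x z a K_u a)], because the adjoint of
    [h |-> K_h a] is multiplication by [z a] (lemma [dot_Kseq_zc]). The error is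
    bounded by the product of the [H^(1/2)] norm and of the [L^2] norm of [h]
    ([gradient_expansion]). That uses the fact that resolvents of smooth data
    are smooth: [a] and [b] lie in [H^(1/4)] ([Aseq_regularity]), so that they
    are fourth-power integrable and the products [a K_u a] make sense in [L^2].
    The gradient of [L_x] is thus [a p - alpha b q], with [p = 1 + x z K_u a]
    and [q = x z K_u b].

    As for the bracket, the functions [a] and [p] are exchanged by the symbol: both
    [u conj p - a] and [x u conj a - p] have only nonpositive frequencies
    ([conjugate_pair]). If [(a, p)] is such a pair at [x] and [(b, q)] one at [y],
    then [y a conj b - q conj p] has only nonpositive frequencies and
    [x a conj b - q conj p] only nonnegative ones, so that the inner product of
    the two is read off their means. Its imaginary part is [x - y] times
    [Im (a p | b q) - Im ((a | b) conj (q | p))] up to sign, so that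
    [Im (a p | b q)] depends only on scalar products of resolvents
    ([conjugate_pair_Im]). In [Im (grad L_x | grad L_y)] these are real on the
    diagonal and cancel off it ([gradient_real]). The Hamiltonian vector of
    [L_x] being [-i / 2] times its gradient, this is the vanishing of the bracket.

    The same pairs show that the vector field of the equation is
    tangent to the level sets of [L_y], for every [y != 0] such that [1 - y K_u^2]
    is invertible ([gradient_conserved]). A solution is differentiable in time
    only for the [L^2] norm, but it is continuous in [H^(1/2)], and the product
    form of the error above turns this into a vanishing time derivative of
    [L_y] ([Lfun_is_derive]). This alone does not reach a given [x], since
    [1 - x K_u^2] may stop being invertible between two times. For [y] small
    however the resolvent exists for all nearby times, and expanding in powers of
    [y] shows that every moment [(K_u^(2n) u | u) - alpha (K_u^(2n) 1 | 1)] is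
    locally constant, hence constant ([moments_constant]). Finally [L_x] is
    determined by these moments wherever it exists, because the inverse of
    [1 - x K_u^2] is a limit of polynomials in [K_u^2] ([resolvent_of_moments]).

    [L^2] being a space of measurable functions, the passage to coefficients
    rests on Parseval's identity and the Riesz-Fischer theorem, hence on the
    uniqueness of Fourier coefficients and on completeness, which are proved
    first. *)

(** * Complex numbers *)

Section ComplexArithmetic.
Context {R : realType}.
Implicit Types (z w : R[i]).

Lemma ReD z w : Re (z + w) = Re z + Re w. Proof. by case: z w => [? ?] [? ?]. Qed.
Lemma ImD z w : Im (z + w) = Im z + Im w. Proof. by case: z w => [? ?] [? ?]. Qed.
Lemma ReN z : Re (- z) = - Re z. Proof. by case: z => [? ?]. Qed.
Lemma ImN z : Im (- z) = - Im z. Proof. by case: z => [? ?]. Qed.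
Lemma ReB z w : Re (z - w) = Re z - Re w. Proof. by rewrite ReD ReN. Qed.
Lemma ImB z w : Im (z - w) = Im z - Im w. Proof. by rewrite ImD ImN. Qed.
Lemma ReM z w : Re (z * w) = Re z * Re w - Im z * Im w.
Proof. by case: z w => [? ?] [? ?]. Qed.
Lemma ImM z w : Im (z * w) = Re z * Im w + Im z * Re w.
Proof. by case: z w => [? ?] [? ?]. Qed.
Lemma ReJ z : Re (conjc z) = Re z. Proof. by case: z. Qed.
Lemma ImJ z : Im (conjc z) = - Im z. Proof. by case: z. Qed.
Lemma Re_sum I (r : seq I) (P : pred I) (F : I -> R[i]) :
  Re (\sum_(i <- r | P i) F i) = \sum_(i <- r | P i) Re (F i).
Proof. by apply: (big_morph (@Re R)) => //; exact: ReD. Qed.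
Lemma complexP z w : Re z = Re w -> Im z = Im w -> z = w.
Proof. by case: z w => [? ?] [? ?] /= -> ->. Qed.

Definition ReImE := (ReD, ImD, ReN, ImN, ReM, ImM, ReJ, ImJ).

Lemma conjcM z w : conjc (z * w) = conjc z * conjc w. Proof. exact: rmorphM. Qed.
Lemma conjcD z w : conjc (z + w) = conjc z + conjc w. Proof. exact: rmorphD. Qed.
Lemma conjcN z : conjc (- z) = - conjc z. Proof. exact: rmorphN. Qed.
Lemma conjcB z w : conjc (z - w) = conjc z - conjc w. Proof. exact: rmorphB. Qed.

Lemma normsq_ge0 z : 0 <= normsq z.
Proof. by rewrite /normsq addr_ge0// sqr_ge0. Qed.
Lemma normsqM z w : normsq (z * w) = normsq z * normsq w.
Proof. rewrite /normsq !ReImE; ring. Qed.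
Lemma normsqJ z : normsq (conjc z) = normsq z.
Proof. by rewrite /normsq !ReImE sqrrN. Qed.
Lemma normsqN z : normsq (- z) = normsq z.
Proof. by rewrite /normsq !ReImE !sqrrN. Qed.
Lemma normsq0 : normsq (0 : R[i]) = 0.
Proof. by rewrite /normsq /= expr0n addr0. Qed.
Lemma normsqR (x : R) : normsq x%:C%C = x ^+ 2.
Proof. by rewrite /normsq/= expr0n addr0. Qed.
Lemma normsqE z : (normsq z)%:C%C = z * conjc z.
Proof. apply: complexP; rewrite /normsq !ReImE /=; ring. Qed.
Lemma normsq_eq0 z : normsq z = 0 -> z = 0.
Proof.
move=> /eqP; rewrite /normsq paddr_eq0 ?sqr_ge0// !sqrf_eq0 => /andP[/eqP ? /eqP ?].
exact: complexP.
Qed.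
Lemma normsqD z w : normsq (z + w) <= 2 * normsq z + 2 * normsq w.
Proof.
rewrite /normsq !ReImE; have := sqr_ge0 (Re z - Re w).
have := sqr_ge0 (Im z - Im w); nra.
Qed.
Lemma normsqB z w : normsq (z - w) <= 2 * normsq z + 2 * normsq w.
Proof. by rewrite -(normsqN w) normsqD. Qed.
Lemma Re_le_normsq z : Re z ^+ 2 <= normsq z.
Proof. by rewrite lerDl sqr_ge0. Qed.
Lemma Im_le_normsq z : Im z ^+ 2 <= normsq z.
Proof. by rewrite lerDr sqr_ge0. Qed.
Lemma Re_mul_le z w : `|Re (z * w)| <= normsq z + normsq w.
Proof.
rewrite /normsq !ReImE ler_norml.
have := sqr_ge0 (Re z - Re w); have := sqr_ge0 (Re z + Re w).
have := sqr_ge0 (Im z - Im w); have := sqr_ge0 (Im z + Im w).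
by move=> *; apply/andP; split; nra.
Qed.
Lemma Im_mul_le z w : `|Im (z * w)| <= normsq z + normsq w.
Proof.
rewrite /normsq !ReImE ler_norml.
have := sqr_ge0 (Re z - Im w); have := sqr_ge0 (Re z + Im w).
have := sqr_ge0 (Im z - Re w); have := sqr_ge0 (Im z + Re w).
by move=> *; apply/andP; split; nra.
Qed.

(** The optimal choice of the free scalar in the positivity of
    [|f - z g|^2] is the projection coefficient; a vanishing [B] forces
    [c] to vanish because the form is then affine in [z]. *)
Lemma cauchy_schwarz_of_pos (A B : R) (c : R[i]) : 0 <= A -> 0 <= B ->
  (forall z, 0 <= A - 2 * Re (conjc z * c) + normsq z * B) -> normsq c <= A * B.
Proof.
move=> A0 B0 H; have [B1|B1] := eqVneq B 0.
  rewrite B1 mulr0; have := H (((A + 1) / 2 / normsq c)%:C%C * c).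
  have [->|c0] := eqVneq c 0; first by rewrite normsq0.
  rewrite B1 mulr0 addr0 conjcM conjc_real -mulrA (mulrC (conjc c)) -normsqE.
  rewrite -rmorphM divfK; last by apply: contra_neq c0 => /normsq_eq0.
  rewrite /=; lra.
have := H ((B^-1)%:C%C * c).
rewrite conjcM conjc_real -mulrA (mulrC (conjc c)) -normsqE -rmorphM normsqM normsqR /=.
have -> : A - 2 * (B^-1 * normsq c) + B^-1 ^+ 2 * normsq c * B = A - normsq c / B.
  by field.
by rewrite subr_ge0 ler_pdivrMr// lt_neqAle eq_sym B1.
Qed.

End ComplexArithmetic.

(** * Means and inner products on the circle *)

Section MeanValue.
Context {R : realType}.
Implicit Types (f g h : R -> R[i]).
Local Notation mu := (@lebesgue_measure R).

Lemma pi2_gt0 : 0 < 2 * pi :> R.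
Proof. by rewrite mulr_gt0// pi_gt0. Qed.

Lemma mcircle : measurable (@circle R : set (measurableTypeR R)).
Proof. exact: measurable_itv. Qed.

Lemma mu_circle : mu circle = (2 * pi)%:E.
Proof.
rewrite /circle lebesgue_measure_itv /= lte_fin pi2_gt0.
by rewrite oppr0 addr0.
Qed.

Definition cmfun f := measurable_fun circle (fun t => Re (f t)) /\
  measurable_fun circle (fun t => Im (f t)).

Definition L1 f := mu.-integrable circle (fun t => (Re (f t))%:E) /\
  mu.-integrable circle (fun t => (Im (f t))%:E).

Lemma cmfunD f g : cmfun f -> cmfun g -> cmfun (fun t => f t + g t).
Proof.
move=> [f1 f2] [g1 g2]; split.
  by under eq_fun do rewrite ReD; exact: measurable_funD.
by under eq_fun do rewrite ImD; exact: measurable_funD.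
Qed.

Lemma cmfunM f g : cmfun f -> cmfun g -> cmfun (fun t => f t * g t).
Proof.
move=> [f1 f2] [g1 g2]; split.
  under eq_fun do rewrite ReM.
  by apply: measurable_funB; exact: measurable_funM.
under eq_fun do rewrite ImM.
by apply: measurable_funD; exact: measurable_funM.
Qed.

Lemma cmfunJ f : cmfun f -> cmfun (fun t => conjc (f t)).
Proof.
move=> [f1 f2]; split.
  by under eq_fun do rewrite ReJ.
under eq_fun do rewrite ImJ.
exact: measurableT_comp.
Qed.

Lemma cmfun_cst (z : R[i]) : cmfun (fun=> z).
Proof. by split; exact: measurable_cst. Qed.

Lemma cmfunZ z f : cmfun f -> cmfun (fun t => z * f t).
Proof. by move=> mf; apply: cmfunM => //; exact: cmfun_cst. Qed.

Lemma cmfun_normsq f : cmfun f -> measurable_fun circle (fun t => normsq (f t)).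
Proof.
by move=> [f1 f2]; apply: measurable_funD; exact: measurable_funX.
Qed.

Lemma continuous_measurable_circle (f : R -> R) : continuous f ->
  measurable_fun circle f.
Proof.
move=> cf; apply: (@measurable_funS _ _ _ _ setT) => //.
exact: continuous_measurable_fun.
Qed.

Lemma continuous_cosM (c : R) : continuous (fun t : R => cos (c * t)).
Proof.
move=> t; apply: (@continuous_comp _ _ _ (fun t : R => c * t) cos).
  exact: mulrl_continuous.
exact: continuous_cos.
Qed.

Lemma continuous_sinM (c : R) : continuous (fun t : R => sin (c * t)).
Proof.
move=> t; apply: (@continuous_comp _ _ _ (fun t : R => c * t) sin).
  exact: mulrl_continuous.
exact: continuous_sin.
Qed.

Lemma cmfun_expi n : cmfun (@expi R n).
Proof.
split; apply: continuous_measurable_circle => /=.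
  exact: continuous_cosM.
exact: continuous_sinM.
Qed.

Lemma L2_cmfun f : L2 f -> cmfun f. Proof. by case. Qed.
Lemma L1_cmfun f : L1 f -> cmfun f.
Proof. by case=> /measurable_int/measurable_EFinP ? /measurable_int/measurable_EFinP ?. Qed.

Lemma L1_bound f (g : R -> R) : cmfun f ->
  mu.-integrable circle (fun t => (g t)%:E) ->
  (forall t, circle t -> `|Re (f t)| <= g t) ->
  (forall t, circle t -> `|Im (f t)| <= g t) -> L1 f.
Proof.
move=> [f1 f2] ig h1 h2; split.
- apply: (le_integrable mcircle _ _ ig); first exact/measurable_EFinP.
  move=> t ct /=; rewrite lee_fin (le_trans (h1 _ ct))// ler_norm//.
- apply: (le_integrable mcircle _ _ ig); first exact/measurable_EFinP.
  move=> t ct /=; rewrite lee_fin (le_trans (h2 _ ct))// ler_norm//.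
Qed.

Lemma integrable_scale (c : R) (g : R -> R) :
  mu.-integrable circle (fun t => (g t)%:E) ->
  mu.-integrable circle (fun t => (c * g t)%:E).
Proof. by move=> ig; under eq_fun do rewrite EFinM; exact: (integrableZl mcircle). Qed.

Lemma integrable_add (g1 g2 : R -> R) :
  mu.-integrable circle (fun t => (g1 t)%:E) ->
  mu.-integrable circle (fun t => (g2 t)%:E) ->
  mu.-integrable circle (fun t => (g1 t + g2 t)%:E).
Proof.
by move=> i1 i2; under eq_fun do rewrite EFinD; exact: (integrableD mcircle i1 i2).
Qed.

Lemma L1D f g : L1 f -> L1 g -> L1 (fun t => f t + g t).
Proof.
move=> [f1 f2] [g1 g2]; split.
  under eq_fun do rewrite ReD EFinD; exact: (integrableD mcircle f1 g1).
under eq_fun do rewrite ImD EFinD; exact: (integrableD mcircle f2 g2).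
Qed.

Lemma L1Z z f : L1 f -> L1 (fun t => z * f t).
Proof.
move=> [f1 f2]; split.
  under eq_fun do rewrite ReM EFinB !EFinM.
  by apply: (integrableB mcircle); exact: (integrableZl mcircle).
under eq_fun do rewrite ImM EFinD !EFinM.
by apply: (integrableD mcircle); exact: (integrableZl mcircle).
Qed.

Lemma L1J f : L1 f -> L1 (fun t => conjc (f t)).
Proof.
move=> [f1 f2]; split; first by under eq_fun do rewrite ReJ.
under eq_fun do rewrite ImJ EFinN; exact: (integrableN f2).
Qed.

Lemma L1N f : L1 f -> L1 (fun t => - f t).
Proof. by move=> /(L1Z (-1)); under eq_fun do rewrite mulN1r. Qed.

Lemma L1B f g : L1 f -> L1 g -> L1 (fun t => f t - g t).
Proof. by move=> f1 g1; apply: L1D => //; exact: L1N. Qed.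

Lemma L1_sum (I : Type) (r : seq I) (F : I -> R -> R[i]) :
  (forall i, L1 (F i)) -> L1 (fun t => \sum_(i <- r) F i t).
Proof.
move=> h; elim: r => [|i r ih].
  under eq_fun do rewrite big_nil; split; exact: integrable0.
by under eq_fun do rewrite big_cons; exact: L1D.
Qed.

Lemma cmeanD f g : L1 f -> L1 g -> cmean (fun t => f t + g t) = cmean f + cmean g.
Proof.
move=> [f1 f2] [g1 g2]; apply: complexP; rewrite ?ReD ?ImD /= -mulrDr; congr (_ * _).
  under eq_Rintegral do rewrite ReD; exact: (RintegralD mcircle f1 g1).
under eq_Rintegral do rewrite ImD; exact: (RintegralD mcircle f2 g2).
Qed.

Lemma cmeanZ z f : L1 f -> cmean (fun t => z * f t) = z * cmean f.
Proof.
move=> [f1 f2]; apply: complexP; rewrite ?ReM ?ImM /=.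
  under eq_Rintegral do rewrite ReM.
  rewrite (RintegralB mcircle); last 2 first.
  - exact: integrable_scale.
  - exact: integrable_scale.
  rewrite (RintegralZl _ mcircle f1) (RintegralZl _ mcircle f2); ring.
under eq_Rintegral do rewrite ImM.
rewrite (RintegralD mcircle); last 2 first.
- exact: integrable_scale.
- exact: integrable_scale.
rewrite (RintegralZl _ mcircle f1) (RintegralZl _ mcircle f2); ring.
Qed.

Lemma cmeanJ f : L1 f -> cmean (fun t => conjc (f t)) = conjc (cmean f).
Proof.
move=> [f1 f2]; apply: complexP; rewrite ?ReJ ?ImJ /=.
  by under eq_Rintegral do rewrite ReJ.
under eq_Rintegral do rewrite ImJ -mulN1r.
by rewrite (RintegralZl _ mcircle f2) mulN1r mulrN.
Qed.

Lemma cmeanN f : L1 f -> cmean (fun t => - f t) = - cmean f.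
Proof.
move=> f1; rewrite -mulN1r -cmeanZ//; congr cmean.
by apply/funext => t; rewrite mulN1r.
Qed.

Lemma cmeanB f g : L1 f -> L1 g -> cmean (fun t => f t - g t) = cmean f - cmean g.
Proof. by move=> f1 g1; rewrite cmeanD ?cmeanN//; exact: L1N. Qed.

Lemma cmean0 : cmean (fun=> 0) = 0 :> R[i].
Proof. by apply: complexP => /=; rewrite Rintegral_cst ?mul0r ?mulr0//; exact: mcircle. Qed.

Lemma cmean_sum (I : Type) (r : seq I) (F : I -> R -> R[i]) :
  (forall i, L1 (F i)) -> cmean (fun t => \sum_(i <- r) F i t) = \sum_(i <- r) cmean (F i).
Proof.
move=> h; elim: r => [|i r ih].
  by under eq_fun do rewrite big_nil; rewrite big_nil cmean0.
under eq_fun do rewrite big_cons.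
by rewrite big_cons cmeanD ?ih//; exact: L1_sum.
Qed.

Lemma eq_cmean f g : f =1 g -> cmean f = cmean g.
Proof. by move=> /funext ->. Qed.

(** ** Square integrable functions *)

Lemma L2_intro f (g : R -> R) : cmfun f -> mu.-integrable circle (fun t => (g t)%:E) ->
  (forall t, circle t -> normsq (f t) <= g t) -> L2 f.
Proof.
move=> mf ig h; case: (mf) => f1 f2; split => //.
apply: (le_integrable mcircle _ _ ig); first by apply/measurable_EFinP; exact: (cmfun_normsq mf).
move=> t ct /=; rewrite lee_fin ger0_norm ?normsq_ge0// (le_trans (h _ ct))// ler_norm//.
Qed.

Lemma L2D f g : L2 f -> L2 g -> L2 (fun t => f t + g t).
Proof.
move=> L2f L2g; have [_ _ i1] := L2f; have [_ _ i2] := L2g.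
apply: (@L2_intro _ (fun t => 2 * normsq (f t) + 2 * normsq (g t))).
- by apply: cmfunD; exact: L2_cmfun.
- by apply: integrable_add; exact: integrable_scale.
- by move=> t _; exact: normsqD.
Qed.

Lemma L2M_bounded f g (C : R) : cmfun f -> L2 g -> (forall t, normsq (f t) <= C) ->
  L2 (fun t => f t * g t).
Proof.
move=> mf L2g h; have [_ _ i2] := L2g.
apply: (@L2_intro _ (fun t => C * normsq (g t))).
- by apply: cmfunM => //; exact: L2_cmfun.
- exact: integrable_scale.
- by move=> t _; rewrite normsqM ler_wpM2r// normsq_ge0.
Qed.

Lemma L2Z z f : L2 f -> L2 (fun t => z * f t).
Proof. by move=> L2f; apply: (@L2M_bounded _ _ (normsq z)) => //; exact: cmfun_cst. Qed.

Lemma L2N f : L2 f -> L2 (fun t => - f t).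
Proof. by move=> /(L2Z (-1)); under eq_fun do rewrite mulN1r. Qed.

Lemma L2B f g : L2 f -> L2 g -> L2 (fun t => f t - g t).
Proof. by move=> ? ?; apply: L2D => //; exact: L2N. Qed.

Lemma L2J f : L2 f -> L2 (fun t => conjc (f t)).
Proof.
move=> L2f; have [_ _ i] := L2f.
apply: (@L2_intro _ (fun t => normsq (f t))) => //.
- by apply: cmfunJ; exact: L2_cmfun.
- by move=> t _; rewrite normsqJ.
Qed.

Lemma L2_bounded f (C : R) : cmfun f -> (forall t, normsq (f t) <= C) -> L2 f.
Proof.
move=> mf h; apply: (@L2_intro _ (fun=> C)) => //.
apply: (@measurable_bounded_integrable _ _ _ mu (fun=> C)) => //.
- exact: mcircle.
- by rewrite [X in (X < _)%E]mu_circle ltry.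
- by exists `|C|; split => // M /ltW CM x _.
Qed.

Lemma L2_cst (z : R[i]) : @L2 R (fun=> z).
Proof. by apply: (@L2_bounded _ (normsq z)) => //; exact: cmfun_cst. Qed.

Lemma normsq_expi n t : normsq (@expi R n t) = 1.
Proof. by rewrite /normsq /= cos2Dsin2. Qed.

Lemma L2_expi n : L2 (@expi R n).
Proof.
apply: (@L2_bounded _ 1); first exact: cmfun_expi.
by move=> t; rewrite normsq_expi.
Qed.

Lemma L2_expiM n f : L2 f -> L2 (fun t => expi n t * f t).
Proof.
move=> L2f; apply: (@L2M_bounded _ _ 1) => //; first exact: cmfun_expi.
by move=> t; rewrite normsq_expi.
Qed.

Lemma L2_sum (I : Type) (r : seq I) (F : I -> R -> R[i]) :
  (forall i, L2 (F i)) -> L2 (fun t => \sum_(i <- r) F i t).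
Proof.
move=> h; elim: r => [|i r ih].
  by under eq_fun do rewrite big_nil; exact: L2_cst.
by under eq_fun do rewrite big_cons; exact: L2D.
Qed.

Lemma L1M f g : L2 f -> L2 g -> L1 (fun t => f t * g t).
Proof.
move=> L2f L2g; have [_ _ i1] := L2f; have [_ _ i2] := L2g.
apply: (@L1_bound _ (fun t => normsq (f t) + normsq (g t))).
- by apply: cmfunM; exact: L2_cmfun.
- exact: integrable_add.
- by move=> t _; exact: Re_mul_le.
- by move=> t _; exact: Im_mul_le.
Qed.

Lemma L2_L1 f : L2 f -> L1 f.
Proof.
move=> L2f; have := L1M L2f (L2_cst 1).
by under eq_fun do rewrite mulr1.
Qed.

Lemma L1_ip f g : L2 f -> L2 g -> L1 (fun t => f t * conjc (g t)).
Proof. by move=> ? ?; apply: L1M => //; exact: L2J. Qed.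

Lemma ipDl f g h : L2 f -> L2 g -> L2 h -> ip (fun t => f t + g t) h = ip f h + ip g h.
Proof.
move=> f2 g2 h2; rewrite /ip -cmeanD; try exact: L1_ip.
by apply: eq_cmean => t; rewrite mulrDl.
Qed.

Lemma ipZl z f h : L2 f -> L2 h -> ip (fun t => z * f t) h = z * ip f h.
Proof.
move=> f2 h2; rewrite /ip -cmeanZ; last exact: L1_ip.
by apply: eq_cmean => t; rewrite mulrA.
Qed.

Lemma ipJ f g : L2 f -> L2 g -> conjc (ip f g) = ip g f.
Proof.
move=> f2 g2; rewrite /ip -cmeanJ; last exact: L1_ip.
by apply: eq_cmean => t; rewrite rmorphM /= conjcK mulrC.
Qed.

Lemma ipNl f h : L2 f -> L2 h -> ip (fun t => - f t) h = - ip f h.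
Proof.
move=> f2 h2; have -> : (fun t => - f t) = (fun t => -1 * f t).
  by apply/funext => t; rewrite mulN1r.
by rewrite (ipZl (-1) f2 h2) mulN1r.
Qed.

Lemma ipBl f g h : L2 f -> L2 g -> L2 h -> ip (fun t => f t - g t) h = ip f h - ip g h.
Proof. by move=> f2 g2 h2; rewrite ipDl ?ipNl//; exact: L2N. Qed.

Lemma ipDr f g h : L2 f -> L2 g -> L2 h -> ip h (fun t => f t + g t) = ip h f + ip h g.
Proof.
move=> f2 g2 h2; rewrite -(ipJ (L2D f2 g2) h2) ipDl// conjcD.
by rewrite (ipJ f2 h2) (ipJ g2 h2).
Qed.

Lemma ipZr z f h : L2 f -> L2 h -> ip h (fun t => z * f t) = conjc z * ip h f.
Proof.
move=> f2 h2; rewrite -(ipJ (L2Z z f2) h2).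
by rewrite ipZl// conjcM (ipJ f2 h2).
Qed.

Lemma ipNr f h : L2 f -> L2 h -> ip h (fun t => - f t) = - ip h f.
Proof.
move=> f2 h2; rewrite -(ipJ (L2N f2) h2).
by rewrite ipNl// conjcN (ipJ f2 h2).
Qed.

Lemma ipBr f g h : L2 f -> L2 g -> L2 h -> ip h (fun t => f t - g t) = ip h f - ip h g.
Proof. by move=> f2 g2 h2; rewrite ipDr ?ipNr//; exact: L2N. Qed.

Lemma ip_suml (I : Type) (r : seq I) (F : I -> R -> R[i]) h :
  (forall i, L2 (F i)) -> L2 h ->
  ip (fun t => \sum_(i <- r) F i t) h = \sum_(i <- r) ip (F i) h.
Proof.
move=> hF h2; rewrite /ip -cmean_sum; last by move=> i; exact: L1_ip.
by apply: eq_cmean => t; rewrite mulr_suml.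
Qed.

Lemma Re_ip f : Re (ip f f) = (2 * pi)^-1 * \int[mu]_(t in circle) normsq (f t).
Proof.
rewrite /ip /=; congr (_ * _); apply: eq_Rintegral => t _.
by rewrite -normsqE.
Qed.

Lemma Re_ip_ge0 f : 0 <= Re (ip f f).
Proof.
rewrite Re_ip mulr_ge0 ?invr_ge0 ?(ltW pi2_gt0)//.
by apply: Rintegral_ge0 => t _; exact: normsq_ge0.
Qed.

Lemma Im_ip f : Im (ip f f) = 0.
Proof.
rewrite /ip /=; under eq_Rintegral do rewrite -normsqE /=.
by rewrite Rintegral_cst ?mul0r ?mulr0//; exact: mcircle.
Qed.

Lemma ipE f : ip f f = (Re (ip f f))%:C%C.
Proof. by apply: complexP => //; rewrite Im_ip. Qed.

Lemma ip_expand f g z : L2 f -> L2 g ->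
  Re (ip (fun t => f t - z * g t) (fun t => f t - z * g t)) =
  Re (ip f f) - 2 * Re (conjc z * ip f g) + normsq z * Re (ip g g).
Proof.
move=> f2 g2; have zg := L2Z z g2.
rewrite ipBl ?ipBr//; try exact: L2B.
rewrite ipZr// ipZl// ipZl// ipZr//.
rewrite -(ipJ f2 g2) (ipE g) !(ReD,ReN,ReM,ImM,ReJ,ImJ) /= /normsq; ring.
Qed.

Lemma ip_CS f g : L2 f -> L2 g ->
  normsq (ip f g) <= Re (ip f f) * Re (ip g g).
Proof.
move=> f2 g2; apply: cauchy_schwarz_of_pos; try exact: Re_ip_ge0.
by move=> z; rewrite -ip_expand// Re_ip_ge0.
Qed.

Lemma L2norm_sq f : L2norm f ^+ 2 = Re (ip f f).
Proof. by rewrite sqr_sqrtr// Re_ip_ge0. Qed.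

Lemma L2norm_ge0 f : 0 <= L2norm f.
Proof. exact: sqrtr_ge0. Qed.

End MeanValue.

(** * Exponentials and trigonometric polynomials *)

Section Exponentials.
Context {R : realType}.
Implicit Types (f g : R -> R[i]) (n m : int).
Local Notation mu := (@lebesgue_measure R).

Lemma expi0 t : @expi R 0 t = 1.
Proof. by rewrite /expi mul0r cos0 sin0. Qed.

Lemma expiD n m t : @expi R (n + m) t = expi n t * expi m t.
Proof.
apply: complexP; rewrite !ReImE /= intrD mulrDl ?cosD ?sinD//.
by rewrite addrC mulrC [X in _ + X]mulrC addrC mulrC [X in _ + X]mulrC.
Qed.

Lemma expiN n t : @expi R (- n) t = conjc (expi n t).
Proof. by apply: complexP; rewrite !ReImE /= intrN mulNr ?cosN ?sinN. Qed.

Lemma sin_nat_2pi (k : nat) : sin (k%:R * (2 * pi)) = 0 :> R /\ cos (k%:R * (2 * pi)) = 1 :> R.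
Proof.
have e : 2 * pi = pi *+ 2 :> R by rewrite mulr_natl.
elim: k => [|k [s c]]; first by rewrite mul0r sin0 cos0.
by rewrite -natr1 mulrDl mul1r {2 4}e sinD2pi cosD2pi.
Qed.

Lemma sin_int_2pi n : sin (n%:~R * (2 * pi)) = 0 :> R /\ cos (n%:~R * (2 * pi)) = 1 :> R.
Proof.
case: n => k; first exact: sin_nat_2pi.
rewrite NegzE intrN mulNr sinN cosN.
by have [-> ->] := sin_nat_2pi k.+1; rewrite oppr0.
Qed.

Lemma derivable_LR (F f : R -> R) (a b : R) : (forall x : R, is_derive x 1 F (f x)) ->
  derivable_oo_LRcontinuous F a b.
Proof.
move=> h; have c x : {for x, continuous F}.
  by apply: differentiable_continuous; apply/derivable1_diffP; apply: ex_derive.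
split; first by move=> x _; apply: ex_derive.
- by apply: cvg_at_right_filter; exact: c.
- by apply: cvg_at_left_filter; exact: c.
Qed.

Lemma Rintegral_circle_FTC (F f : R -> R) : continuous f ->
  (forall x : R, is_derive x 1 F (f x)) ->
  \int[mu]_(t in circle) f t = F (2 * pi) - F 0.
Proof.
move=> cf dF; rewrite /Rintegral /circle (@continuous_FTC2 _ _ F)//.
- exact: pi2_gt0.
- exact: continuous_subspaceT.
- exact: derivable_LR dF.
- by move=> x _; rewrite derive1E; apply: derive_val.
Qed.

(** The fundamental theorem of calculus, the primitives of a nonconstant
    exponential being periodic. *)
Lemma cmean_expi n : cmean (@expi R n) = (n == 0)%:R.
Proof.
have [->|n0] := eqVneq n 0.
  have -> : expi 0 = fun=> 1 :> R[i] by apply/funext => t; rewrite expi0.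
  have pi0 : 2 * pi != 0 :> R by rewrite gt_eqF ?pi2_gt0.
  apply: complexP => /=; rewrite Rintegral_cst; try exact: mcircle.
  - by rewrite [X in fine X]mu_circle /= mul1r mulVf.
  - by rewrite mul0r mulr0.
have c0 : n%:~R != 0 :> R by rewrite intr_eq0.
have [s c] := sin_int_2pi n.
have dS (x : R) : is_derive x 1 (fun t : R => n%:~R^-1 * sin (n%:~R * t)) (cos (n%:~R * x)).
  by apply: is_derive_eq; rewrite /GRing.scale /= mulr1; field.
have dC (x : R) : is_derive x 1 (fun t : R => - n%:~R^-1 * cos (n%:~R * t)) (sin (n%:~R * x)).
  by apply: is_derive_eq; rewrite /GRing.scale /= mulr1; field.
have ic : \int[mu]_(t in circle) cos (n%:~R * t) = 0.
  rewrite (Rintegral_circle_FTC (@continuous_cosM R _) dS).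
  by rewrite s !mulr0 sin0 mulr0 subrr.
have is_ : \int[mu]_(t in circle) sin (n%:~R * t) = 0.
  rewrite (Rintegral_circle_FTC (@continuous_sinM R _) dC).
  by rewrite c mulr1 mulr0 cos0 mulr1 subrr.
by apply: complexP => /=; rewrite ?ic ?is_ mulr0.
Qed.

Lemma ip_expi n m : ip (@expi R n) (expi m) = (n == m)%:R.
Proof.
rewrite -subr_eq0 -cmean_expi; apply: eq_cmean => t.
by rewrite expiD expiN.
Qed.

Lemma conjc_expi n t : conjc (@expi R n t) = expi (- n) t.
Proof. by rewrite expiN. Qed.

Lemma fourierE f n : fourier f n = cmean (fun t => f t * expi (- n) t).
Proof. by apply: eq_cmean => t; rewrite conjc_expi. Qed.

Lemma fourierD f g n : L2 f -> L2 g -> fourier (fun t => f t + g t) n = fourier f n + fourier g n.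
Proof. by move=> ? ?; apply: ipDl => //; exact: L2_expi. Qed.
Lemma fourierZ z f n : L2 f -> fourier (fun t => z * f t) n = z * fourier f n.
Proof. by move=> ?; apply: ipZl => //; exact: L2_expi. Qed.
Lemma fourierB f g n : L2 f -> L2 g -> fourier (fun t => f t - g t) n = fourier f n - fourier g n.
Proof. by move=> ? ?; apply: ipBl => //; exact: L2_expi. Qed.

Lemma fourierJ f n : L2 f -> fourier (fun t => conjc (f t)) n = conjc (fourier f (- n)).
Proof.
move=> f2; rewrite !fourierE -cmeanJ; last first.
  by under eq_fun do rewrite mulrC; apply: L2_L1; exact: L2_expiM.
by apply: eq_cmean => t; rewrite conjcM conjc_expi !opprK.
Qed.

Lemma fourier_expi n m : fourier (@expi R n) m = (n == m)%:R.
Proof. exact: ip_expi. Qed.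

Lemma fourier_expiM f n m : L2 f -> fourier (fun t => expi m t * f t) n = fourier f (n - m).
Proof.
move=> f2; rewrite !fourierE; apply: eq_cmean => t.
by rewrite opprB expiD; ring.
Qed.

Lemma fourier_sum (I : Type) (r : seq I) (F : I -> R -> R[i]) n :
  (forall i, L2 (F i)) -> fourier (fun t => \sum_(i <- r) F i t) n = \sum_(i <- r) fourier (F i) n.
Proof. by move=> h; apply: ip_suml => //; exact: L2_expi. Qed.

(** An inductive predicate rather than finite sums: the closure under products
    is then an induction. *)
Inductive trig : (R -> R[i]) -> Prop :=
| trig_expi n : trig (expi n)
| trig_add f g : trig f -> trig g -> trig (fun t => f t + g t)
| trig_scale z f : trig f -> trig (fun t => z * f t).

Lemma trig_mul f g : trig f -> trig g -> trig (fun t => f t * g t).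
Proof.
move=> tf tg; elim: tf => [n|f1 f2 _ ih1 _ ih2|z f1 _ ih].
- elim: tg => [m|g1 g2 _ ih1 _ ih2|z g1 _ ih].
  + have -> : (fun t : R => expi n t * expi m t) = expi (n + m).
      by apply/funext => t; rewrite expiD.
    exact: trig_expi.
  + under eq_fun do rewrite mulrDr; exact: trig_add.
  + under eq_fun do rewrite mulrCA; exact: trig_scale.
- under eq_fun do rewrite mulrDl; exact: trig_add.
- under eq_fun do rewrite -mulrA; exact: trig_scale.
Qed.

Lemma trig_cst (z : R[i]) : trig (fun=> z).
Proof.
have -> : (fun _ : R => z) = (fun t => z * @expi R 0 t).
  by apply/funext => t; rewrite expi0 mulr1.
by apply: trig_scale; exact: trig_expi.
Qed.

Lemma trig_exp f (n : nat) : trig f -> trig (fun t => f t ^+ n).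
Proof.
move=> tf; elim: n => [|n ih]; first by under eq_fun do rewrite expr0; exact: trig_cst.
by under eq_fun do rewrite exprS; exact: trig_mul.
Qed.

Lemma L1M_bounded f g (C : R) : cmfun f -> L1 g -> (forall t, normsq (f t) <= C ^+ 2) ->
  0 <= C -> L1 (fun t => f t * g t).
Proof.
move=> mf Lg h C0; have [i1 i2] := Lg.
have hRe t : `|Re (f t)| <= C.
  by rewrite -ler_sqr ?nnegrE// real_normK ?num_real// (le_trans _ (h t))// Re_le_normsq.
have hIm t : `|Im (f t)| <= C.
  by rewrite -ler_sqr ?nnegrE// real_normK ?num_real// (le_trans _ (h t))// Im_le_normsq.
apply: (@L1_bound _ _ (fun t => C * `|Re (g t)| + C * `|Im (g t)|)).
- by apply: cmfunM => //; exact: L1_cmfun.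
- by apply: integrable_add; apply: integrable_scale; apply: integrable_norm.
- move=> t _; rewrite ReM (le_trans (ler_normB _ _))// !normrM lerD// ler_wpM2r//.
- move=> t _; rewrite ImM addrC (le_trans (ler_normD _ _))// !normrM lerD// ler_wpM2r//.
Qed.

Lemma trig_orthogonal f T : L1 f -> (forall n, cmean (fun t => f t * expi n t) = 0) ->
  trig T -> L1 (fun t => f t * T t) /\ cmean (fun t => f t * T t) = 0.
Proof.
move=> f1 f0; elim => [n|g1 g2 _ [i1 m1] _ [i2 m2]|z g _ [i m]].
- split => //; under eq_fun do rewrite mulrC.
  apply: (@L1M_bounded _ _ 1) => //; first exact: cmfun_expi.
  by move=> t; rewrite normsq_expi expr1n.
- under eq_fun do rewrite mulrDr; split; first exact: L1D.
  by rewrite cmeanD// m1 m2 addr0.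
- under eq_fun do rewrite mulrCA; split; first exact: L1Z.
  by rewrite cmeanZ// m mulr0.
Qed.

End Exponentials.

(** * Uniqueness of Fourier coefficients *)

Section Uniqueness.
Context {R : realType}.
Implicit Types (f : R -> R[i]) (g : R -> R).
Local Notation mu := (@lebesgue_measure R).

Lemma bernoulli_ineq (x : R) (m : nat) : -1 <= x -> 1 + m%:R * x <= (1 + x) ^+ m.
Proof.
move=> x1; elim: m => [|m ih]; first by rewrite mul0r addr0 expr0.
have x0 : 0 <= 1 + x by lra.
rewrite exprS; apply: le_trans (ler_wpM2l x0 ih).
rewrite -natr1; have := sqr_ge0 x; have : 0 <= m%:R :> R by []; nra.
Qed.

(** A polynomial step function: it tends to [1] on [0, 1/2) and to [0]
    on (1/2, 1], while staying in the unit interval. *)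
Definition polystep (n : nat) (v : R) := (1 - v ^+ n) ^+ (2 ^ n).

Lemma polystep_itv n (v : R) : 0 <= v <= 1 -> 0 <= polystep n v <= 1.
Proof.
move=> /andP[v0 v1]; have vn0 := exprn_ge0 n v0; have vn1 := exprn_ile1 n v0 v1.
by rewrite exprn_ge0 ?exprn_ile1//; lra.
Qed.

(** Bernoulli's inequality gives [1 - (2 v)^n <= polystep n v], which is where
    the exponent [2^n] comes from. *)
Lemma polystep_cvg1 (v : R) : 0 <= v -> v < 2^-1 -> polystep n v @[n --> \oo] --> (1 : R).
Proof.
move=> v0 v1; have v2 : 0 <= v <= 1 by lra.
apply: (@squeeze_cvgr _ _ _ _ (fun n => 1 - (2 * v) ^+ n) (cst 1)).
- apply: nearW => n; have /andP[_ ->] := polystep_itv n v2; rewrite andbT.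
  have /andP[v20 v21] := v2; have vn1 := exprn_ile1 n v20 v21.
  have := @bernoulli_ineq (- v ^+ n) (2 ^ n) ltac:(lra).
  by rewrite mulrN natrX -exprMn.
- rewrite -[X in _ --> X]subr0; apply: cvgB; first exact: cvg_cst.
  by apply: cvg_expr; rewrite ger0_norm; lra.
- exact: cvg_cst.
Qed.

(** Bernoulli's inequality for [(1 + v^n)^(2^n)], whose product with
    [polystep n v] is at most [1], gives [polystep n v <= (2 v)^-n]. *)
Lemma polystep_cvg0 (v : R) : 2^-1 < v -> v <= 1 -> polystep n v @[n --> \oo] --> (0 : R).
Proof.
move=> v0 v1; have v2 : 0 <= v <= 1 by lra.
have v3 : 0 < v by lra.
apply: (@squeeze_cvgr _ _ _ _ (cst 0) (fun n => ((2 * v)^-1) ^+ n)).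
- apply: nearW => n; have /andP[-> _] := polystep_itv n v2 => /=.
  rewrite exprVn -[leRHS]mul1r ler_pdivlMr; last by apply: exprn_gt0; lra.
  rewrite exprMn -natrX.
  have vn0 := exprn_gt0 n v3; have /andP[v20 v21] := v2.
  have vn1 := exprn_ile1 n v20 v21.
  rewrite /polystep; set y := v ^+ n in vn0 vn1 *; set m := (2 ^ n)%N.
  have h : 1 + m%:R * y <= (1 + y) ^+ m by apply: bernoulli_ineq; lra.
  have h2 : m%:R * y <= (1 + y) ^+ m by lra.
  have p0 : 0 <= (1 - y) ^+ m by apply: exprn_ge0; lra.
  apply: le_trans (ler_wpM2l p0 h2) _.
  by rewrite -exprMn exprn_ile1//; nra.
- exact: cvg_cst.
- apply: cvg_expr; rewrite ger0_norm ?invr_ge0; last by lra.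
  by rewrite invf_lt1; lra.
Qed.

(** A trigonometric polynomial in [t] of degree one, below [1/2] for [t] in
    (0, x) and above [1/2] for [t] in (x, 2 pi), because the first sine is
    positive and the second has the sign of [x - t]. *)
Definition cutoff (x t : R) := 2^-1 - sin (t / 2) * sin ((x - t) / 2) / 2.

Lemma cutoffE x t :
  cutoff x t = (2 - (cos (x / 2) * cos t + sin (x / 2) * sin t - cos (x / 2))) / 4.
Proof.
rewrite /cutoff.
have -> : cos (x / 2) * cos t + sin (x / 2) * sin t = cos (t / 2 + (t - x) / 2).
  by rewrite (_ : t / 2 + (t - x) / 2 = t - x / 2); [rewrite cosB; ring|field].
have -> : cos (x / 2) = cos (t / 2 - (t - x) / 2) by congr cos; field.
have -> : (x - t) / 2 = - ((t - x) / 2) by field.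
by rewrite sinN cosD cosB; field.
Qed.

Lemma cutoff_trig x : trig (fun t => (cutoff x t)%:C%C).
Proof.
pose z := (Complex (cos (x / 2)) (- sin (x / 2)) / 8).
have -> : (fun t => (cutoff x t)%:C%C) = (fun t => (Complex (2^-1 + cos (x / 2) / 4) 0 : R[i])
   + (- Complex (cos (x / 2) / 8) (- sin (x / 2) / 8) * expi 1 t
   + - Complex (cos (x / 2) / 8) (sin (x / 2) / 8) * expi (-1) t)).
  apply/funext => t; rewrite cutoffE; apply: complexP; rewrite !ReImE /=.
    by rewrite mulr1z mulrN1z mul1r mulN1r cosN sinN; field.
  by rewrite mulr1z mulrN1z mul1r mulN1r cosN sinN; field.
apply: trig_add; first exact: trig_cst.
by apply: trig_add; apply: trig_scale; exact: trig_expi.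
Qed.

Lemma polystep_trig n x : trig (fun t => (polystep n (cutoff x t))%:C%C).
Proof.
have -> : (fun t => (polystep n (cutoff x t))%:C%C) =
  (fun t => (1 + -1 * (cutoff x t)%:C%C ^+ n) ^+ (2 ^ n)).
  by apply/funext => t; rewrite /polystep rmorphXn rmorphB rmorphXn rmorph1 mulN1r.
apply: trig_exp; apply: trig_add; first exact: trig_cst.
by apply: trig_scale; apply: trig_exp; exact: cutoff_trig.
Qed.

Lemma cutoff_itv x t : 0 <= cutoff x t <= 1.
Proof.
have s1 := sin_max (t / 2); have s2 := sin_max ((x - t) / 2).
have : `|sin (t / 2) * sin ((x - t) / 2)| <= 1.
  by rewrite normrM; have := normr_ge0 (sin (t / 2)); nra.
rewrite ler_norml /cutoff => /andP[? ?]; apply/andP; split; lra.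
Qed.

Lemma polystep_cutoff_cvg (x t : R) : 0 < x <= 2 * pi -> 0 < t < 2 * pi -> t != x ->
  polystep n (cutoff x t) @[n --> \oo] --> ((t <= x)%R%:R : R).
Proof.
move=> xp tp tx; have /andP[v0 v1] := cutoff_itv x t.
have st : 0 < sin (t / 2) by apply: sin_gt0_pi; lra.
have [tx'|xt] := leP t x.
  have {}tx' : t < x by rewrite lt_neqAle tx.
  have sx : 0 < sin ((x - t) / 2) by apply: sin_gt0_pi; lra.
  by apply: polystep_cvg1 => //; rewrite /cutoff; nra.
have sx : 0 < sin ((t - x) / 2) by apply: sin_gt0_pi; lra.
apply: polystep_cvg0 => //; rewrite /cutoff.
have -> : (x - t) / 2 = - ((t - x) / 2) by field.
by rewrite sinN; nra.
Qed.

Lemma ae_mono (P Q : R -> Prop) : {ae mu, forall t, P t} ->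
  (forall t, P t -> Q t) -> {ae mu, forall t, Q t}.
Proof. by move=> + PQ; apply: filterS PQ; exact: (ae_filter_ringOfSetsType mu). Qed.

Lemma ae_mono2 (P Q S : R -> Prop) : {ae mu, forall t, P t} ->
  {ae mu, forall t, Q t} -> (forall t, P t -> Q t -> S t) -> {ae mu, forall t, S t}.
Proof. by move=> + + PQ; apply: filterS2 PQ; exact: (ae_filter_ringOfSetsType mu). Qed.

Lemma ae_everywhere (P : R -> Prop) : (forall t, P t) -> {ae mu, forall t, P t}.
Proof. by move=> PQ; apply: nearW => //; exact: (ae_filter_ringOfSetsType mu). Qed.

Lemma ae_notin3 (a b c : R) : {ae mu, forall t, [/\ t != a, t != b & t != c]}.
Proof.
exists [set a; b; c]; split.
- by apply: measurableU => //; apply: measurableU.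
- rewrite null_set_setU ?null_set_setU//; try exact: lebesgue_measure_set1.
  by apply: measurableU.
- move=> t /= h; apply: contrapT => h2; apply: h; split; apply/eqP => e; apply: h2; rewrite e /=; tauto.
Qed.

Lemma trig_cmfun (T : R -> R[i]) : trig T -> cmfun T.
Proof.
elim=> [n|f1 f2 _ ih1 _ ih2|z f _ ih].
- exact: cmfun_expi.
- exact: cmfunD.
- exact: cmfunZ.
Qed.

Lemma measurable_trig_real g : trig (fun t => (g t)%:C%C) -> measurable_fun circle g.
Proof. by move=> /trig_cmfun[]. Qed.

(** Dominated convergence along [polystep n (cutoff x t)]. *)
Lemma orthogonal_initial_segment g (x : R) :
  mu.-integrable circle (fun t => (g t)%:E) ->
  (forall T : R -> R, trig (fun t => (T t)%:C%C) -> \int[mu]_(t in circle) (g t * T t) = 0) ->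
  0 < x <= 2 * pi -> \int[mu]_(t in circle) (g t * (t <= x)%R%:R) = 0.
Proof.
move=> ig h xp; have mg : measurable_fun circle g by move: ig => /measurable_int/measurable_EFinP.
have mq n := measurable_trig_real (polystep_trig n x).
have mle : measurable_fun circle (fun t : R => (t <= x)%R%:R : R).
  apply: (@measurable_funS _ _ _ _ setT) => //.
  rewrite (_ : (fun t : R => (t <= x)%R%:R) = \1_(`]-oo, x])); last first.
    apply/funext => t; rewrite indicE; congr (_%:R); congr nat_of_bool.
    by apply/idP/idP; rewrite inE /= in_itv.
  exact: measurable_indic.
pose F n t := (g t * polystep n (cutoff x t))%:E.
have mF n : measurable_fun circle (F n) by apply/measurable_EFinP; exact: measurable_funM.
have mG : measurable_fun circle (fun t => (g t * (t <= x)%R%:R)%:E).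
  by apply/measurable_EFinP; exact: measurable_funM.
have cF : {ae mu, forall t, circle t -> F ^~ t @ \oo --> (g t * (t <= x)%R%:R)%:E}.
  apply: (ae_mono (ae_notin3 0 x (2 * pi))) => t [t0 tx t2].
  rewrite /circle /= in_itv /= => /andP[t0' t2'].
  apply: cvg_EFin; first exact: nearW.
  apply: cvgMr; apply: polystep_cutoff_cvg => //.
  by rewrite !lt_neqAle t0' t2' eq_sym t0 t2.
have iA : mu.-integrable circle (fun t => `|g t|%:E) by exact: (integrable_norm ig).
have bF : {ae mu, forall t n, circle t -> (`|F n t| <= `|g t|%:E)%E}.
  apply: ae_everywhere => t n _; rewrite /F /= lee_fin normrM ler_piMr//.
  by have /andP[? ?] := polystep_itv n (cutoff_itv x t); rewrite ger0_norm.
have [_ _] := dominated_convergence mcircle mF mG cF iA bF.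
have -> : [sequence (\int[mu]_(t in circle) F n t)%E]_n = fun=> 0%E.
  apply/funext => n /=.
  have := h _ (polystep_trig n x); rewrite /Rintegral => e.
  rewrite -[LHS]fineK ?e//; apply: (integrable_fin_num mcircle).
  apply: (le_integrable mcircle (mF n) _ iA) => t ct.
  rewrite /F /= lee_fin normrM normr_id ler_piMr//.
  by have /andP[? ?] := polystep_itv n (cutoff_itv x t); rewrite ger0_norm.
move=> /(cvg_lim (@ereal_hausdorff R)) => e.
rewrite /Rintegral -e; have -> // := @cvg_lim _ (@ereal_hausdorff R) _ _ _ (fun=> 0%E) 0%E.
exact: cvg_cst.
Qed.

(** Lebesgue's differentiation theorem for the primitive. *)
Lemma ae_eq0_of_initial_segments g :
  mu.-integrable circle (fun t => (g t)%:E) ->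
  (forall x : R, 0 < x <= 2 * pi -> \int[mu]_(t in circle) (g t * (t <= x)%R%:R) = 0) ->
  {ae mu, forall t, circle t -> g t = 0}.
Proof.
move=> ig h; pose G := g \_ circle.
have iG : mu.-integrable setT (EFin \o G).
  by have /integrable_mkcond := ig; rewrite restrict_EFin; apply; exact: mcircle.
have lG : locally_integrable setT G by exact: (integrable_locally mcircle ig).
have iy (y : R) : mu.-integrable `]-oo, y] (EFin \o G).
  by apply: integrableS iG => //; exact: measurable_itv.
have := FTC1Ny iy lG.
move=> H; apply: (ae_mono2 (ae_notin3 0 0 (2 * pi)) H) => t [t0 _ t2] [_ Ft] ct.
have <- : G t = g t by rewrite /G patchE mem_set.
rewrite -Ft.
have tp : 0 < t < 2 * pi.
  by move: ct; rewrite /circle /= in_itv /= => /andP[? ?]; rewrite !lt_neqAle eq_sym t0 t2; apply/andP.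
have F0 (x : R) : 0 < x <= 2 * pi -> \int[mu]_(s in `]-oo, x]) G s = 0.
  move=> xp; rewrite -(h x xp) Rintegral_mkcond [RHS]Rintegral_mkcond.
  apply: eq_Rintegral => s _; rewrite /G !patchE.
  case: ifPn; rewrite ?inE /= ?in_itv /= => sx.
    by case: ifPn; rewrite // sx mulr1.
  case: ifPn => // _; move: sx; rewrite notin_setE /= in_itv /= => /negP/negbTE ->.
  by rewrite mulr0.
rewrite derive1E; have <- : 'D_1 (cst 0) t = 0 :> R by exact: derive_cst.
apply: near_eq_derive.
have : \forall y \near t, y \in `]0, 2 * pi[ by apply: near_in_itvoo; rewrite in_itv.
apply: filterS => y; rewrite in_itv /= => /andP[y0 y2]; rewrite F0//.
by rewrite y0 ltW.
Qed.

Lemma ae_eq0_of_trig_orthogonal g :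
  mu.-integrable circle (fun t => (g t)%:E) ->
  (forall T : R -> R, trig (fun t => (T t)%:C%C) -> \int[mu]_(t in circle) (g t * T t) = 0) ->
  {ae mu, forall t, circle t -> g t = 0}.
Proof.
move=> ig h; apply: ae_eq0_of_initial_segments => // x xp.
exact: orthogonal_initial_segment.
Qed.

(** The real and imaginary parts are orthogonal to all real trigonometric
    polynomials, hence to the indicators of initial segments, which are bounded
    limits of such polynomials; the primitives then vanish. *)
Lemma fourier_uniqueness f : L1 f -> (forall n, fourier f n = 0) ->
  {ae mu, forall t, circle t -> f t = 0}.
Proof.
move=> f1 f0; have [iRe iIm] := f1.
have orth (T : R -> R) : trig (fun t => (T t)%:C%C) ->
    \int[mu]_(t in circle) (Re (f t) * T t) = 0 /\
    \int[mu]_(t in circle) (Im (f t) * T t) = 0.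
  move=> tT; have [|_] := trig_orthogonal f1 _ tT.
    by move=> n; rewrite -(opprK n) -fourierE.
  have pi0 : (2 * pi)^-1 != 0 :> R by rewrite invr_eq0 gt_eqF// pi2_gt0.
  rewrite /cmean => -[] /eqP; rewrite mulf_eq0 (negbTE pi0) /= => /eqP e1.
  move=> /eqP; rewrite mulf_eq0 (negbTE pi0) /= => /eqP e2.
  split; [rewrite -[RHS]e1|rewrite -[RHS]e2]; apply: eq_Rintegral => t _.
    by rewrite ReM /= mulr0 subr0.
  by rewrite ImM /= mulr0 add0r.
have hRe := ae_eq0_of_trig_orthogonal iRe (fun T tT => (orth T tT).1).
have hIm := ae_eq0_of_trig_orthogonal iIm (fun T tT => (orth T tT).2).
apply: (ae_mono2 hRe hIm) => t h1 h2 ct.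
by apply: complexP; rewrite /= ?h1 ?h2.
Qed.

End Uniqueness.

(** * Completeness of the space of square integrable functions *)

Section Completeness.
Context {R : realType}.
Implicit Types (f g h : R -> R[i]).
Local Notation mu := (@lebesgue_measure R).

Definition L2sq f : R := Re (ip f f).

Lemma integral_normsq f : L2 f ->
  (\int[mu]_(t in circle) (normsq (f t))%:E = (2 * pi * L2sq f)%:E)%E.
Proof.
move=> [_ _ i]; rewrite /L2sq Re_ip mulrA mulfV ?mul1r ?gt_eqF ?pi2_gt0//.
by rewrite /Rintegral fineK//; exact: (integrable_fin_num mcircle).
Qed.

Lemma cvg_of_summable_increments (u d : nat -> R) (B : R) :
  (forall k, `|u k.+1 - u k| <= d k) -> (forall n, \sum_(k < n) d k <= B) -> cvgn u.
Proof.
move=> ud dB; have d0 k : 0 <= d k by exact: le_trans (normr_ge0 _) (ud k).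
have cd : cvgn (series d).
  apply: nondecreasing_is_cvgn.
    by apply/nondecreasing_seqP => n; rewrite seriesSr lerDl; exact: d0.
  by exists B => _ [n _ <-]; rewrite seriesEord; exact: dB.
have : cvgn (series (telescope u)).
  by apply: normed_cvg; apply: series_le_cvg cd => // n; exact: normr_ge0.
move=> /cvg_ex[l]; rewrite telescopeK => ul.
have -> : u = (fun n => (u n - u 0%N) + u 0%N) by apply/funext => n; rewrite subrK.
by apply: is_cvgD; [apply: cvgP ul|exact: is_cvg_cst].
Qed.

Lemma nneseries_bound (d : nat -> R) : (forall k, 0 <= d k) ->
  (\sum_(k <oo) (d k)%:E)%E \is a fin_num -> exists B, forall n, \sum_(k < n) d k <= B.
Proof.
move=> d0 fin; exists (fine (\sum_(k <oo) (d k)%:E)%E) => n.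
rewrite -lee_fin fineK//.
have := @nneseries_lim_ge _ (fun k => (d k)%:E) xpredT 0 n.
rewrite big_mkord sumEFin; apply => k _ _; by rewrite lee_fin.
Qed.

(** Quadratic control of the increments of a rapidly Cauchy sequence gives
    almost everywhere convergence: [|z| <= 2^k |z|^2 + 2^-k] turns the bounds
    [4^-k] on the squared norms into summable bounds on the absolute values. *)
Lemma rapidly_cauchy_ae_cvg (F : nat -> R -> R[i]) :
  (forall n, L2 (F n)) -> (forall k, L2sq (fun t => F k.+1 t - F k t) <= 4^-1 ^+ k) ->
  {ae mu, forall t, circle t -> cvgn (fun k => Re (F k t)) /\ cvgn (fun k => Im (F k t))}.
Proof.
move=> F2 FD; pose d k t := 2 ^+ k * normsq (F k.+1 t - F k t) + 2^-1 ^+ k.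
have DF2 k : L2 (fun t => F k.+1 t - F k t) by exact: L2B.
have d0 k t : 0 <= d k t.
  by rewrite /d addr_ge0 ?mulr_ge0 ?normsq_ge0 ?exprn_ge0.
have md k : measurable_fun circle (fun t => (d k t)%:E).
  apply/measurable_EFinP; apply: measurable_funD; last exact: measurable_cst.
  by apply: measurable_funM; [exact: measurable_cst|exact: (cmfun_normsq (L2_cmfun (DF2 k)))].
have id_ k : (\int[mu]_(t in circle) (d k t)%:E <= (2 * (2 * pi) * 2^-1 ^+ k)%:E)%E.
  have [_ _ i1] := DF2 k.
  have i2 : mu.-integrable circle (fun _ : R => (2^-1 ^+ k)%:E).
    have [_ _ ] := L2_cst (1 : R[i]); move/(integrable_scale (2^-1 ^+ k)).
    by apply: eq_integrable => [|t _]; [exact: mcircle|rewrite /normsq /= expr1n expr0n addr0 mulr1].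
  rewrite (_ : (fun t => _) = (fun t => (2 ^+ k * normsq (F k.+1 t - F k t))%:E + (2^-1 ^+ k)%:E)%E)//.
  rewrite (integralD mcircle)//; last exact: integrable_scale.
  under eq_integral do rewrite EFinM.
  rewrite (integralZl mcircle)// integral_normsq// integral_cst; last exact: mcircle.
  rewrite [X in (_ + _ * X)%E]mu_circle -!EFinM -EFinD lee_fin.
  have h1 := FD k; have pi2 := @pi2_gt0 R.
  have h2 : 2 ^+ k * (4^-1) ^+ k = 2^-1 ^+ k :> R.
    by rewrite -exprMn; congr (_ ^+ _); field.
  have h3 : 2 ^+ k * L2sq (fun t => F k.+1 t - F k t) <= 2^-1 ^+ k.
    by rewrite -h2 ler_wpM2l// exprn_ge0.
  nra.
have isum : mu.-integrable circle (fun t => \sum_(k <oo) (d k t)%:E)%E.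
  apply/integrableP; split.
    by apply: ge0_emeasurable_sum => [k t _ _|k _]; [rewrite lee_fin|exact: md].
  rewrite (_ : (\int[mu]_(t in circle) _)%E =
               (\int[mu]_(t in circle) \sum_(k <oo) (d k t)%:E)%E); last first.
    by apply: eq_integral => t _; rewrite gee0_abs// nneseries_ge0// => k _ _; rewrite lee_fin.
  rewrite integral_nneseries//; last 2 first.
  - exact: mcircle.
  - by move=> k t _; rewrite lee_fin.
  apply: (@le_lt_trans _ _ (2 * (2 * pi) * 2)%:E); last exact: ltry.
  apply: lime_le; first by apply: is_cvg_nneseries => k _ _; apply: integral_ge0 => t _; rewrite lee_fin.
  apply: nearW => n; apply: (@le_trans _ _ (\sum_(0 <= k < n) (2 * (2 * pi) * 2^-1 ^+ k)%:E)%E).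
    by apply: lee_sum => k _; exact: id_.
  rewrite sumEFin lee_fin -mulr_sumr ler_wpM2l//.
    by have := @pi2_gt0 R; lra.
  suff -> : \sum_(0 <= k < n) 2^-1 ^+ k = 2 - 2 * 2^-1 ^+ n :> R.
    by rewrite gerBl mulr_ge0// exprn_ge0.
  elim: n => [|n ih]; first by rewrite big_nil expr0 mulr1 subrr.
  by rewrite big_nat_recr//= ih exprS; field.
apply: (ae_mono (integrable_ae mcircle isum)) => t h ct.
have [B hB] := nneseries_bound (fun k => d0 k t) (h ct).
have k2 k : (2 ^+ k : R) * 2^-1 ^+ k = 1 by rewrite -exprMn mulfV ?expr1n.
have ineq k (a : R) z : a ^+ 2 <= normsq z -> `|a| <= 2 ^+ k * normsq z + 2^-1 ^+ k.
  move=> az; have p0 : 0 < 2 ^+ k :> R by rewrite exprn_gt0.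
  have q0 : 0 < 2^-1 ^+ k :> R by rewrite exprn_gt0// invr_gt0.
  have e := k2 k; set p := (2 ^+ k : R) in e p0 *; set q := (2^-1 ^+ k : R) in e q0 *.
  have : `|a| <= p * a ^+ 2 + q.
    rewrite -real_normK ?num_real//; set b := `|a|.
    have : 0 <= p * (b - q) ^+ 2 by rewrite mulr_ge0 ?sqr_ge0 ?ltW.
    have -> : p * (b - q) ^+ 2 = p * b ^+ 2 - 2 * (p * q) * b + (p * q) * q by ring.
    rewrite e => ?; have : 0 <= b by exact: normr_ge0.
    lra.
  by move=> /le_trans; apply; rewrite lerD2r ler_wpM2l// ltW.
split; apply: (@cvg_of_summable_increments _ (fun k => d k t) B) => // k.
  by rewrite -ReB; apply: ineq; exact: Re_le_normsq.
by rewrite -ImB; apply: ineq; exact: Im_le_normsq.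
Qed.

Lemma ae_limit_fun (F : nat -> R -> R[i]) : (forall n, L2 (F n)) ->
  {ae mu, forall t, circle t -> cvgn (fun k => Re (F k t)) /\ cvgn (fun k => Im (F k t))} ->
  exists g, cmfun g /\ {ae mu, forall t, circle t ->
    Re (F k t) @[k --> \oo] --> Re (g t) /\ Im (F k t) @[k --> \oo] --> Im (g t)}.
Proof.
move=> F2 h.
pose lim_ (a : R[i] -> R) t := fine (limn_esup (fun k => (a (F k t))%:E)).
exists (fun t => Complex (lim_ (@Re R) t) (lim_ (@Im R) t)); split.
  by split; apply: (measurableT_comp (@fine_measurable R setT _)) => //;
    apply: measurable_fun_limn_esup => n; apply/measurable_EFinP; have [] := F2 n.
have lE (u : nat -> R) : cvgn u -> fine (limn_esup (fun k => (u k)%:E)) = limn u.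
  move=> cu; have e : (u k)%:E @[k --> \oo] --> (limn u)%:E by apply: cvg_EFin => //; exact: nearW.
  by rewrite (cvg_limn_einf_sup e).2.
apply: (ae_mono h) => t /[apply] -[c1 c2] /=.
by rewrite /lim_ !lE.
Qed.

Lemma cvg_normsq (u : nat -> R[i]) z : Re (u k) @[k --> \oo] --> Re z ->
  Im (u k) @[k --> \oo] --> Im z -> normsq (u k) @[k --> \oo] --> normsq z.
Proof. by move=> c1 c2; apply: cvgD; rewrite expr2; apply: cvgM. Qed.

(** Fatou's lemma for the squared moduli. *)
Lemma fatou_L2 (F : nat -> R -> R[i]) g (C : R) : (forall n, L2 (F n)) -> cmfun g ->
  {ae mu, forall t, circle t ->
    Re (F k t) @[k --> \oo] --> Re (g t) /\ Im (F k t) @[k --> \oo] --> Im (g t)} ->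
  (forall n, L2sq (F n) <= C) -> L2 g /\ L2sq g <= C.
Proof.
move=> F2 mg h FC.
have mF n : measurable_fun circle (fun t => (normsq (F n t))%:E).
  by apply/measurable_EFinP; exact: (cmfun_normsq (L2_cmfun (F2 n))).
have mng : measurable_fun circle (fun t => (normsq (g t))%:E).
  by apply/measurable_EFinP; exact: (cmfun_normsq mg).
have ig : (\int[mu]_(t in circle) (normsq (g t))%:E <= (2 * pi * C)%:E)%E.
  have := @fatou _ _ _ mu circle mcircle _ mF (fun n t _ => _).
  rewrite (_ : (\int[mu]_(t in circle) limn_einf _)%E = (\int[mu]_(t in circle) (normsq (g t))%:E)%E); last first.
    apply: ge0_ae_eq_integral => //; first exact: mcircle.
    - have -> : (fun x : R => limn_einf (fun n => (normsq (F n x))%:E)) =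
          (fun x => - limn_esup (fun n => - (normsq (F n x))%:E))%E.
        by apply/funext => x; rewrite -limn_einfN; congr limn_einf; apply/funext => n /=; rewrite opprK.
      by apply: measurableT_comp => //; apply: measurable_fun_limn_esup => n; apply: measurableT_comp => //; exact: mF.
    - move=> x _; rewrite limn_einf_lim; apply: lime_ge; first exact: is_cvg_einfs.
      by apply: nearW => n; apply: le_ereal_inf_tmp => _ [m _ <-]; rewrite lee_fin normsq_ge0.
    - by move=> x _; rewrite lee_fin normsq_ge0.
    - apply: (ae_mono h) => t /[apply] -[c1 c2].
      have e : (normsq (F k t))%:E @[k --> \oo] --> (normsq (g t))%:E.
        by apply: cvg_EFin; [exact: nearW|exact: cvg_normsq].
      by rewrite (cvg_limn_einf_sup e).1.
  move=> H; apply: (le_trans (H _)).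
    by move=> n t; rewrite lee_fin normsq_ge0.
  rewrite limn_einf_lim; apply: lime_le; first exact: is_cvg_einfs.
  apply: nearW => n; apply: (@le_trans _ _ (\int[mu]_(t in circle) (normsq (F n t))%:E)%E).
    by apply: ereal_inf_lbound; exists n => /=.
  by rewrite integral_normsq// lee_fin ler_wpM2l// ltW// pi2_gt0.
have L2g : L2 g.
  case: (mg) => m1 m2; split => //; apply/integrableP; split => //.
  apply: (@le_lt_trans _ _ (2 * pi * C)%:E); last exact: ltry.
  by apply: le_trans ig; rewrite le_eqVlt; apply/orP; left; apply/eqP; apply: eq_integral => t _; rewrite gee0_abs// lee_fin normsq_ge0.
split => //; move: ig; rewrite integral_normsq// lee_fin ler_pM2l//; exact: pi2_gt0.
Qed.

(** A rapidly Cauchy subsequence converges almost everywhere, and Fatou's lemma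
    bounds the distance of its limit to the terms of the whole sequence. *)
Lemma L2_complete (F : nat -> R -> R[i]) (e : nat -> R) : (forall n, L2 (F n)) ->
  e @ \oo --> (0 : R) ->
  (forall m n, (m <= n)%N -> L2sq (fun t => F n t - F m t) <= e m) ->
  exists2 g, L2 g & forall m, L2sq (fun t => g t - F m t) <= e m.
Proof.
move=> F2 e0 Fe.
have /choice[N hN] (k : nat) : exists N, forall m, (N <= m)%N -> e m <= 4^-1 ^+ k.
  have p0 : 0 < 4^-1 ^+ k :> R by rewrite exprn_gt0// invr_gt0.
  have /cvgrPdist_le/(_ _ p0) [N _ hN] := e0.
  exists N => m /hN /=; rewrite sub0r normrN; exact: le_trans (ler_norm _).
pose phi k := (k + \sum_(i < k.+1) N i)%N.
have phiS k : (phi k <= phi k.+1)%N by rewrite /phi [in leqRHS]big_ord_recr /= leq_add// leq_addr.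
have phiN k : (N k <= phi k)%N by rewrite /phi big_ord_recr /= addnA leq_addl.
have phik k : (k <= phi k)%N by rewrite /phi leq_addr.
have phi_mono : {homo phi : m n / (m <= n)%N >-> (m <= n)%N}.
  by apply: homo_leq => [//||//]; [exact: leq_trans].
have [g [mg hg]] := ae_limit_fun (fun k => F2 (phi k))
  (rapidly_cauchy_ae_cvg (fun k => F2 (phi k)) (fun k => le_trans (Fe _ _ (phiS k)) (hN _ _ (phiN k)))).
have key m : L2 (fun t => g t - F m t) /\ L2sq (fun t => g t - F m t) <= e m.
  apply: (@fatou_L2 (fun k t => F (phi (k + m)%N) t - F m t)).
  - by move=> n; exact: L2B.
  - by apply: cmfunD => //; under eq_fun do rewrite -mulN1r; apply: cmfunZ; exact: L2_cmfun.
  - apply: (ae_mono hg) => t /[apply] -[c1 c2]; split.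
      under eq_fun do rewrite ReB; rewrite ReB; apply: cvgB; last exact: cvg_cst.
      by rewrite (@cvg_shiftn m _ (fun k => Re (F (phi k) t))).
    under eq_fun do rewrite ImB; rewrite ImB; apply: cvgB; last exact: cvg_cst.
    by rewrite (@cvg_shiftn m _ (fun k => Im (F (phi k) t))).
  - by move=> n; apply: Fe; apply: leq_trans (phik _); rewrite leq_addl.
exists g => [|m]; last by have [] := key m.
have -> : g = (fun t => (g t - F 0%N t) + F 0%N t) by apply/funext => t; rewrite subrK.
by apply: L2D => //; have [] := key 0%N.
Qed.

End Completeness.

(** * Limits of complex sequences *)

Section ComplexLimits.
Context {R : realType}.
Implicit Types (u v : nat -> R[i]) (z w : R[i]).

Lemma conjc_sum I (r : seq I) (P : pred I) (F : I -> R[i]) :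
  conjc (\sum_(i <- r | P i) F i) = \sum_(i <- r | P i) conjc (F i).
Proof. exact: rmorph_sum. Qed.

Definition ccvg u z := Re (u k) @[k --> \oo] --> Re z /\ Im (u k) @[k --> \oo] --> Im z.

Lemma ccvg_unique u z w : ccvg u z -> ccvg u w -> z = w.
Proof.
by move=> [c1 c2] [d1 d2]; apply: complexP; [exact: cvg_unique c1 d1|exact: cvg_unique c2 d2].
Qed.

Lemma ccvg_cst z : ccvg (fun=> z) z.
Proof. by split; exact: cvg_cst. Qed.

Lemma ccvgD u v z w : ccvg u z -> ccvg v w -> ccvg (fun k => u k + v k) (z + w).
Proof.
by move=> [c1 c2] [d1 d2]; split;
  [under eq_fun do rewrite ReD; rewrite ReD|under eq_fun do rewrite ImD; rewrite ImD];
  exact: cvgD.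
Qed.

Lemma ccvgJ u z : ccvg u z -> ccvg (fun k => conjc (u k)) (conjc z).
Proof.
move=> [c1 c2]; split; first by under eq_fun do rewrite ReJ; rewrite ReJ.
by under eq_fun do rewrite ImJ; rewrite ImJ; exact: cvgN.
Qed.

Lemma ccvgM u v z w : ccvg u z -> ccvg v w -> ccvg (fun k => u k * v k) (z * w).
Proof.
move=> [c1 c2] [d1 d2]; split.
  by under eq_fun do rewrite ReM; rewrite ReM; apply: cvgB; exact: cvgM.
by under eq_fun do rewrite ImM; rewrite ImM; apply: cvgD; exact: cvgM.
Qed.

Lemma ccvgZ c u z : ccvg u z -> ccvg (fun k => c * u k) (c * z).
Proof. by move=> uz; apply: ccvgM => //; exact: ccvg_cst. Qed.

Lemma ccvg_shift u z (m : nat) : ccvg u z -> ccvg (fun k => u (k + m)%N) z.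
Proof.
move=> [c1 c2]; split; first by rewrite (@cvg_shiftn m _ (fun k => Re (u k))).
by rewrite (@cvg_shiftn m _ (fun k => Im (u k))).
Qed.

Lemma ccvg_squeeze u z (e : nat -> R) : e @ \oo --> (0 : R) ->
  (forall n, normsq (z - u n) <= e n) -> ccvg u z.
Proof.
move=> e0 ue.
have e00 n : 0 <= e n by exact: le_trans (normsq_ge0 _) (ue n).
have se : Num.sqrt (e n) @[n --> \oo] --> (0 : R).
  by rewrite -[X in _ --> X]sqrtr0; exact: (cvg_comp _ _ e0 (@sqrt_continuous R 0)).
have main (a : R[i] -> R) : (forall z w, a (z - w) = a z - a w) ->
    (forall z, a z ^+ 2 <= normsq z) -> a (u n) @[n --> \oo] --> a z.
  move=> aB an; apply/cvgrPdist_le => d d0.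
  have /cvgrPdist_le/(_ _ d0) := se.
  apply: filterS => n; rewrite sub0r normrN ger0_norm ?sqrtr_ge0//; apply: le_trans.
  rewrite -(@ler_sqr _ _ (Num.sqrt _)) ?nnegrE ?sqrtr_ge0// sqr_sqrtr//.
  by rewrite real_normK ?num_real// -aB (le_trans (an _)).
split; apply: main.
- exact: ReB.
- exact: Re_le_normsq.
- exact: ImB.
- exact: Im_le_normsq.
Qed.

Lemma ccvg_normsq_le u z (C : R) : ccvg u z -> (forall n, normsq (u n) <= C) -> normsq z <= C.
Proof.
move=> [c1 c2] h; have c := cvg_normsq c1 c2.
rewrite -(cvg_lim (@Rhausdorff R) c); apply: limr_le; first exact: cvgP c.
exact: nearW.
Qed.

End ComplexLimits.

(** * The Riesz-Fischer theorem and the identity of Parseval *)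

Section RieszFischer.
Context {R : realType}.
Implicit Types (f g h : R -> R[i]) (r : seq int) (c : int -> R[i]).
Local Notation mu := (@lebesgue_measure R).

Lemma L2sq_ge0 f : 0 <= L2sq f. Proof. exact: Re_ip_ge0. Qed.

Lemma L2sqZ z f : L2 f -> L2sq (fun t => z * f t) = normsq z * L2sq f.
Proof.
move=> f2; rewrite /L2sq ipZl ?ipZr//; last exact: L2Z.
by rewrite mulrA -normsqE (ipE f) -rmorphM.
Qed.

Lemma L2sqN f : L2sq (fun t => - f t) = L2sq f.
Proof. by congr Re; apply: eq_cmean => t; rewrite conjcN mulrNN. Qed.

Lemma L2sqB_le f g : L2 f -> L2 g -> L2sq (fun t => f t - g t) <= 2 * L2sq f + 2 * L2sq g.
Proof.
move=> f2 g2; have := @ip_expand _ f g 1 f2 g2; have := @ip_expand _ f g (-1) f2 g2.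
have := L2sq_ge0 (fun t => f t - -1 * g t); rewrite /L2sq.
rewrite (_ : (fun t => f t - 1 * g t) = (fun t => f t - g t)); last first.
  by apply/funext => t; rewrite mul1r.
rewrite conjcN conjc1 mul1r mulN1r ReN normsqN.
have -> : normsq (1 : R[i]) = 1 by rewrite /normsq /= expr1n expr0n addr0.
lra.
Qed.

Lemma L2sqD_le f g : L2 f -> L2 g -> L2sq (fun t => f t + g t) <= 2 * L2sq f + 2 * L2sq g.
Proof.
move=> f2 g2; have := L2sqB_le f2 (L2N g2); rewrite L2sqN.
by under eq_fun do rewrite opprK.
Qed.

Lemma normsq_fourier_le f n : L2 f -> normsq (fourier f n) <= L2sq f.
Proof.
move=> f2; apply: le_trans (ip_CS f2 (L2_expi n)) _.
by rewrite ip_expi eqxx mulr1.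
Qed.

Definition trigsum r c : R -> R[i] := fun t => \sum_(n <- r) c n * expi n t.

Lemma L2_trigsum r c : L2 (trigsum r c).
Proof. by apply: L2_sum => n; apply: L2Z; exact: L2_expi. Qed.

Lemma fourier_trigsum r c m : uniq r ->
  fourier (trigsum r c) m = if m \in r then c m else 0.
Proof.
move=> ur; rewrite fourier_sum; last by move=> n; apply: L2Z; exact: L2_expi.
rewrite (eq_bigr (fun n => c n * (n == m)%:R)); last first.
  by move=> n _; rewrite fourierZ ?fourier_expi//; exact: L2_expi.
case: ifPn => mr.
  rewrite (bigD1_seq m)//= eqxx mulr1 big1 ?addr0// => n /negbTE ->.
  by rewrite mulr0.
rewrite big1_seq// => n /= nr; have [e|_] := eqVneq n m; last by rewrite mulr0.
by rewrite -e nr in mr.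
Qed.

Lemma ip_trigsum f r c : L2 f ->
  ip f (trigsum r c) = \sum_(n <- r) conjc (c n) * fourier f n.
Proof.
move=> f2; rewrite -(ipJ (L2_trigsum r c) f2) ip_suml//; last first.
  by move=> n; apply: L2Z; exact: L2_expi.
rewrite conjc_sum; apply: eq_bigr => n _.
by rewrite (ipZl _ (L2_expi n) f2) conjcM (ipJ (L2_expi n) f2).
Qed.

Lemma L2sq_trigsum r c : uniq r -> L2sq (trigsum r c) = \sum_(n <- r) normsq (c n).
Proof.
move=> ur; rewrite /L2sq ip_trigsum ?Re_sum; last exact: L2_trigsum.
apply: eq_big_seq => n nr; rewrite fourier_trigsum// nr mulrC -normsqE //.
Qed.

(** The remainder is orthogonal to the partial sum. *)
Lemma bessel f r : L2 f -> uniq r ->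
  L2sq (fun t => f t - trigsum r (fourier f) t) = L2sq f - \sum_(n <- r) normsq (fourier f n).
Proof.
move=> f2 ur; have := @ip_expand _ f (trigsum r (fourier f)) 1 f2 (L2_trigsum _ _).
rewrite (_ : (fun t => f t - 1 * _) = (fun t => f t - trigsum r (fourier f) t)); last first.
  by apply/funext => t; rewrite mul1r.
rewrite /L2sq => ->; rewrite -/(L2sq (trigsum _ _)) L2sq_trigsum// ip_trigsum// conjc1 mul1r Re_sum.
have -> : normsq (1 : R[i]) = 1 by rewrite /normsq /= expr1n expr0n addr0.
rewrite (eq_bigr (fun n => normsq (fourier f n))); first by ring.
by move=> n _; rewrite mulrC -normsqE.
Qed.

(** Symmetric blocks of frequencies; [freqs 0 N] exhausts the integers. *)
Definition freqs (m k : nat) : seq int :=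
  map Posz (iota m (k - m)) ++ map Negz (iota m (k - m)).

Lemma uniq_freqs m k : uniq (freqs m k).
Proof.
rewrite cat_uniq !map_inj_uniq ?iota_uniq//=; try by move=> ? ? [].
by rewrite andbT; apply/hasPn => x /mapP[i _ ->]; apply/negP => /mapP[].
Qed.

Lemma mem_freqs (n : int) k : (n \in freqs 0 k) = (match n with Posz i => i | Negz i => i end < k)%N.
Proof.
rewrite mem_cat subn0; case: n => i.
  rewrite (mem_map (fun x y (e : Posz x = Posz y) => let: erefl := e in erefl)) mem_iota /= add0n.
  by rewrite orbC; case: mapP => // -[].
rewrite orbC (mem_map (fun x y (e : Negz x = Negz y) => let: erefl := e in erefl)) mem_iota /= add0n.
by rewrite orbC; case: mapP => // -[].
Qed.

Lemma sum_freqs (V : nmodType) (G : int -> V) m k :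
  \sum_(n <- freqs m k) G n = \sum_(m <= i < k) (G (Posz i) + G (Negz i)).
Proof. by rewrite big_cat /= !big_map -big_split /index_iota. Qed.

(** The partial sums are Cauchy because the norm of a block of terms is the
    corresponding block of the series of the squared moduli. *)
Lemma riesz_fischer c (B : R) :
  (forall N, \sum_(0 <= i < N) (normsq (c (Posz i)) + normsq (c (Negz i))) <= B) ->
  exists f, [/\ L2 f, forall n, fourier f n = c n &
    (fun N => L2sq (fun t => f t - trigsum (freqs 0 N) c t)) @ \oo --> (0 : R)].
Proof.
move=> hB; pose a N := \sum_(0 <= i < N) (normsq (c (Posz i)) + normsq (c (Negz i))).
have a_nd : nondecreasing_seq a.
  apply/nondecreasing_seqP => n; rewrite /a big_nat_recr//= lerDl.
  by rewrite addr_ge0 ?normsq_ge0.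
have ca : cvgn a by apply: nondecreasing_is_cvgn => //; exists B => _ [n _ <-]; exact: hB.
pose e N := limn a - a N.
have e0 : e @ \oo --> (0 : R).
  by rewrite -(subrr (limn a)); apply: cvgB => //; exact: cvg_cst.
have [f f2 hf] : exists2 g, L2 g & forall m, L2sq (fun t => g t - trigsum (freqs 0 m) c t) <= e m.
  apply: L2_complete => //; first by move=> n; exact: L2_trigsum.
  move=> m n mn; have -> : (fun t => trigsum (freqs 0 n) c t - trigsum (freqs 0 m) c t) = trigsum (freqs m n) c.
    apply/funext => t; rewrite /trigsum !sum_freqs (@big_cat_nat _ _ _ m 0 n)//=.
    by rewrite addrAC subrr add0r.
  rewrite L2sq_trigsum ?uniq_freqs// sum_freqs.
  have -> : \sum_(m <= i < n) (normsq (c (Posz i)) + normsq (c (Negz i))) = a n - a m.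
    by rewrite /a (@big_cat_nat _ _ _ m 0 n)//= addrAC subrr add0r.
  by rewrite /e lerD2r; exact: nondecreasing_cvgn_le.
exists f; split => //.
- move=> n; apply/eqP; rewrite -subr_eq0; apply/eqP/normsq_eq0/eqP.
  rewrite eq_le normsq_ge0 andbT.
  rewrite -(cvg_lim (@Rhausdorff R) e0); apply: limr_ge; first exact: cvgP e0.
  exists (match n with Posz i => i | Negz i => i end).+1 => // N /= nN.
  apply: le_trans (hf N); apply: le_trans (normsq_fourier_le n _); last by apply: L2B => //; exact: L2_trigsum.
  rewrite fourierB//; last exact: L2_trigsum.
  by rewrite fourier_trigsum ?uniq_freqs// mem_freqs nN.
- apply: (@squeeze_cvgr _ _ _ _ (cst 0) e) => //; last exact: cvg_cst.
  by apply: nearW => n; rewrite L2sq_ge0 hf.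
Qed.

Lemma aeq_cmean f g : cmfun f -> cmfun g -> aeq f g -> cmean f = cmean g.
Proof.
move=> [f1 f2] [g1 g2] fg; apply: complexP => /=; congr (_ * fine _);
  apply: ae_eq_integral; try exact: mcircle; try exact/measurable_EFinP;
  by apply: (ae_mono fg) => t /[apply] ->.
Qed.

Lemma aeq_ip f g h k : L2 f -> L2 g -> L2 h -> L2 k -> aeq f g -> aeq h k -> ip f h = ip g k.
Proof.
move=> f2 g2 h2 k2 fg hk; apply: aeq_cmean.
- by apply: L1_cmfun; exact: L1_ip.
- by apply: L1_cmfun; exact: L1_ip.
- by apply: (ae_mono2 fg hk) => t e1 e2 ct; rewrite e1// e2.
Qed.

Lemma fourier_inj f g : L2 f -> L2 g -> fourier f =1 fourier g -> aeq f g.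
Proof.
move=> f2 g2 fg; have := @fourier_uniqueness _ (fun t => f t - g t).
case; first by apply: L2_L1; exact: L2B.
  by move=> n; rewrite fourierB// fg subrr.
move=> N [mN N0 h]; exists N; split => // t ht; apply: h => h; apply: ht => ct.
by apply/eqP; rewrite -subr_eq0 h.
Qed.

(** The function is equal to the one that the Riesz-Fischer theorem builds from
    its coefficients. *)
Lemma fourier_partial_sums f : L2 f ->
  (fun N => L2sq (fun t => f t - trigsum (freqs 0 N) (fourier f) t)) @ \oo --> (0 : R).
Proof.
move=> f2; have [N|g [g2 gc]] := @riesz_fischer (fourier f) (L2sq f).
  rewrite -(sum_freqs (fun n => normsq (fourier f n))) -subr_ge0 -bessel ?uniq_freqs//; exact: L2sq_ge0.
apply: cvg_trans; rewrite (_ : (fun N => _) = (fun N => L2sq (fun t => g t - trigsum (freqs 0 N) (fourier f) t)))//.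
apply/funext => N; have t2 := L2_trigsum (freqs 0 N) (fourier f).
have fg := fourier_inj f2 g2 (fun n => esym (gc n)).
have d : aeq (fun t => f t - trigsum (freqs 0 N) (fourier f) t) (fun t => g t - trigsum (freqs 0 N) (fourier f) t).
  by apply: (ae_mono fg) => t /[apply] ->.
by congr Re; apply: aeq_ip => //; exact: L2B.
Qed.

Lemma parseval f g : L2 f -> L2 g ->
  ccvg (fun N => \sum_(n <- freqs 0 N) fourier f n * conjc (fourier g n)) (ip f g).
Proof.
move=> f2 g2.
apply: (@ccvg_squeeze _ _ _ (fun N => L2sq (fun t => f t - trigsum (freqs 0 N) (fourier f) t) * L2sq g)).
  by rewrite -(mul0r (L2sq g)); apply: cvgM; [exact: fourier_partial_sums|exact: cvg_cst].
move=> N; have t2 := L2_trigsum (freqs 0 N) (fourier f).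
have -> : \sum_(n <- freqs 0 N) fourier f n * conjc (fourier g n) = ip (trigsum (freqs 0 N) (fourier f)) g.
  rewrite -(ipJ g2 t2) ip_trigsum// conjc_sum; apply: eq_bigr => n _.
  by rewrite conjcM conjcK.
by rewrite -ipBl//; apply: ip_CS => //; exact: L2B.
Qed.

End RieszFischer.

(** * Square summable sequences *)

Section SquareSummable.
Context {R : realType}.
Implicit Types (x y z : nat -> R[i]) (w p q : nat -> R) (A B C : R).

(** A bound on the squared norm in the weighted space [l^2(w)], as a relation:
    no infinite sum has to be shown to converge. *)
Definition bd w x B := forall N, \sum_(k < N) w k * normsq (x k) <= B.

Definition w1 : nat -> R := fun=> 1.

Definition l2 x := exists B, bd w1 x B.

Lemma sum_CS (I : Type) (r : seq I) (P : pred I) (c : I -> R[i]) (p q : I -> R) :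
  (forall i, 0 <= p i) -> (forall i, 0 <= q i) ->
  (forall i, normsq (c i) <= p i * q i) ->
  normsq (\sum_(i <- r | P i) c i) <= (\sum_(i <- r | P i) p i) * (\sum_(i <- r | P i) q i).
Proof.
move=> p0 q0 h; elim: r => [|i r ih]; first by rewrite !big_nil normsq0 mulr0.
rewrite !big_cons; case: ifP => // _.
set D := \sum_(j <- r | P j) c j in ih *.
set Sp := \sum_(j <- r | P j) p j in ih *; set Sq := \sum_(j <- r | P j) q j in ih *.
have Sp0 : 0 <= Sp by exact: sumr_ge0.
have Sq0 : 0 <= Sq by exact: sumr_ge0.
have e : normsq (c i + D) = normsq (c i) + normsq D + 2 * Re (c i * conjc D).
  rewrite /normsq !ReImE; ring.
have h1 : Re (c i * conjc D) ^+ 2 <= (p i * q i) * (Sp * Sq).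
  apply: le_trans (Re_le_normsq _) _; rewrite normsqM normsqJ.
  by rewrite ler_pM ?normsq_ge0.
have h2 : `|2 * Re (c i * conjc D)| <= p i * Sq + Sp * q i.
  rewrite -ler_sqr ?nnegrE ?addr_ge0 ?mulr_ge0// real_normK ?num_real// exprMn.
  have := sqr_ge0 (p i * Sq - Sp * q i).
  have -> : (p i * Sq + Sp * q i) ^+ 2 = (p i * Sq - Sp * q i) ^+ 2 + 4 * ((p i * q i) * (Sp * Sq)) by ring.
  lra.
have := h i; have := ler_norm (2 * Re (c i * conjc D)).
rewrite e; have -> : (p i + Sp) * (q i + Sq) = p i * q i + p i * Sq + Sp * q i + Sp * Sq by ring.
by move=> t1 t2; apply: le_trans (lerD (lerD t2 ih) (le_trans t1 h2)) _; lra.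
Qed.

Lemma bd_ge0 w x B : bd w x B -> 0 <= B.
Proof. by move=> /(_ 0%N); rewrite big_ord0. Qed.

Lemma bd_mono w x A B : A <= B -> bd w x A -> bd w x B.
Proof. by move=> AB h N; exact: le_trans AB. Qed.

Lemma bd_weight_le w v x B : (forall k, v k <= w k) -> bd w x B -> bd v x B.
Proof.
move=> vw h N; apply: le_trans (h N); apply: ler_sum => k _.
by rewrite ler_wpM2r ?normsq_ge0.
Qed.

Lemma bdD w x y A B : (forall k, 0 <= w k) -> bd w x A -> bd w y B ->
  bd w (fun k => x k + y k) (2 * A + 2 * B).
Proof.
move=> w0 xA yB N.
apply: (@le_trans _ _ (2 * (\sum_(k < N) w k * normsq (x k)) + 2 * (\sum_(k < N) w k * normsq (y k)))).
  rewrite !mulr_sumr -big_split; apply: ler_sum => k _ /=.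
  have := normsqD (x k) (y k); have := w0 k; nra.
by apply: lerD; rewrite ler_wpM2l.
Qed.

Lemma bdZ w c x A : bd w x A -> bd w (fun k => c * x k) (normsq c * A).
Proof.
move=> xA N; apply: le_trans (ler_wpM2l (normsq_ge0 c) (xA N)); rewrite mulr_sumr.
by apply: ler_sum => k _; rewrite normsqM mulrCA.
Qed.

Lemma bdN w x A : bd w x A -> bd w (fun k => - x k) A.
Proof. by move=> xA N; under eq_bigr do rewrite normsqN; exact: xA. Qed.

Lemma bd_zero w : bd w (fun=> 0) 0.
Proof.
move=> N; rewrite big1; first exact: lexx.
by move=> k _; rewrite normsq0 mulr0.
Qed.

Lemma bdB w x y A B : (forall k, 0 <= w k) -> bd w x A -> bd w y B ->
  bd w (fun k => x k - y k) (2 * A + 2 * B).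
Proof. by move=> w0 xA /bdN yB; exact: bdD. Qed.

Lemma bd_entry w x A k : (forall k, 0 <= w k) -> bd w x A -> w k * normsq (x k) <= A.
Proof.
move=> w0 /(_ k.+1); rewrite big_ord_recr /=; apply: le_trans.
by rewrite lerDr sumr_ge0// => i _; rewrite mulr_ge0// normsq_ge0.
Qed.

Lemma bd_seg w x A m n : (forall k, 0 <= w k) -> bd w x A ->
  \sum_(m <= k < n) w k * normsq (x k) <= A.
Proof.
move=> w0 xA; have [mn|nm] := leqP m n; last first.
  by rewrite big_geq ?(bd_ge0 xA)// ltnW.
apply: le_trans (xA n); rewrite -(big_mkord xpredT (fun k => w k * normsq (x k))).
rewrite (@big_cat_nat _ _ _ m 0 n)//= lerDr sumr_ge0// => i _.
by rewrite mulr_ge0// normsq_ge0.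
Qed.

Lemma bd_shift w x A n : (forall k, 0 <= w k) -> (forall k, w k <= w (k + n)%N) -> bd w x A ->
  bd w (fun k => x (k + n)%N) A.
Proof.
move=> w0 wn xA N; apply: le_trans (bd_seg n (n + N)%N w0 xA).
rewrite -[X in \sum_(X <= _ < _) _]add0n big_addn addKn big_mkord.
by apply: ler_sum => k _; rewrite ler_wpM2r ?normsq_ge0.
Qed.

Lemma w1_ge0 k : 0 <= w1 k. Proof. exact: ler01. Qed.

Lemma l2D x y : l2 x -> l2 y -> l2 (fun k => x k + y k).
Proof. by move=> [A xA] [B yB]; exists (2 * A + 2 * B); apply: bdD => // k; exact: w1_ge0. Qed.
Lemma l2Z c x : l2 x -> l2 (fun k => c * x k).
Proof. by move=> [A xA]; exists (normsq c * A); exact: bdZ. Qed.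
Lemma l2N x : l2 x -> l2 (fun k => - x k).
Proof. by move=> [A xA]; exists A; exact: bdN. Qed.
Lemma l2B x y : l2 x -> l2 y -> l2 (fun k => x k - y k).
Proof. by move=> ? /l2N ?; exact: l2D. Qed.
Lemma l2_shift x n : l2 x -> l2 (fun k => x (k + n)%N).
Proof. by move=> [A xA]; exists A; apply: bd_shift => // k; exact: w1_ge0. Qed.

Lemma bd1E x B : bd w1 x B <-> forall N, \sum_(k < N) normsq (x k) <= B.
Proof.
split=> h N; have := h N; rewrite /w1; first by under eq_bigr do rewrite mul1r.
by under [in X in _ -> X]eq_bigr do rewrite mul1r.
Qed.

Definition pdot x y N := \sum_(k < N) x k * conjc (y k).

(** A limit of partial sums, so as to be defined on all sequences. *)
Definition dot x y : R[i] :=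
  Complex (limn (fun N => Re (pdot x y N))) (limn (fun N => Im (pdot x y N))).

Lemma dotP x y : l2 x -> l2 y -> ccvg (pdot x y) (dot x y).
Proof.
move=> [A /bd1E xA] [B /bd1E yB].
have dB n : \sum_(k < n) (normsq (x k) + normsq (y k)) <= A + B.
  by rewrite big_split lerD.
split; apply: (cvg_of_summable_increments (d := fun k => normsq (x k) + normsq (y k)) _ dB) => k.
  rewrite /pdot big_ord_recr /= -ReB addrAC subrr add0r.
  by rewrite -(normsqJ (y k)); exact: Re_mul_le.
rewrite /pdot big_ord_recr /= -ImB addrAC subrr add0r.
by rewrite -(normsqJ (y k)); exact: Im_mul_le.
Qed.

Lemma dot_eq x y (z : R[i]) : l2 x -> l2 y -> ccvg (pdot x y) z -> dot x y = z.
Proof. by move=> x2 y2; apply: ccvg_unique; exact: dotP. Qed.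

Lemma dotDl x y z : l2 x -> l2 y -> l2 z -> dot (fun k => x k + y k) z = dot x z + dot y z.
Proof.
move=> x2 y2 z2; apply: dot_eq => //; first exact: l2D.
have -> : pdot (fun k => x k + y k) z = (fun N => pdot x z N + pdot y z N).
  by apply/funext => N; rewrite -big_split; apply: eq_bigr => k _; rewrite mulrDl.
by apply: ccvgD; exact: dotP.
Qed.

Lemma dotZl c x z : l2 x -> l2 z -> dot (fun k => c * x k) z = c * dot x z.
Proof.
move=> x2 z2; apply: dot_eq => //; first exact: l2Z.
have -> : pdot (fun k => c * x k) z = (fun N => c * pdot x z N).
  by apply/funext => N; rewrite mulr_sumr; apply: eq_bigr => k _; rewrite mulrA.
by apply: ccvgZ; exact: dotP.
Qed.

Lemma dotJ x y : l2 x -> l2 y -> conjc (dot x y) = dot y x.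
Proof.
move=> x2 y2; apply/esym; apply: dot_eq => //.
have -> : pdot y x = (fun N => conjc (pdot x y N)).
  apply/funext => N; rewrite conjc_sum; apply: eq_bigr => k _.
  by rewrite conjcM conjcK mulrC.
by apply: ccvgJ; exact: dotP.
Qed.

Lemma dotNl x z : l2 x -> l2 z -> dot (fun k => - x k) z = - dot x z.
Proof.
move=> x2 z2; rewrite -mulN1r -(dotZl _ x2 z2); congr dot.
by apply/funext => k; rewrite mulN1r.
Qed.

Lemma dotBl x y z : l2 x -> l2 y -> l2 z -> dot (fun k => x k - y k) z = dot x z - dot y z.
Proof. by move=> x2 y2 z2; rewrite dotDl ?dotNl//; exact: l2N. Qed.

Lemma dotDr x y z : l2 x -> l2 y -> l2 z -> dot z (fun k => x k + y k) = dot z x + dot z y.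
Proof.
move=> x2 y2 z2; rewrite -(dotJ (l2D x2 y2) z2) dotDl// conjcD.
by rewrite (dotJ x2 z2) (dotJ y2 z2).
Qed.

Lemma dotZr c x z : l2 x -> l2 z -> dot z (fun k => c * x k) = conjc c * dot z x.
Proof. by move=> x2 z2; rewrite -(dotJ (l2Z c x2) z2) dotZl// conjcM (dotJ x2 z2). Qed.

Lemma dotNr x z : l2 x -> l2 z -> dot z (fun k => - x k) = - dot z x.
Proof. by move=> x2 z2; rewrite -(dotJ (l2N x2) z2) dotNl// conjcN (dotJ x2 z2). Qed.

Lemma dotBr x y z : l2 x -> l2 y -> l2 z -> dot z (fun k => x k - y k) = dot z x - dot z y.
Proof. by move=> x2 y2 z2; rewrite dotDr ?dotNr//; exact: l2N. Qed.

Lemma normsq_dot_le x y p q A B : l2 x -> l2 y ->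
  (forall k, 0 <= p k) -> (forall k, 0 <= q k) ->
  (forall k, normsq (x k * conjc (y k)) <= p k * q k) ->
  (forall N, \sum_(k < N) p k <= A) -> (forall N, \sum_(k < N) q k <= B) ->
  normsq (dot x y) <= A * B.
Proof.
move=> x2 y2 p0 q0 h pA qB; apply: (ccvg_normsq_le (dotP x2 y2)) => N.
have := @sum_CS 'I_N (index_enum _) xpredT _ _ _ (fun i => p0 i) (fun i => q0 i) (fun i => h i).
move=> /le_trans; apply.
by apply: ler_pM => //; [exact: sumr_ge0|exact: sumr_ge0|exact: pA|exact: qB].
Qed.

Lemma dot_CS x y A B : bd w1 x A -> bd w1 y B -> normsq (dot x y) <= A * B.
Proof.
move=> xA yB; apply: (@normsq_dot_le _ _ (fun k => normsq (x k)) (fun k => normsq (y k))).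
- by exists A.
- by exists B.
- by move=> k; exact: normsq_ge0.
- by move=> k; exact: normsq_ge0.
- by move=> k; rewrite normsqM normsqJ.
- by move/bd1E: xA.
- by move/bd1E: yB.
Qed.

Definition nsq x := Re (dot x x).

Lemma pdot_self x N : pdot x x N = (\sum_(k < N) normsq (x k))%:C%C.
Proof.
by rewrite rmorph_sum; apply: eq_bigr => k _; rewrite -normsqE.
Qed.

Lemma bd_nsq x : l2 x -> bd w1 x (nsq x).
Proof.
move=> x2; apply/bd1E => N; have [c _] := dotP x2 x2.
rewrite /nsq -(cvg_lim (@Rhausdorff R) c); apply: limr_ge; first exact: cvgP c.
exists N => // n /= Nn; rewrite pdot_self /=.
rewrite -(big_mkord xpredT (fun k => normsq (x k))) -(big_mkord xpredT (fun k => normsq (x k))).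
rewrite (@big_cat_nat _ _ _ N 0 n)//= lerDl sumr_ge0// => i _; exact: normsq_ge0.
Qed.

Lemma nsq_le x B : bd w1 x B -> nsq x <= B.
Proof.
move=> xB; have x2 : l2 x by exists B.
have [c _] := dotP x2 x2; rewrite /nsq -(cvg_lim (@Rhausdorff R) c).
apply: limr_le; first exact: cvgP c.
by apply: nearW => n; rewrite pdot_self /=; move/bd1E: xB; apply.
Qed.

Lemma nsq_ge0 x : l2 x -> 0 <= nsq x.
Proof. by move=> /bd_nsq/bd_ge0. Qed.

Lemma dot_selfE x : l2 x -> dot x x = (nsq x)%:C%C.
Proof.
move=> x2; have := congr1 (@Im R) (dotJ x2 x2); rewrite ImJ => e.
by apply: complexP => //; rewrite [RHS]/=; lra.
Qed.

Lemma nsq_eq0 x : l2 x -> nsq x <= 0 -> x = fun=> 0.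
Proof.
move=> x2 h; apply/funext => k; apply/normsq_eq0/eqP.
rewrite eq_le normsq_ge0 andbT; apply: le_trans h.
by have := bd_entry k w1_ge0 (bd_nsq x2); rewrite mul1r.
Qed.

End SquareSummable.

(** * Coefficients of Hardy functions *)

Section HardySequences.
Context {R : realType}.
Implicit Types (f g h : R -> R[i]) (x y : nat -> R[i]).

Definition coefs f : nat -> R[i] := fun k => fourier f (Posz k).

Lemma hardy_L2 f : hardy f -> L2 f. Proof. by case. Qed.

Lemma hardyD f g : hardy f -> hardy g -> hardy (fun t => f t + g t).
Proof.
move=> [f2 f0] [g2 g0]; split; first exact: L2D.
by move=> n n0; rewrite fourierD// f0// g0// addr0.
Qed.

Lemma hardyZ z f : hardy f -> hardy (fun t => z * f t).
Proof.
move=> [f2 f0]; split; first exact: L2Z.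
by move=> n n0; rewrite fourierZ// f0// mulr0.
Qed.

Lemma hardyN f : hardy f -> hardy (fun t => - f t).
Proof. by move=> /(hardyZ (-1)); under eq_fun do rewrite mulN1r. Qed.

Lemma hardyB f g : hardy f -> hardy g -> hardy (fun t => f t - g t).
Proof. by move=> ? ?; apply: hardyD => //; exact: hardyN. Qed.

Lemma coefsD f g : L2 f -> L2 g -> coefs (fun t => f t + g t) = fun k => coefs f k + coefs g k.
Proof. by move=> f2 g2; apply/funext => k; exact: fourierD. Qed.
Lemma coefsB f g : L2 f -> L2 g -> coefs (fun t => f t - g t) = fun k => coefs f k - coefs g k.
Proof. by move=> f2 g2; apply/funext => k; exact: fourierB. Qed.
Lemma coefsZ z f : L2 f -> coefs (fun t => z * f t) = fun k => z * coefs f k.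
Proof. by move=> f2; apply/funext => k; exact: fourierZ. Qed.

Lemma bd_coefs f : L2 f -> bd w1 (coefs f) (L2sq f).
Proof.
move=> f2; apply/bd1E => N.
have ur : uniq (map Posz (iota 0 N)) by rewrite map_inj_uniq ?iota_uniq// => ? ? [].
have := L2sq_ge0 (fun t => f t - trigsum (map Posz (iota 0 N)) (fourier f) t).
rewrite bessel// subr_ge0 big_map; apply: le_trans.
by rewrite -(big_mkord xpredT (fun k => normsq (fourier f (Posz k)))) /index_iota subn0.
Qed.

Lemma l2_coefs f : L2 f -> l2 (coefs f).
Proof. by move=> f2; exists (L2sq f); exact: bd_coefs. Qed.

Lemma Negz_lt0 i : Negz i < 0. Proof. by []. Qed.

Lemma parseval_hardy f g : L2 f -> hardy g -> ip f g = dot (coefs f) (coefs g).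
Proof.
move=> f2 [g2 g0]; apply/esym; apply: dot_eq; try exact: l2_coefs.
have := parseval f2 g2; congr ccvg; apply/funext => N.
rewrite sum_freqs big_mkord; apply: eq_bigr => k _.
by rewrite (g0 _ (Negz_lt0 k)) conjc0 mulr0 addr0.
Qed.

Lemma L2sq_nsq f : hardy f -> L2sq f = nsq (coefs f).
Proof. by move=> hf; rewrite /L2sq parseval_hardy//; exact: hardy_L2. Qed.

Lemma coefs_inj f g : hardy f -> hardy g -> coefs f = coefs g -> aeq f g.
Proof.
move=> [f2 f0] [g2 g0] e; apply: fourier_inj => // -[n|n].
  by have := congr1 (@^~ n) e.
by rewrite f0 ?g0.
Qed.

Lemma aeq_fourier f g n : L2 f -> L2 g -> aeq f g -> fourier f n = fourier g n.
Proof.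
move=> f2 g2 fg; apply: aeq_ip => //; try exact: L2_expi.
exact: ae_everywhere.
Qed.

Lemma aeq_coefs f g : L2 f -> L2 g -> aeq f g -> coefs f = coefs g.
Proof. by move=> f2 g2 fg; apply/funext => k; exact: aeq_fourier. Qed.

Lemma synthesis x : l2 x -> exists2 f, hardy f & coefs f = x.
Proof.
move=> [B /bd1E xB]; pose c (n : int) := if n is Posz k then x k else 0.
have [N|f [f2 fc _]] := @riesz_fischer _ c B.
  rewrite big_mkord; under eq_bigr do rewrite normsq0 addr0; exact: xB.
exists f; last by apply/funext => k; rewrite /coefs fc.
by split => // -[n|n] //; rewrite fc.
Qed.

Definition synth x : R -> R[i] := xget (fun=> 0) [set f | hardy f /\ coefs f = x].

Lemma synthP x : l2 x -> hardy (synth x) /\ coefs (synth x) = x.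
Proof. by move=> /synthesis[f hf fx]; rewrite /synth; case: xgetP => [g _ //|/(_ f)]; case. Qed.

(** The weight of [H^(1/2)]. *)
Definition w2 : nat -> R := fun k => 1 + k%:R.

Lemma w2_ge0 k : 0 <= w2 k. Proof. by rewrite /w2 addr_ge0. Qed.
Lemma w2_ge1 k : 1 <= w2 k. Proof. by rewrite lerDl. Qed.

Lemma H12_sumE f : hardy f ->
  (H12_sum f = \sum_(k <oo) (w2 k * normsq (coefs f k))%:E)%E.
Proof.
move=> [f2 f0]; rewrite nneseries_esumT; last first.
  by move=> n; rewrite lee_fin mulr_ge0 ?w2_ge0 ?normsq_ge0.
rewrite /H12_sum (esumID (range Posz)); last first.
  by move=> n _; rewrite lee_fin mulr_ge0 ?normsq_ge0// addr_ge0.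
rewrite [X in (_ + X)%E]esum1 ?adde0; last first.
  move=> [n|n] [_ /= h]; first by case: h; exists n.
  by rewrite f0// normsq0 mulr0.
by rewrite setTI esum_image//; move=> a b _ _ [].
Qed.

Lemma H12plus_bd u : H12plus u -> bd w2 (coefs u) (H12norm u ^+ 2).
Proof.
move=> [hu fin]; have g0 k : 0 <= w2 k * normsq (coefs u k) by rewrite mulr_ge0 ?w2_ge0 ?normsq_ge0.
have s0 : (0 <= H12_sum u)%E by rewrite H12_sumE//; apply: nneseries_ge0 => k _ _; rewrite lee_fin.
move=> N; rewrite sqr_sqrtr ?fine_ge0// -lee_fin fineK; last by rewrite ge0_fin_numE.
rewrite H12_sumE//; have := @nneseries_lim_ge _ (fun k => (w2 k * normsq (coefs u k))%:E) xpredT 0 N.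
by rewrite big_mkord sumEFin; apply => k _ _; rewrite lee_fin.
Qed.

Lemma bd_H12plus u B : hardy u -> bd w2 (coefs u) B -> H12plus u /\ H12norm u ^+ 2 <= B.
Proof.
move=> hu uB; have g0 k : 0 <= w2 k * normsq (coefs u k) by rewrite mulr_ge0 ?w2_ge0 ?normsq_ge0.
have s0 : (0 <= H12_sum u)%E by rewrite H12_sumE//; apply: nneseries_ge0 => k _ _; rewrite lee_fin.
have sB : (H12_sum u <= B%:E)%E.
  rewrite H12_sumE//; apply: lime_le; first by apply: is_cvg_nneseries => k _ _; rewrite lee_fin.
  by apply: nearW => n; rewrite big_mkord sumEFin lee_fin; exact: uB.
have fin : (H12_sum u < +oo)%E by apply: le_lt_trans sB _; exact: ltry.
split; first by split.
by rewrite sqr_sqrtr ?fine_ge0// -lee_fin fineK ?ge0_fin_numE.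
Qed.

End HardySequences.

(** * Weighted sequence spaces *)

Section Weights.
Context {R : realType}.
Implicit Types (x y u a b : nat -> R[i]) (w v : nat -> R) (A B C : R).

Lemma triangular_sum (V : nmodType) (F : nat -> nat -> V) N :
  \sum_(m < N) \sum_(n < m.+1) F n (m - n)%N = \sum_(n < N) \sum_(k < N - n) F n k.
Proof.
elim: N => [|N ih]; first by rewrite !big_ord0.
rewrite big_ord_recr /= ih [RHS]big_ord_recr /= big_ord_recr /= addrA -big_split /=.
rewrite subnn subSnn big_ord1; congr (_ + _); apply: eq_bigr => n _.
by rewrite subSn 1?ltnW// big_ord_recr.
Qed.

Lemma rectangle_le_triangle (F : nat -> nat -> R) N M : (forall n k, 0 <= F n k) ->
  \sum_(n < N) \sum_(k < M) F n k <= \sum_(m < N + M) \sum_(n < m.+1) F n (m - n)%N.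
Proof.
move=> F0; rewrite triangular_sum big_split_ord /=.
rewrite -[leLHS]addr0; apply: lerD; last by apply: sumr_ge0 => i _; exact: sumr_ge0.
apply: ler_sum => n _; rewrite -(big_mkord xpredT (F n)) -(big_mkord xpredT (F n)).
have le1 : (M <= N + M - n)%N by rewrite -addnBAC ?leq_addl// ltnW.
rewrite [leRHS](@big_cat_nat _ _ _ M 0)//= lerDl; exact: sumr_ge0.
Qed.

(** ** The weights *)

(** The weight of [H^(1/4)], a space stable under [K_u] and embedded in [L^4]. *)
Definition w4 : nat -> R := fun k => Num.sqrt (1 + k%:R).

(** For these weights every square summable sequence has finite norm, while the
    bounds for [K_u] do not depend on the cap. *)
Definition capped (M : R) : nat -> R := fun k => Num.min (w4 k) M.

Lemma w4_gt0 k : 0 < w4 k. Proof. by rewrite sqrtr_gt0 ltr_wpDr. Qed.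
Lemma w4_ge0 k : 0 <= w4 k. Proof. exact: ltW (w4_gt0 k). Qed.
Lemma w4_sq k : w4 k * w4 k = 1 + k%:R.
Proof. by rewrite -expr2 sqr_sqrtr// addr_ge0. Qed.
Lemma w4_mono m n : (m <= n)%N -> w4 m <= w4 n.
Proof. by move=> mn; rewrite ler_wsqrtr// lerD2l ler_nat. Qed.
Lemma w4_ge1 k : 1 <= w4 k.
Proof. by apply: le_trans (w4_mono (leq0n k)); rewrite /w4 addr0 sqrtr1. Qed.
Lemma w4_le_w2 k : w4 k <= w2 k.
Proof. by rewrite /w2 -w4_sq ler_peMl ?w4_ge1 ?w4_ge0. Qed.
Lemma w1_le_w4 k : w1 k <= w4 k. Proof. exact: w4_ge1. Qed.
Lemma w1_le_w2 k : w1 k <= w2 k :> R. Proof. exact: w2_ge1. Qed.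
Lemma w2_gt0 k : 0 < w2 k :> R. Proof. by rewrite ltr_wpDr. Qed.

Lemma natSr n : n.+1%:R = 1 + n%:R :> R.
Proof. by rewrite -add1n natrD. Qed.

Lemma sum_inv_w4 n : \sum_(k < n) (w4 k)^-1 <= 2 * Num.sqrt n%:R.
Proof.
elim: n => [|n ih]; first by rewrite big_ord0 mulr_ge0 ?sqrtr_ge0.
rewrite big_ord_recr /= (natSr n) -/(w4 n).
have s0 := w4_gt0 n; have s2 := w4_sq n.
have t0 := sqrtr_ge0 (n%:R : R); have t2 : Num.sqrt n%:R ^+ 2 = n%:R :> R by rewrite sqr_sqrtr.
set s := w4 n in s0 s2 *; set t := Num.sqrt n%:R in ih t0 t2 *.
have h : s^-1 <= 2 * s - 2 * t.
  rewrite -[leLHS]mul1r ler_pdivrMr//; have := sqr_ge0 (s - t); nra.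
lra.
Qed.

(** The condition under which [K_u] is bounded on [l^2(w)] for [u] in [H^(1/2)]:
    on each antidiagonal of the Hankel matrix the weights add up to at most a
    multiple of the weight of the corresponding coefficient of [u]. *)
Definition K_weight w C := (forall k, 0 < w k) /\
  forall m, \sum_(n < m.+1) w n / w (m - n)%N <= C * (1 + m%:R).

(** A nondecreasing weight is largest at the end of the antidiagonal. *)
Lemma K_weight_of_mono w C : (forall k, 0 < w k) -> (forall m n, (m <= n)%N -> w m <= w n) ->
  (forall m, w m * \sum_(k < m.+1) (w k)^-1 <= C * (1 + m%:R)) -> K_weight w C.
Proof.
move=> w0 wm h; split=> // m; apply: le_trans (h m); rewrite mulr_sumr.
rewrite (reindex_inj rev_ord_inj) /=; apply: ler_sum => n _; rewrite subSS.
rewrite subKn; last by rewrite -ltnS.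
by apply: ler_wpM2r; [rewrite invr_ge0 ltW|apply: wm; exact: leq_subr].
Qed.

Lemma K_weight1 : K_weight w1 1.
Proof.
split => [k|m]; first exact: ltr01.
rewrite mul1r; under eq_bigr do rewrite /w1 divr1.
by rewrite sumr_const card_ord (natSr m).
Qed.

Lemma capped_gt0 M k : 1 <= M -> 0 < capped M k.
Proof. by move=> M1; rewrite /capped lt_min w4_gt0 (lt_le_trans ltr01). Qed.

Lemma K_weight_capped M : 1 <= M -> K_weight (capped M) 3.
Proof.
move=> M1; have M0 : 0 < M by exact: lt_le_trans M1.
apply: K_weight_of_mono => [k|m n mn|m]; first exact: capped_gt0.
  by rewrite /capped le_min !ge_min lexx orbT andbT w4_mono.
have inv_le k : (capped M k)^-1 <= (w4 k)^-1 + M^-1.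
  rewrite /capped; case: (leP (w4 k) M) => _; first by rewrite lerDl invr_ge0 ltW.
  by rewrite lerDr invr_ge0 w4_ge0.
apply: (@le_trans _ _ (capped M m * (2 * w4 m + (1 + m%:R) / M))).
  apply: ler_wpM2l; first exact: ltW (capped_gt0 _ M1).
  have hs : \sum_(k < m.+1) (capped M k)^-1 <= \sum_(k < m.+1) ((w4 k)^-1 + M^-1).
    by apply: ler_sum => k _; exact: inv_le.
  apply: le_trans hs _.
  rewrite big_split /=; apply: lerD.
    by apply: le_trans (sum_inv_w4 _) _; rewrite (natSr m).
  by rewrite sumr_const card_ord -[leLHS]mulr_natl (natSr m).
have c1 : capped M m <= w4 m by rewrite ge_min lexx.
have c2 : capped M m <= M by rewrite ge_min lexx orbT.
have s2 := w4_sq m; have s0 := w4_ge0 m.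
have h1 : capped M m * (2 * w4 m) <= 2 * (1 + m%:R).
  by rewrite -s2 mulrCA ler_wpM2l// ler_wpM2r.
have h2 : capped M m * ((1 + m%:R) / M) <= 1 + m%:R.
  by rewrite mulrA ler_pdivrMr// mulrC ler_wpM2l// addr_ge0.
rewrite mulrDr; lra.
Qed.

Lemma K_weight4 : K_weight w4 3.
Proof.
split => [k|m]; first exact: w4_gt0.
have [_ h] := K_weight_capped (w4_ge1 m); apply: le_trans (h m).
apply: ler_sum => n _; rewrite /capped !min_l ?w4_mono ?leq_subr//.
by rewrite -ltnS.
Qed.

Lemma bd_capped x B : (forall M, 1 <= M -> bd (capped M) x B) -> bd w4 x B.
Proof.
move=> h N; apply: le_trans (h _ (w4_ge1 N) N); apply: ler_sum => k _.
by rewrite /capped min_l// w4_mono// ltnW.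
Qed.

(** ** Products *)

(** The coefficients of the product of two Hardy functions. *)
Definition conv x y : nat -> R[i] := fun n => \sum_(k < n.+1) x k * y (n - k)%N.

(** The Cauchy-Schwarz inequality on each antidiagonal. *)
Lemma bd_conv w v C x y A B : (forall k, 0 <= w k) -> (forall k, 0 < v k) -> 0 <= C ->
  (forall n, w n * \sum_(k < n.+1) (v k * v (n - k)%N)^-1 <= C) ->
  bd v x A -> bd v y B -> bd w (conv x y) (C * (A * B)).
Proof.
move=> w0 v0 C0 hC xA yB N.
pose X k := v k * normsq (x k); pose Y k := v k * normsq (y k).
have X0 k : 0 <= X k by rewrite mulr_ge0 ?normsq_ge0 ?ltW.
have Y0 k : 0 <= Y k by rewrite mulr_ge0 ?normsq_ge0 ?ltW.
apply: (@le_trans _ _ (\sum_(n < N) C * \sum_(k < n.+1) X k * Y (n - k)%N)).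
  apply: ler_sum => n _.
  have := @sum_CS _ 'I_n.+1 (index_enum _) xpredT (fun k => x k * y (n - k)%N)
    (fun k => (v k * v (n - k)%N)^-1) (fun k => X k * Y (n - k)%N).
  move=> H; apply: (@le_trans _ _ (w n * ((\sum_(k < n.+1) (v k * v (n - k)%N)^-1) * \sum_(k < n.+1) X k * Y (n - k)%N))).
    rewrite ler_wpM2l//; apply: H => k.
    - by rewrite invr_ge0 mulr_ge0// ltW.
    - by rewrite mulr_ge0.
    - rewrite normsqM /X /Y le_eqVlt; apply/orP; left; apply/eqP.
      by field; rewrite !gt_eqF.
  by rewrite mulrA ler_wpM2r// sumr_ge0// => k _; rewrite mulr_ge0.
rewrite -mulr_sumr ler_wpM2l// (triangular_sum (fun n k => X n * Y k)).
apply: (@le_trans _ _ (\sum_(n < N) X n * B)).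
  by apply: ler_sum => n _; rewrite -mulr_sumr ler_wpM2l//; exact: yB.
by rewrite -mulr_suml ler_wpM2r ?(bd_ge0 yB)//; exact: xA.
Qed.

Lemma sum_rev_inv w n : \sum_(k < n.+1) (w (n - k)%N)^-1 = \sum_(k < n.+1) (w k)^-1.
Proof.
rewrite [RHS](reindex_inj rev_ord_inj) /=.
by apply: eq_bigr => k _; rewrite subSS.
Qed.

Lemma bd_conv4 x y A B : bd w4 x A -> bd w4 y B -> bd w1 (conv x y) (4 * (A * B)).
Proof.
apply: bd_conv => //; [exact: w4_gt0|move=> n].
rewrite mul1r.
have s0 : 0 < Num.sqrt (n%:R + 2) :> R by rewrite sqrtr_gt0 ltr_wpDl.
apply: (@le_trans _ _ (\sum_(k < n.+1) ((w4 k)^-1 + (w4 (n - k)%N)^-1) / Num.sqrt (n%:R + 2))).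
  apply: ler_sum => k _; have a0 := w4_gt0 k; have b0 := w4_gt0 (n - k)%N.
  rewrite ler_pdivlMr// -(@ler_pM2l _ (w4 k * w4 (n - k)%N)) ?mulr_gt0//.
  rewrite mulrA mulfV ?mul1r ?mulf_neq0 ?gt_eqF//.
  have -> : w4 k * w4 (n - k)%N * ((w4 k)^-1 + (w4 (n - k)%N)^-1) = w4 k + w4 (n - k)%N.
    by field; rewrite !gt_eqF.
  rewrite -ler_sqr ?nnegrE ?sqrtr_ge0 ?addr_ge0 ?w4_ge0// sqr_sqrtr ?addr_ge0//.
  have kn : (k <= n)%N by rewrite -ltnS.
  have := w4_sq k; have := w4_sq (n - k)%N; rewrite (natrB _ kn) => e1 e2.
  have -> : (w4 k + w4 (n - k)%N) ^+ 2 = w4 k * w4 k + w4 (n - k)%N * w4 (n - k)%N + 2 * (w4 k * w4 (n - k)%N) by ring.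
  by rewrite e1 e2; have := mulr_gt0 a0 b0; lra.
rewrite -mulr_suml big_split /= sum_rev_inv ler_pdivrMr//.
have h := sum_inv_w4 n.+1.
have : Num.sqrt n.+1%:R <= Num.sqrt (n%:R + 2) :> R by rewrite ler_wsqrtr// (natSr n); lra.
lra.
Qed.

Lemma bd_conv2 x y A B : bd w2 x A -> bd w2 y B -> bd w4 (conv x y) (4 * (A * B)).
Proof.
apply: bd_conv => //; [exact: w4_ge0|exact: w2_gt0|move=> n].
have s0 : 0 < n%:R + 2 :> R by rewrite ltr_wpDl.
have inv_le k : (w2 k)^-1 <= (w4 k)^-1 by rewrite lef_pV2 ?posrE ?w4_gt0 ?w2_gt0// w4_le_w2.
apply: (@le_trans _ _ (w4 n * \sum_(k < n.+1) ((w4 k)^-1 + (w4 (n - k)%N)^-1) / (n%:R + 2))).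
  rewrite ler_wpM2l ?w4_ge0//; apply: ler_sum => k _.
  have a0 : 0 < w2 k :> R := w2_gt0 k; have b0 : 0 < w2 (n - k)%N :> R := w2_gt0 (n - k)%N.
  rewrite ler_pdivlMr//; apply: le_trans (lerD (inv_le k) (inv_le (n - k)%N)).
  rewrite le_eqVlt; apply/orP; left; apply/eqP.
  have kn : (k <= n)%N by rewrite -ltnS.
  have e : (n%:R + 2 : R) = w2 k + w2 (n - k)%N by rewrite /w2 (natrB _ kn); ring.
  by rewrite e; field; rewrite !gt_eqF.
rewrite -mulr_suml big_split /= sum_rev_inv mulrA ler_pdivrMr//.
have h := sum_inv_w4 n.+1; have s2 := w4_sq n; have p0 := w4_ge0 n.
have e : Num.sqrt n.+1%:R = w4 n by rewrite (natSr n).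
rewrite e in h; have := ler_wpM2l p0 h; rewrite mulrDr.
have : 0 <= n%:R :> R by [].
set Z := \sum_(k < _) _ in h *; nra.
Qed.

(** Used to split a symbol into a finitely supported one and one that is small
    in [H^(1/2)]. *)
Lemma bd_tail w x B (e : R) : (forall k, 0 <= w k) -> bd w x B -> 0 < e ->
  exists N, bd w (fun k => if (k < N)%N then 0 else x k) e.
Proof.
move=> w0 xB e0; pose a N := \sum_(0 <= k < N) w k * normsq (x k).
have t0 k : 0 <= w k * normsq (x k) by rewrite mulr_ge0 ?normsq_ge0.
have nd : nondecreasing_seq a.
  by apply/nondecreasing_seqP => n; rewrite /a big_nat_recr//= lerDl.
have ca : cvgn a.
  by apply: nondecreasing_is_cvgn => //; exists B => _ [n _ <-]; rewrite /a big_mkord; exact: xB.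
have /cvgrPdist_le/(_ _ e0) [N _ /(_ N (leqnn N))] := ca.
move=> /ler_normlP[_ h]; exists N => M.
apply: le_trans h; rewrite lerBrDr.
have [MN|NM] := leqP M N.
  rewrite big1 ?add0r; first exact: nondecreasing_cvgn_le.
  by move=> k _; rewrite (leq_trans (ltn_ord k) MN) normsq0 mulr0.
apply: le_trans (nondecreasing_cvgn_le nd ca M).
rewrite -(big_mkord xpredT (fun k => w k * normsq (if (k < N)%N then 0 else x k))).
rewrite (@big_cat_nat _ _ _ N 0 M) ?(ltnW NM)//= big_nat big1; last first.
  by move=> k /andP[_ ->]; rewrite normsq0 mulr0.
rewrite add0r addrC.
have -> : a M = a N + \sum_(N <= k < M) w k * normsq (x k).
  by rewrite /a (@big_cat_nat _ _ _ N 0 M) ?(ltnW NM).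
rewrite lerD2l le_eqVlt; apply/orP; left; apply/eqP; apply: eq_big_nat => k /andP[Nk _].
by rewrite ltnNge Nk.
Qed.

End Weights.

(** * The shifted Hankel operator on sequences *)

Section HankelSequences.
Context {R : realType}.
Implicit Types (x y u h a b f : nat -> R[i]) (w : nat -> R) (A B C U : R).

(** [K_u = S^* H_u] on coefficients: the matrix [u_(n + k + 1)] applied to the
    conjugate of [a]. *)
Definition Kseq u a : nat -> R[i] := fun n => dot (fun k => u (k + n.+1)%N) a.

Lemma KseqE u a n : Kseq u a n = dot (fun k => u (k + n.+1)%N) a.
Proof. by []. Qed.

(** Coefficients of functions of [H^(1/2)]. *)
Definition h2 u := exists U, bd w2 u U.

Lemma bd_w1 w x B : (forall k, w1 k <= w k) -> bd w x B -> bd w1 x B.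
Proof. exact: bd_weight_le. Qed.

Lemma h2_l2 u : h2 u -> l2 u.
Proof. by move=> [U uU]; exists U; apply: bd_weight_le uU => k; exact: w1_le_w2. Qed.

Lemma h2D u h : h2 u -> h2 h -> h2 (fun k => u k + h k).
Proof. by move=> [A uA] [B uB]; exists (2 * A + 2 * B); apply: bdD => // k; exact: w2_ge0. Qed.

Lemma cvg_sum_ord (F : nat -> nat -> R) (l : nat -> R) N :
  (forall n, F n k @[k --> \oo] --> l n) ->
  \sum_(n < N) F n k @[k --> \oo] --> \sum_(n < N) l n.
Proof.
move=> h; elim: N => [|N ih].
  by under eq_fun do rewrite big_ord0; rewrite big_ord0; exact: cvg_cst.
under eq_fun do rewrite big_ord_recr; rewrite big_ord_recr.
by apply: cvgD.
Qed.

(** The Cauchy-Schwarz inequality on each row bounds the squared norm by the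
    Hilbert-Schmidt sum of [w_n / w_k |u_(n+k+1)|^2], which is summed along
    antidiagonals. *)
Lemma bd_Kseq w C u a U A : K_weight w C -> 0 <= C -> l2 a ->
  bd w2 u U -> bd w a A -> bd w (Kseq u a) (C * U * A).
Proof.
move=> [w0 wC] C0 a2 uU aA N.
have u2 : l2 u by apply: h2_l2; exists U.
pose G k := \sum_(n < N) w n * normsq (pdot (fun k => u (k + n.+1)%N) a k).
have cG : G k @[k --> \oo] --> \sum_(n < N) w n * normsq (Kseq u a n).
  apply: (@cvg_sum_ord (fun n k => w n * normsq (pdot (fun k => u (k + n.+1)%N) a k))
    (fun n => w n * normsq (Kseq u a n)) N) => n.
  have [c1 c2] := dotP (l2_shift n.+1 u2) a2.
  apply: cvgM; first exact: cvg_cst.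
  exact: (cvg_normsq c1 c2).
rewrite -(cvg_lim (@Rhausdorff R) cG); apply: limr_le; first exact: cvgP cG.
apply: nearW => M; rewrite /G.
have A0 := bd_ge0 aA.
apply: (@le_trans _ _ (\sum_(n < N) \sum_(k < M) (w n / w k * normsq (u (k + n.+1)%N)) * A)).
  apply: ler_sum => n _; rewrite -mulr_suml.
  have := @sum_CS _ 'I_M (index_enum _) xpredT (fun k => u (k + n.+1)%N * conjc (a k))
    (fun k => (w k)^-1 * normsq (u (k + n.+1)%N)) (fun k => w k * normsq (a k)).
  move=> H; apply: (@le_trans _ _ (w n * ((\sum_(k < M) (w k)^-1 * normsq (u (k + n.+1)%N)) *
      (\sum_(k < M) w k * normsq (a k))))).
    apply: ler_wpM2l; first exact: ltW.
    apply: H => k.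
    - by rewrite mulr_ge0 ?normsq_ge0// invr_ge0 ltW.
    - by rewrite mulr_ge0 ?normsq_ge0// ltW.
    - rewrite normsqM normsqJ le_eqVlt; apply/orP; left; apply/eqP.
      by field; rewrite gt_eqF.
  rewrite mulrA; apply: ler_pM => //.
  - apply: mulr_ge0; first exact: ltW.
    apply: sumr_ge0 => k _; by rewrite mulr_ge0 ?normsq_ge0// invr_ge0 ltW.
  - by apply: sumr_ge0 => k _; rewrite mulr_ge0 ?normsq_ge0// ltW.
  - rewrite mulr_sumr le_eqVlt; apply/orP; left; apply/eqP; apply: eq_bigr => k _.
    by rewrite mulrA.
under eq_bigr do rewrite -mulr_suml.
rewrite -mulr_suml; apply: ler_wpM2r => //.
pose F n k := w n / w k * normsq (u (k + n.+1)%N).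
apply: (le_trans (@rectangle_le_triangle _ F N M _)).
  by move=> n k; rewrite mulr_ge0 ?normsq_ge0// mulr_ge0 ?invr_ge0 ?ltW.
apply: (@le_trans _ _ (\sum_(m < N + M) C * (w2 m.+1 * normsq (u m.+1)))).
  apply: ler_sum => m _.
  rewrite (eq_bigr (fun n : 'I_m.+1 => w n / w (m - n)%N * normsq (u m.+1))); last first.
    by move=> n _; rewrite /F addnS subnK// -ltnS.
  rewrite -mulr_suml mulrA; apply: ler_wpM2r; first exact: normsq_ge0.
  apply: le_trans (wC m) _; apply: ler_wpM2l => //.
  by rewrite /w2 lerD2l ler_nat.
rewrite -mulr_sumr; apply: ler_wpM2l => //.
apply: le_trans (uU (N + M).+1); rewrite [leRHS]big_ord_recl lerDr.
by rewrite mulr_ge0 ?w2_ge0 ?normsq_ge0.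
Qed.

Lemma bd_Kseq1 u a U A : bd w2 u U -> bd w1 a A -> bd w1 (Kseq u a) (U * A).
Proof.
move=> uU aA; rewrite -(mul1r U); apply: bd_Kseq => //; first exact: K_weight1.
by exists A.
Qed.

Lemma bd4_l2 a A : bd w4 a A -> l2 a.
Proof. by move=> aA; exists A; apply: bd_weight_le aA => k; exact: w1_le_w4. Qed.

Lemma bd_Kseq4 u a U A : bd w2 u U -> bd w4 a A -> bd w4 (Kseq u a) (3 * U * A).
Proof.
move=> uU aA; apply: bd_Kseq => //; first exact: K_weight4.
exact: bd4_l2 aA.
Qed.

Lemma l2_Kseq u a : h2 u -> l2 a -> l2 (Kseq u a).
Proof. by move=> [U uU] [A aA]; exists (U * A); exact: bd_Kseq1. Qed.

(** ** Algebraic properties *)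

Lemma KseqDl u h a : l2 u -> l2 h -> l2 a ->
  Kseq (fun k => u k + h k) a = fun n => Kseq u a n + Kseq h a n.
Proof. by move=> u2 h2_ a2; apply/funext => n; apply: dotDl => //; exact: l2_shift. Qed.

Lemma KseqDr u a b : l2 u -> l2 a -> l2 b ->
  Kseq u (fun k => a k + b k) = fun n => Kseq u a n + Kseq u b n.
Proof. by move=> u2 a2 b2; apply/funext => n; apply: dotDr => //; exact: l2_shift. Qed.

Lemma KseqBr u a b : l2 u -> l2 a -> l2 b ->
  Kseq u (fun k => a k - b k) = fun n => Kseq u a n - Kseq u b n.
Proof. by move=> u2 a2 b2; apply/funext => n; apply: dotBr => //; exact: l2_shift. Qed.

Lemma KseqZr u z a : l2 u -> l2 a ->
  Kseq u (fun k => z * a k) = fun n => conjc z * Kseq u a n.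
Proof. by move=> u2 a2; apply/funext => n; apply: dotZr => //; exact: l2_shift. Qed.

Lemma dot_finite x y N : l2 x -> l2 y -> (forall k, (N <= k)%N -> x k = 0) ->
  dot x y = \sum_(k < N) x k * conjc (y k).
Proof.
move=> x2 y2 x0; apply: dot_eq => //.
suff e : forall n, (N <= n)%N -> pdot x y n = \sum_(k < N) x k * conjc (y k).
  by split; apply: cvg_near_cst; exists N => // n /= Nn; rewrite e.
move=> n Nn; rewrite /pdot -(big_mkord xpredT (fun k => x k * conjc (y k))).
rewrite -(big_mkord xpredT (fun k => x k * conjc (y k))) (@big_cat_nat _ _ _ N 0 n)//=.
have -> : \sum_(N <= i < n) x i * conjc (y i) = 0; last by rewrite addr0.
by rewrite big_nat big1// => k /andP[Nk _]; rewrite x0 ?mul0r.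
Qed.

Definition head N x : nat -> R[i] := fun k => if (k < N)%N then x k else 0.
Definition tail N x : nat -> R[i] := fun k => if (k < N)%N then 0 else x k.

Lemma head_tail N x : x = fun k => head N x k + tail N x k.
Proof. by apply/funext => k; rewrite /head /tail; case: ifP; rewrite ?addr0 ?add0r. Qed.

Lemma bd_head w N x B : (forall k, 0 <= w k) -> bd w x B -> bd w (head N x) B.
Proof.
move=> w0 xB n; apply: le_trans (xB n); apply: ler_sum => k _; rewrite /head.
by case: ifP; rewrite // normsq0 mulr0 mulr_ge0 ?normsq_ge0.
Qed.

Lemma Kseq_head0 N u a n : l2 u -> l2 a -> (N <= n)%N -> Kseq (head N u) a n = 0.
Proof.
move=> [U uU] a2 Nn; rewrite /Kseq (@dot_finite _ _ 0) ?big_ord0//.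
  by apply: l2_shift; exists U; apply: bd_head => // k; exact: w1_ge0.
by move=> k _; rewrite /head ltnNge (leq_trans Nn)// addnS ltnW// ltnS leq_addl.
Qed.

Lemma dot_Kseq_head_sym N u a b : h2 u -> l2 a -> l2 b ->
  dot (Kseq (head N u) a) b = dot (Kseq (head N u) b) a.
Proof.
move=> u2 a2 b2; have hu2 : l2 u := h2_l2 u2.
have hh : h2 (head N u) by case: u2 => U uU; exists U; apply: bd_head => // k; exact: w2_ge0.
have E (c d : nat -> R[i]) : l2 c -> l2 d -> dot (Kseq (head N u) c) d =
    \sum_(n < N) \sum_(k < N) head N u (k + n.+1)%N * conjc (c k) * conjc (d n).
  move=> c2 d2; rewrite (@dot_finite _ _ N) //; last 2 first.
  - exact: l2_Kseq.
  - by move=> n Nn; exact: Kseq_head0.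
  apply: eq_bigr => n _; rewrite -mulr_suml; congr (_ * _).
  apply: dot_finite => //; first by apply: l2_shift; exact: h2_l2.
  by move=> k Nk; rewrite /head ltnNge (leq_trans Nk)// leq_addr.
rewrite !E// exchange_big; apply: eq_bigr => n _; apply: eq_bigr => k _.
by rewrite mulrAC addnS addnC -addnS.
Qed.

Lemma normsq_small_eq (z z' : R[i]) : (forall e : R, 0 < e -> normsq (z - z') <= e) -> z = z'.
Proof.
move=> h; apply/eqP; rewrite -subr_eq0; apply/eqP/normsq_eq0/eqP.
rewrite eq_le normsq_ge0 andbT; apply/ler_addgt0Pr => e e0; rewrite add0r; exact: h.
Qed.

(** [K_u] is antilinear and symmetric: clear for finitely supported symbols,
    and these are dense. *)
Lemma dot_Kseq_sym u a b : h2 u -> l2 a -> l2 b -> dot (Kseq u a) b = dot (Kseq u b) a.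
Proof.
move=> hu a2 b2; apply: normsq_small_eq => e e0.
have [U uU] := hu; have [A aA] := a2; have [B bB] := b2.
have A0 := bd_ge0 aA; have B0 := bd_ge0 bB.
pose d := e / (4 * A * B + 1).
have d0 : 0 < d by rewrite divr_gt0// ltr_wpDl// !mulr_ge0.
have [N tN] := bd_tail (@w2_ge0 R) uU d0.
have hd : h2 (head N u) by exists U; apply: bd_head => // k; exact: w2_ge0.
have ht : h2 (tail N u) by exists d.
have split_ (c1 c2 : nat -> R[i]) : l2 c1 -> l2 c2 -> dot (Kseq u c1) c2 =
    dot (Kseq (head N u) c1) c2 + dot (Kseq (tail N u) c1) c2.
  move=> l1 l2_; rewrite {1}(head_tail N u) KseqDl ?dotDl//; try exact: h2_l2; try exact: l2_Kseq.
rewrite !split_// (dot_Kseq_head_sym N hu a2 b2).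
set P := dot (Kseq (head N u) b) a.
have -> : forall p q : R[i], P + p - (P + q) = p - q by move=> p q; ring.
apply: le_trans (normsqB _ _) _.
have t1 : normsq (dot (Kseq (tail N u) a) b) <= d * A * B by apply: dot_CS => //; exact: bd_Kseq1.
have t2 : normsq (dot (Kseq (tail N u) b) a) <= d * B * A by apply: dot_CS => //; exact: bd_Kseq1.
apply: (@le_trans _ _ (d * (4 * A * B + 1))).
  have : d * B * A = d * A * B by ring.
  by move: t1 t2 => + + e1; rewrite e1 => t1 t2; lra.
by rewrite /d mulfVK// gt_eqF// ltr_wpDl// !mulr_ge0.
Qed.

Lemma dot_Kseq2_sym u a b : h2 u -> l2 a -> l2 b ->
  dot (Kseq u (Kseq u a)) b = dot a (Kseq u (Kseq u b)).
Proof.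
move=> hu a2 b2; rewrite dot_Kseq_sym//; last exact: l2_Kseq.
rewrite -(dotJ _ a2); last by do 2 apply: l2_Kseq => //.
rewrite (dot_Kseq_sym hu _ a2); last exact: l2_Kseq.
by rewrite dotJ//; exact: l2_Kseq.
Qed.

(** A finitely supported symbol gives an operator with finitely supported range. *)
Lemma bd4_Kseq_head N u a U A : bd w2 u U -> bd w1 a A ->
  bd w4 (Kseq (head N u) a) (w4 N * (U * A)).
Proof.
move=> uU aA n.
have hU : bd w2 (head N u) U by apply: bd_head => // k; exact: w2_ge0.
have := bd_Kseq1 hU aA => KB.
have u2 : l2 u by apply: h2_l2; exists U.
have a2 : l2 a by exists A.
apply: le_trans (ler_wpM2l (w4_ge0 N) (KB n)); rewrite mulr_sumr.
apply: ler_sum => k _; have [kN|Nk] := ltnP k N.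
  by rewrite /w1 mul1r; apply: ler_wpM2r; [exact: normsq_ge0|apply: w4_mono; exact: ltnW].
by rewrite Kseq_head0// normsq0 !mulr0.
Qed.

End HankelSequences.

(** * Resolvents *)

#[local] Opaque Kseq dot.

Section Resolvent.
Context {R : realType}.
Implicit Types (u h a b f : nat -> R[i]) (w : nat -> R) (A B C D U F x : R).

(** The operator [1 - x K_u^2] on coefficients. *)
Definition Aseq x u a : nat -> R[i] := fun n => a n - x%:C%C * Kseq u (Kseq u a) n.

Lemma l2_Aseq x u a : h2 u -> l2 a -> l2 (Aseq x u a).
Proof. by move=> hu a2; apply: l2B => //; apply: l2Z; do 2 apply: l2_Kseq => //. Qed.

Lemma AseqD x u a b : h2 u -> l2 a -> l2 b ->
  Aseq x u (fun n => a n + b n) = fun n => Aseq x u a n + Aseq x u b n.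
Proof.
move=> hu a2 b2; have u2 := h2_l2 hu; apply/funext => n; rewrite /Aseq.
rewrite (KseqDr u2 a2 b2) (KseqDr u2 (l2_Kseq hu a2) (l2_Kseq hu b2)).
by rewrite mulrDr opprD addrACA.
Qed.

Lemma AseqB x u a b : h2 u -> l2 a -> l2 b ->
  Aseq x u (fun n => a n - b n) = fun n => Aseq x u a n - Aseq x u b n.
Proof.
move=> hu a2 b2; have u2 := h2_l2 hu; apply/funext => n; rewrite /Aseq.
rewrite (KseqBr u2 a2 b2) (KseqBr u2 (l2_Kseq hu a2) (l2_Kseq hu b2)).
by rewrite mulrBr !opprB addrACA [RHS]addrACA; congr (_ + _); rewrite addrC.
Qed.

Lemma dot_Aseq_sym x u a b : h2 u -> l2 a -> l2 b -> dot (Aseq x u a) b = dot a (Aseq x u b).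
Proof.
move=> hu a2 b2; have Ka : l2 (Kseq u (Kseq u a)) by do 2 apply: l2_Kseq => //.
have Kb : l2 (Kseq u (Kseq u b)) by do 2 apply: l2_Kseq => //.
rewrite dotBl ?dotZl ?dotBr ?dotZr//; try exact: l2Z.
by rewrite dot_Kseq2_sym// conjc_real.
Qed.

(** A bound that improves itself; the finite bound [D] from which the iteration
    starts leaves no trace in the result. *)
Lemma halving w a c D : (forall D, bd w a D -> bd w a (c + D / 2)) -> bd w a D -> bd w a (2 * c).
Proof.
move=> h aD; have hj j : bd w a (2 * c + 2^-1 ^+ j * (D - 2 * c)).
  elim: j => [|j ih]; first by rewrite expr0 mul1r addrC subrK.
  by apply: bd_mono (h _ ih); rewrite exprS; lra.
move=> N.
have c0 : 2 * c + 2^-1 ^+ j * (D - 2 * c) @[j --> \oo] --> 2 * c + 0 * (D - 2 * c).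
  apply: cvgD; first exact: cvg_cst.
  apply: cvgM; last exact: cvg_cst.
  by apply: cvg_expr; rewrite ger0_norm; lra.
rewrite mul0r addr0 in c0; rewrite -(cvg_lim (@Rhausdorff R) c0).
by apply: limr_ge; [exact: cvgP c0|apply: nearW => j; exact: hj].
Qed.

(** Elliptic regularity: [K_u] is the sum of an operator of small norm on the
    weighted spaces and of smoothing ones. The capped weights make the weighted
    norm of [a] finite from the start, so that the small part can be absorbed
    uniformly in the cap. *)
Lemma Aseq_regularity x u : h2 u -> exists2 C, 0 <= C &
  forall a A F, bd w1 a A -> bd w4 (Aseq x u a) F -> bd w4 a (C * (F + A)).
Proof.
move=> [U uU]; have U0 := bd_ge0 uU.
(* [K_r] multiplies squared weighted norms by at most [3 d], and
   [x^2 (3 d)^2] is at most [1/4]. *)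
pose d := (6 * (`|x| + 1))^-1.
have x1 : 0 < `|x| + 1 by rewrite ltr_wpDl.
have d0 : 0 < d by rewrite invr_gt0 mulr_gt0.
have [N tN] := bd_tail (@w2_ge0 R) uU d0.
pose p := head N u; pose r := tail N u.
have hp : h2 p by exists U; apply: bd_head => // k; exact: w2_ge0.
have hr : h2 r by exists d.
have hu : h2 u by exists U.
pose L1 := w4 N * (U * U); pose L2_ := 3 * d * (w4 N * U).
have L10 : 0 <= L1 by rewrite !mulr_ge0 ?w4_ge0.
have d_ge0 := ltW d0.
have L20 : 0 <= L2_ by rewrite !mulr_ge0 ?w4_ge0.
pose c1 := normsq (x%:C%C : R[i]) * (2 * L1 + 2 * L2_).
have c10 : 0 <= c1 by apply: mulr_ge0; [exact: normsq_ge0|lra].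
exists (2 * (2 * (2 + 2 * c1))); first lra.
move=> a A F aA aF.
have a2 : l2 a by exists A.
have A0 := bd_ge0 aA; have F0 := bd_ge0 aF.
have Kr2 : l2 (Kseq r a) by exact: l2_Kseq.
have Kp2 : l2 (Kseq p a) by exact: l2_Kseq.
have Ku2 : l2 (Kseq u a) by exact: l2_Kseq.
have e : Kseq u (Kseq u a) = fun n => (Kseq p (Kseq u a) n + Kseq r (Kseq p a) n) + Kseq r (Kseq r a) n.
  have Ku c : l2 c -> Kseq u c = fun n => Kseq p c n + Kseq r c n.
    by move=> c2; rewrite {1}(head_tail N u) (KseqDl (h2_l2 hp) (h2_l2 hr) c2).
  apply/funext => n; rewrite (Ku _ Ku2) -addrA; congr (_ + _).
  by rewrite (Ku _ a2) (KseqDr (h2_l2 hr) Kp2 Kr2).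
pose b n := Aseq x u a n + x%:C%C * (Kseq p (Kseq u a) n + Kseq r (Kseq p a) n).
have bB : bd w4 b (2 * F + 2 * (c1 * A)).
  apply: bdD => //; first by move=> k; exact: w4_ge0.
  rewrite /c1 -mulrA; apply: bdZ.
  have -> : (2 * L1 + 2 * L2_) * A = 2 * (L1 * A) + 2 * (L2_ * A) by ring.
  apply: bdD; first by move=> k; exact: w4_ge0.
    by rewrite /L1 -!mulrA; apply: bd4_Kseq_head => //; exact: bd_Kseq1.
  have -> : L2_ * A = 3 * d * (w4 N * (U * A)) by rewrite /L2_; ring.
  by apply: bd_Kseq4 => //; exact: bd4_Kseq_head.
have ab : a = fun n => b n + x%:C%C * Kseq r (Kseq r a) n.
  have id_ (s t p1 q1 r1 : R[i]) : s = s - t * (p1 + q1 + r1) + t * (p1 + q1) + t * r1 by ring.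
  by apply/funext => n; rewrite /b /Aseq e; exact: id_.
have xd : normsq (x%:C%C : R[i]) * (3 * d * (3 * d)) <= 4^-1.
  rewrite normsqR -real_normK ?num_real// /d invfM.
  have -> : `|x| ^+ 2 * (3 * (6^-1 / (`|x| + 1)) * (3 * (6^-1 / (`|x| + 1)))) =
    4^-1 * (`|x| / (`|x| + 1)) ^+ 2 by field; rewrite gt_eqF.
  have y0 : 0 <= `|x| / (`|x| + 1) by rewrite divr_ge0// ltW.
  have y1 : `|x| / (`|x| + 1) <= 1 by rewrite ler_pdivrMr// mul1r lerDl.
  by rewrite -[leRHS]mulr1 ler_wpM2l// exprn_ile1.
apply: bd_capped => M M1.
have kw := K_weight_capped M1.
have w0 k : 0 <= capped M k by apply: ltW; exact: capped_gt0.
have aM : bd (capped M) a (M * A).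
  move=> n; apply: le_trans (ler_wpM2l (le_trans ler01 M1) (aA n)); rewrite mulr_sumr.
  apply: ler_sum => k _; rewrite /w1 mul1r; apply: ler_wpM2r; first exact: normsq_ge0.
  by rewrite /capped ge_min lexx orbT.
have bM : bd (capped M) b (2 * F + 2 * (c1 * A)).
  by apply: bd_weight_le bB => k; rewrite /capped ge_min lexx.
have := @halving (capped M) a (2 * (2 * F + 2 * (c1 * A))) _ _ aM.
move=> H; apply: bd_mono (H _); last first.
  move=> D aD; have D0 := bd_ge0 aD.
  rewrite {1}ab; apply: (@bd_mono _ _ _ (2 * (2 * F + 2 * (c1 * A)) +
    2 * (normsq (x%:C%C : R[i]) * (3 * d * (3 * d * D))))).
    rewrite lerD2l; have := ler_wpM2r D0 xd.
    set nx := normsq _; have -> : nx * (3 * d * (3 * d * D)) = nx * (3 * d * (3 * d)) * D by ring.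
    lra.
  apply: bdD => //; apply: bdZ; apply: bd_Kseq => //.
  by apply: bd_Kseq.
have : 0 <= c1 * F by rewrite mulr_ge0.
lra.
Qed.

(** [invertible_at] on coefficients. *)
Definition inv_seq x u := (forall f, l2 f -> exists2 a, l2 a & Aseq x u a = f) /\
  exists C, forall a, l2 a -> nsq a <= C * nsq (Aseq x u a).

Lemma inv_seq_bd x u : h2 u -> inv_seq x u -> exists2 C, 0 <= C &
  forall a B, l2 a -> bd w1 (Aseq x u a) B -> bd w1 a (C * B).
Proof.
move=> hu [_ [C hC]]; exists `|C| => // a B a2 aB.
apply: bd_mono (bd_nsq a2); apply: le_trans (hC a a2) _.
apply: (@le_trans _ _ (`|C| * nsq (Aseq x u a))).
  by apply: ler_wpM2r; [apply: nsq_ge0; exact: l2_Aseq|exact: ler_norm].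
by apply: ler_wpM2l => //; exact: nsq_le.
Qed.

Lemma inv_seq_bd4 x u : h2 u -> inv_seq x u -> exists2 C, 0 <= C &
  forall a B, l2 a -> bd w4 (Aseq x u a) B -> bd w4 a (C * B).
Proof.
move=> hu iu; have [C C0 hC] := inv_seq_bd hu iu; have [C' C'0 hC'] := Aseq_regularity x hu.
exists (C' * (1 + C)); first by rewrite mulr_ge0// addr_ge0.
move=> a B a2 aB; have a1 : bd w1 a (C * B).
  by apply: hC => //; apply: bd_weight_le aB => k; exact: w1_le_w4.
by apply: bd_mono (hC' _ _ _ a1 aB); rewrite le_eqVlt; apply/orP; left; apply/eqP; ring.
Qed.

(** ** Perturbation of the symbol *)

(** The increment [K_(u+h)^2 - K_u^2]. *)
Definition Eseq u h a : nat -> R[i] := fun n =>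
  Kseq u (Kseq h a) n + Kseq h (Kseq (fun k => u k + h k) a) n.

Lemma Kseq2_perturb u h a : h2 u -> h2 h -> l2 a ->
  Kseq (fun k => u k + h k) (Kseq (fun k => u k + h k) a) =
  fun n => Kseq u (Kseq u a) n + Eseq u h a n.
Proof.
move=> hu hh a2; have hv := h2D hu hh; set v := fun k => u k + h k in hv *.
have Kv : Kseq v a = fun n => Kseq u a n + Kseq h a n by apply: KseqDl => //; exact: h2_l2.
rewrite {1}/v KseqDl; try exact: h2_l2; last exact: l2_Kseq.
apply/funext => n; rewrite /Eseq -/v addrA; congr (_ + _).
rewrite Kv KseqDr//; [exact: h2_l2|exact: l2_Kseq|exact: l2_Kseq].
Qed.

Lemma Aseq_perturb x u h a : h2 u -> h2 h -> l2 a ->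
  Aseq x (fun k => u k + h k) a = fun n => Aseq x u a n - x%:C%C * Eseq u h a n.
Proof.
by move=> hu hh a2; apply/funext => n; rewrite /Aseq Kseq2_perturb//; ring.
Qed.

Lemma l2_Eseq u h a : h2 u -> h2 h -> l2 a -> l2 (Eseq u h a).
Proof.
move=> hu hh a2; apply: l2D; apply: l2_Kseq => //; apply: l2_Kseq => //.
exact: h2D.
Qed.

Lemma bd_Eseq w u h a U d A : K_weight w 3 -> l2 a -> d <= 1 -> bd w2 u U -> bd w2 h d ->
  bd w a A -> bd w (Eseq u h a) (d * (54 * U + 36) * A).
Proof.
move=> kw a2 d1 uU hd aA.
have hu : h2 u by exists U. have hh : h2 h by exists d.
have w0 k : 0 <= w k by case: kw => w0 _; exact: ltW.
have A0 := bd_ge0 aA; have d0 := bd_ge0 hd.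
have dA0 : 0 <= d * A by rewrite mulr_ge0.
have vV : bd w2 (fun k => u k + h k) (2 * U + 2 * d) by apply: bdD => // k; exact: w2_ge0.
apply: (@bd_mono _ _ _ (2 * (3 * U * (3 * d * A)) + 2 * (3 * d * (3 * (2 * U + 2 * d) * A)))).
  rewrite -subr_ge0; have : 0 <= d * A * (1 - d) by rewrite mulr_ge0// subr_ge0.
  lra.
apply: bdD => //; apply: bd_Kseq => //; try exact: l2_Kseq; try exact: bd_Kseq.
by apply: l2_Kseq => //; exact: h2D.
Qed.

Lemma K_weight13 : K_weight (w1 : nat -> R) 3.
Proof.
have [w0 h] := @K_weight1 R; split => // m; apply: le_trans (h m) _.
by rewrite ler_wpM2r ?addr_ge0//; lra.
Qed.

(** Completeness is transported from functions. *)
Lemma l2_complete (s : nat -> nat -> R[i]) (e : nat -> R) : (forall n, l2 (s n)) ->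
  e @ \oo --> (0 : R) ->
  (forall m n, (m <= n)%N -> bd w1 (fun k => s n k - s m k) (e m)) ->
  exists2 a, l2 a & forall m, bd w1 (fun k => a k - s m k) (e m).
Proof.
move=> s2 e0 se; pose F n := synth (s n).
have hF n : hardy (F n) by have [] := synthP (s2 n).
have cF n : coefs (F n) = s n by have [] := synthP (s2 n).
have F2 n : L2 (F n) by exact: hardy_L2.
have [|g g2 hg] := L2_complete F2 e0.
  move=> m n mn; rewrite L2sq_nsq; last exact: hardyB.
  by apply: nsq_le; rewrite coefsB// !cF; exact: se.
exists (coefs g); first exact: l2_coefs.
move=> m; apply: bd_mono (hg m) _; rewrite -(cF m) -coefsB//.
by apply: bd_coefs; exact: L2B.
Qed.

Lemma geometric_series_bd (del : nat -> nat -> R[i]) D : 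
  (forall j, bd w1 (del j) (4^-1 ^+ j * D)) ->
  forall m p, bd w1 (fun k => \sum_(m <= j < m + p) del j k) (4 * (4^-1 ^+ m * D)).
Proof.
move=> h m p; elim: p m => [|p ih] m.
  have D0 : 0 <= 4 * (4^-1 ^+ m * D) by rewrite mulr_ge0// (bd_ge0 (h m)).
  move=> N; rewrite addn0 big1//.
  by move=> k _; rewrite big_geq// normsq0 mulr0.
have -> : (fun k => \sum_(m <= j < m + p.+1) del j k) =
    (fun k => del m k + \sum_(m.+1 <= j < m.+1 + p) del j k).
  by apply/funext => k; rewrite addnS addSn big_ltn// ltnS leq_addr.
apply: bd_mono (bdD (@w1_ge0 R) (h m) (ih m.+1)).
by rewrite exprS; lra.
Qed.

(** The Neumann series: each correction solves the unperturbed equation with the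
    error made by the preceding one as right-hand side. *)
Lemma inv_seq_perturb x u U : bd w2 u U -> inv_seq x u ->
  exists2 d0, 0 < d0 & forall h, bd w2 h d0 -> inv_seq x (fun k => u k + h k).
Proof.
move=> uU iu; have U0 := bd_ge0 uU; have hu : h2 u by exists U.
have [C C0 hC] := inv_seq_bd hu iu; have [surj _] := iu.
pose L := normsq (x%:C%C : R[i]) * (54 * U + 36).
have L0 : 0 <= L by rewrite mulr_ge0 ?normsq_ge0// addr_ge0 ?mulr_ge0.
(* Each step of the series divides the squared norm by four. *)
pose q := 4 * C * L + 1.
have CL_ge0 : 0 <= C * L by rewrite mulr_ge0.
have q0 : 0 < q by rewrite /q; lra.
pose d0 := q^-1.
have d00 : 0 < d0 by rewrite invr_gt0.
have d01 : d0 <= 1 by rewrite invf_le1// /q; lra.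
have CL : C * (d0 * L) <= 4^-1.
  rewrite mulrCA mulrC ler_pdivrMr// /q; have : 0 <= C * L by rewrite mulr_ge0.
  lra.
exists d0; first exact: d00.
move=> h hd; have hh : h2 h by exists d0; exact: hd.
have hv := h2D hu hh; set v := fun k => u k + h k in hv *.
have Ebd a A : l2 a -> bd w1 a A -> bd w1 (fun n => x%:C%C * Eseq u h a n) (d0 * L * A).
  move=> a2 aA; apply: bd_mono (bdZ _ (bd_Eseq K_weight13 a2 d01 uU hd aA)).
  by rewrite le_eqVlt; apply/orP; left; apply/eqP; rewrite /L; ring.
have AE a : l2 a -> Aseq x v a = fun n => Aseq x u a n - x%:C%C * Eseq u h a n.
  by move=> a2; exact: Aseq_perturb.
split; last first.
  exists (4 * C) => a a2.
  have nAa : bd w1 (Aseq x u a) (2 * nsq (Aseq x v a) + 2 * (d0 * L * nsq a)).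
    have -> : Aseq x u a = fun n => Aseq x v a n + x%:C%C * Eseq u h a n.
      by apply/funext => n; rewrite AE// subrK.
    apply: bdD; first by move=> k; exact: w1_ge0.
      by apply: bd_nsq; exact: l2_Aseq.
    by apply: Ebd => //; exact: bd_nsq.
  have := nsq_le (hC _ _ a2 nAa); have na := nsq_ge0 a2.
  have := ler_wpM2r na CL.
  set X := nsq a in na *; set Y := nsq (Aseq x v a).
  have -> : C * (2 * Y + 2 * (d0 * L * X)) = 2 * (C * Y) + 2 * (C * (d0 * L) * X) by ring.
  lra.
move=> f f2.
have /choice[Ai hAi] (g : nat -> R[i]) : exists a, l2 g -> l2 a /\ Aseq x u a = g.
  have [g2|g2] := pselect (l2 g); last by exists g.
  by have [a a2 e] := surj g g2; exists a.
pose del := fix del (j : nat) := match j with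
  | 0%N => Ai f | i.+1 => Ai (fun n => x%:C%C * Eseq u h (del i) n) end.
have del2 j : l2 (del j).
  elim: j => [|j ih]; first by have [] := hAi f f2.
  by have [] := hAi (fun n => x%:C%C * Eseq u h (del j) n) (l2Z _ (l2_Eseq hu hh ih)).
have delA j : Aseq x u (del j.+1) = fun n => x%:C%C * Eseq u h (del j) n.
  by have [] := hAi (fun n => x%:C%C * Eseq u h (del j) n) (l2Z _ (l2_Eseq hu hh (del2 j))).
pose D := nsq (del 0%N).
have D0 : 0 <= D by exact: nsq_ge0.
have delD j : bd w1 (del j) (4^-1 ^+ j * D).
  elim: j => [|j ih]; first by rewrite expr0 mul1r; exact: bd_nsq.
  have := hC _ _ (del2 j.+1); rewrite delA => /(_ _ (Ebd _ _ (del2 j) ih)).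
  apply: bd_mono; rewrite exprS.
  have p0 : 0 <= 4^-1 ^+ j * D by rewrite mulr_ge0// exprn_ge0.
  have := ler_wpM2r p0 CL; rewrite -!mulrA; lra.
pose s J : nat -> R[i] := fun k => \sum_(0 <= j < J) del j k.
have s2 J : l2 (s J).
  elim: J => [|J ih].
    by exists 0 => N; rewrite big1// => k _; rewrite /s big_geq// normsq0 mulr0.
  have -> : s J.+1 = fun k => s J k + del J k by apply/funext => k; rewrite /s big_nat_recr.
  exact: l2D.
have sA J : Aseq x v (s J.+1) = fun n => f n - x%:C%C * Eseq u h (del J) n.
  elim: J => [|J ih].
    have -> : s 1%N = del 0%N by apply/funext => k; rewrite /s big_nat1.
    by rewrite AE//; have [_ ->] := hAi f f2.
  have -> : s J.+2 = fun k => s J.+1 k + del J.+1 k by apply/funext => k; rewrite /s big_nat_recr.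
  rewrite (AseqD x hv (s2 J.+1) (del2 J.+1)) ih (AE _ (del2 J.+1)) delA.
  by apply/funext => n; rewrite addrA subrK.
have g0 (c : R) : 4^-1 ^+ m * c @[m --> \oo] --> (0 : R).
  rewrite -[X in _ --> X](mul0r c); apply: cvgM; last exact: cvg_cst.
  by apply: cvg_expr; rewrite ger0_norm; lra.
have [|a a2 ha] := @l2_complete s (fun m => 4^-1 ^+ m * (4 * D)) s2 (g0 _).
  move=> m n mn.
  have -> : (fun k => s n k - s m k) = (fun k => \sum_(m <= j < m + (n - m)) del j k).
    by apply/funext => k; rewrite subnKC// /s (@big_cat_nat _ _ _ m 0 n)//= addrAC subrr add0r.
  by rewrite mulrCA; exact: geometric_series_bd.
exists a => //.
suff e : (fun n => Aseq x v a n - f n) = fun=> 0.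
  by apply/funext => n; have := congr1 (@^~ n) e => /= /eqP; rewrite subr_eq0 => /eqP.
have [V vV] := hv.
pose M := 2 * 1 + 2 * (normsq (x%:C%C : R[i]) * (V * V)).
have Abd b B : l2 b -> bd w1 b B -> bd w1 (Aseq x v b) (M * B).
  move=> b2 bB; have -> : M * B = 2 * B + 2 * (normsq (x%:C%C : R[i]) * (V * (V * B))) by rewrite /M; ring.
  apply: bdB => //.
  by apply: bdZ; apply: bd_Kseq1 => //; exact: bd_Kseq1.
have l2d : l2 (fun n => Aseq x v a n - f n) by apply: l2B => //; exact: l2_Aseq.
apply: nsq_eq0 => //.
pose c := 2 * (M * D) + 2 * (d0 * L * D).
have key J : nsq (fun n => Aseq x v a n - f n) <= 4^-1 ^+ J * c.
  apply: nsq_le.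
  have -> : (fun n => Aseq x v a n - f n) =
      fun n => Aseq x v (fun k => a k - s J.+1 k) n - x%:C%C * Eseq u h (del J) n.
    rewrite (AseqB x hv a2 (s2 J.+1)) sA; apply/funext => n.
    by rewrite opprB addrA addrAC addrK.
  have h1 := Abd _ _ (l2B a2 (s2 J.+1)) (ha J.+1).
  have h2 := Ebd _ _ (del2 J) (delD J).
  apply: bd_mono (bdB (@w1_ge0 R) h1 h2).
  by rewrite exprS /c le_eqVlt; apply/orP; left; apply/eqP; field.
rewrite -(cvg_lim (@Rhausdorff R) (g0 c)); apply: limr_ge; first exact: cvgP (g0 c).
by apply: nearW => J; exact: key.
Qed.

(** The difference of the two solutions solves the unperturbed equation with a
    right-hand side that contains the difference itself, but with a small
    factor, so that it can be absorbed. *)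
Lemma resolvent_perturb x u U : bd w2 u U -> inv_seq x u ->
  exists d0 C, [/\ 0 < d0, 0 <= C & forall h d, d <= d0 -> bd w2 h d ->
    forall a a' W F F', l2 a -> l2 a' -> bd w4 a W ->
    bd w4 (Aseq x (fun k => u k + h k) a') F' ->
    bd w4 (fun n => Aseq x (fun k => u k + h k) a' n - Aseq x u a n) F ->
    bd w4 (fun n => a' n - a n) (C * (F + d * W))].
Proof.
move=> uU iu; have U0 := bd_ge0 uU; have hu : h2 u by exists U.
have [C C0 hC] := inv_seq_bd4 hu iu.
pose L := normsq (x%:C%C : R[i]) * (54 * U + 36).
have L0 : 0 <= L by rewrite mulr_ge0 ?normsq_ge0// addr_ge0 ?mulr_ge0.
pose q := 8 * C * L + 1.
have CL_ge0 : 0 <= C * L by rewrite mulr_ge0.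
have q0 : 0 < q by rewrite /q; lra.
pose d0 := q^-1.
have d00 : 0 < d0 by rewrite invr_gt0.
have d01 : d0 <= 1 by rewrite invf_le1// /q; lra.
have CL0 : 0 <= C * L by rewrite mulr_ge0.
have CL : C * (d0 * L) <= 8^-1.
  by rewrite mulrCA mulrC ler_pdivrMr// /q; lra.
exists d0, (2 * (2 * C + 4 * C * L)); split => //; first lra.
move=> h d dd0 hd a a' W F F' a2 a'2 aW aF' aF.
have d_ge0 := bd_ge0 hd; have W0 := bd_ge0 aW; have F0 := bd_ge0 aF.
have d1 : d <= 1 by exact: le_trans d01.
have hh : h2 h by exists d.
have hv := h2D hu hh; set v := fun k => u k + h k in hv aF aF' *.
have [B hB] : exists B, bd w4 a' B.
  have [C' _ hC'] := Aseq_regularity x hv; have [A' hA'] := a'2.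
  by eexists; apply: hC' hA' aF'.
have b2 : l2 (fun n => a' n - a n) by exact: l2B.
have CLd : C * (d * L) <= 8^-1.
  apply: le_trans CL; apply: ler_wpM2l => //; exact: ler_wpM2r.
have := @halving w4 (fun n => a' n - a n) (C * (2 * F + 4 * (d * L * W))) _ _
  (bdB (@w4_ge0 R) hB aW).
move=> H; apply: bd_mono (H _); last first.
  move=> D hD; have D0 := bd_ge0 hD.
  have a'W : bd w4 a' (2 * D + 2 * W).
    have -> : a' = fun n => (a' n - a n) + a n by apply/funext => n; rewrite subrK.
    by apply: bdD => // k; exact: w4_ge0.
  have hA : bd w4 (Aseq x u (fun n => a' n - a n)) (2 * F + 2 * (d * L * (2 * D + 2 * W))).
    have -> : Aseq x u (fun n => a' n - a n) =
        fun n => (Aseq x v a' n - Aseq x u a n) + x%:C%C * Eseq u h a' n.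
      rewrite (AseqB x hu a'2 a2) (Aseq_perturb x hu hh a'2); apply/funext => n.
      by rewrite [RHS]addrAC subrK.
    apply: bdD => //; first by move=> k; exact: w4_ge0.
    have := bdZ (x%:C%C) (bd_Eseq (@K_weight4 R) a'2 d1 uU hd a'W).
    by apply: bd_mono; rewrite le_eqVlt; apply/orP; left; apply/eqP; rewrite /L; ring.
  apply: bd_mono (hC _ _ b2 hA).
  have -> : C * (2 * F + 2 * (d * L * (2 * D + 2 * W))) =
    C * (2 * F + 4 * (d * L * W)) + 4 * (C * (d * L) * D) by ring.
  by have := ler_wpM2r D0 CLd; lra.
have t1 : 0 <= C * (d * W) by apply: mulr_ge0 => //; exact: mulr_ge0.
have t2 : 0 <= C * L * F by exact: mulr_ge0.
rewrite -subr_ge0.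
have -> : 2 * (2 * C + 4 * C * L) * (F + d * W) - 2 * (C * (2 * F + 4 * (d * L * W))) =
  8 * (C * L * F) + 4 * (C * (d * W)) by ring.
lra.
Qed.

End Resolvent.

(** * Products of Hardy functions *)

Section Multiplication.
Context {R : realType}.
Implicit Types (f g h : R -> R[i]) (a b u x y : nat -> R[i]).
Local Notation mu := (@lebesgue_measure R).

(** Multiplication by [z^n] on coefficients. *)
Definition shiftr n a : nat -> R[i] := fun k => if (k < n)%N then 0 else a (k - n)%N.

Lemma bd_shiftr1 a A : bd w1 a A -> bd w1 (shiftr 1 a) A.
Proof.
move=> /bd1E aA; apply/bd1E => -[|N]; first by have := aA 0%N; rewrite !big_ord0.
rewrite big_ord_recl /= /shiftr /= normsq0 add0r; apply: le_trans (aA N).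
by apply: ler_sum => k _; rewrite /bump /= add1n subSS subn0.
Qed.

Lemma l2_shiftr n a : l2 a -> l2 (shiftr n a).
Proof.
move=> [A /bd1E aA]; exists A; apply/bd1E => N.
have [Nn|nN] := leqP N n.
  rewrite big1; first by have := aA 0%N; rewrite big_ord0.
  by move=> k _; rewrite /shiftr (leq_trans (ltn_ord k) Nn) normsq0.
rewrite -(big_mkord xpredT (fun k => normsq (shiftr n a k))) (@big_cat_nat _ _ _ n 0 N) ?(ltnW nN)//=.
rewrite big_nat big1 ?add0r; last by move=> k /andP[_ kn]; rewrite /shiftr kn normsq0.
apply: le_trans (aA (N - n)%N); rewrite -[X in \sum_(X <= _ < _) _]add0n big_addn big_mkord.
by apply: ler_sum => k _; rewrite /shiftr ltnNge leq_addl /= addnK.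
Qed.

Lemma dot_shiftr n x y : l2 x -> l2 y -> dot x (shiftr n y) = dot (fun k => x (k + n)%N) y.
Proof.
move=> x2 y2; apply/esym; apply: dot_eq => //; first exact: l2_shift.
have := ccvg_shift n (dotP x2 (l2_shiftr n y2)); congr ccvg; apply/funext => N.
rewrite /pdot -(big_mkord xpredT (fun k => x k * conjc (shiftr n y k))).
rewrite (@big_cat_nat _ _ _ n 0) ?leq_addl//= big_nat big1 ?add0r; last first.
  by move=> k /andP[_ kn]; rewrite /shiftr kn conjc0 mulr0.
rewrite -[X in \sum_(X <= _ < _) _]add0n big_addn addnK big_mkord.
by apply: eq_bigr => k _; rewrite /shiftr ltnNge leq_addl /= addnK.
Qed.

Lemma hardy_expiM n f : hardy f -> hardy (fun t => expi (Posz n) t * f t).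
Proof.
move=> [f2 f0]; split; first exact: L2_expiM.
move=> m m0; rewrite fourier_expiM// f0//.
by rewrite subr_lt0 (lt_le_trans m0).
Qed.

Lemma coefs_expiM n f : hardy f -> coefs (fun t => expi (Posz n) t * f t) = shiftr n (coefs f).
Proof.
move=> [f2 f0]; apply/funext => k; rewrite /coefs fourier_expiM// /shiftr.
case: ltnP => kn; last by rewrite subzn.
by rewrite f0// subr_lt0 ltz_nat.
Qed.

(** The mean of [f g expi(-n)] is the conjugate of [(expi(n) conj g | f)], whose
    first argument has no frequency above [n]: the sum of Parseval is finite. *)
Lemma fourier_mul f g n : hardy f -> hardy g ->
  fourier (fun t => f t * g t) n = if n is Posz k then conv (coefs f) (coefs g) k else 0.
Proof.
move=> hf hg; have [f2 f0] := hf; have [g2 g0] := hg.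
pose k t := expi n t * conjc (g t).
have k2 : L2 k by apply: L2_expiM; exact: L2J.
have e : fourier (fun t => f t * g t) n = conjc (ip k f).
  rewrite ipJ//; apply: eq_cmean => t.
  by rewrite /k conjcM conjcK -mulrA [g t * _]mulrC.
have kc (m : nat) : coefs k m = conjc (fourier g (n - Posz m)).
  by rewrite /coefs /k fourier_expiM ?fourierJ ?opprB//; exact: L2J.
have l2k := l2_coefs k2; have l2f := l2_coefs f2.
rewrite e parseval_hardy//; case: n => n in k k2 e kc l2k *.
  rewrite (@dot_finite _ _ _ n.+1)//; last first.
    by move=> m nm; rewrite kc g0 ?conjc0// subr_lt0 ltz_nat.
  rewrite conjc_sum /conv; apply: eq_bigr => m _.
  rewrite kc conjcM !conjcK mulrC; congr (_ * _).
  by rewrite /coefs subzn// -ltnS.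
rewrite (@dot_finite _ _ _ 0)//; first by rewrite big_ord0 conjc0.
move=> m _; rewrite kc g0 ?conjc0// NegzE -opprD oppr_lt0 //.
Qed.

Lemma cmean_mul f g : hardy f -> hardy g ->
  cmean (fun t => f t * g t) = coefs f 0%N * coefs g 0%N.
Proof.
move=> hf hg; have := fourier_mul (Posz 0) hf hg.
rewrite /conv big_ord1 subn0 => <-; rewrite fourierE; apply: eq_cmean => t.
by rewrite oppr0 expi0 mulr1.
Qed.

(** ** Fourth-power integrable functions *)

Definition L4 f := cmfun f /\ mu.-integrable circle (fun t => (normsq (f t) ^+ 2)%:E).

Lemma L4_of_sq f : cmfun f -> L2 (fun t => f t * f t) -> L4 f.
Proof.
move=> mf [_ _ i]; split => //; apply: eq_integrable i; first exact: mcircle.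
by move=> t _; rewrite normsqM expr2.
Qed.

Lemma L4_intro f (g : R -> R) : cmfun f -> mu.-integrable circle (fun t => (g t)%:E) ->
  (forall t, normsq (f t) ^+ 2 <= g t) -> L4 f.
Proof.
move=> mf ig h; apply: L4_of_sq => //.
by apply: (L2_intro (cmfunM mf mf) ig) => t _; rewrite normsqM -expr2.
Qed.

Lemma integrable_cst1 (c : R) : mu.-integrable circle (fun=> c%:E).
Proof.
apply: (@measurable_bounded_integrable _ _ _ mu (fun=> c)) => //.
- exact: mcircle.
- by rewrite [X in (X < _)%E]mu_circle ltry.
- by exists `|c|; split => // M /ltW CM x _.
Qed.

Lemma L4M f g : L4 f -> L4 g -> L2 (fun t => f t * g t).
Proof.
move=> [mf i1] [mg i2]; apply: (L2_intro (g := fun t => normsq (f t) ^+ 2 + normsq (g t) ^+ 2)).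
- exact: cmfunM.
- exact: integrable_add.
move=> t _; rewrite normsqM; have := sqr_ge0 (normsq (f t) - normsq (g t)).
have := sqr_ge0 (normsq (f t)); have := sqr_ge0 (normsq (g t)); nra.
Qed.

Lemma L4J f : L4 f -> L4 (fun t => conjc (f t)).
Proof.
by move=> [mf i]; apply: (L4_intro (cmfunJ mf) i) => t; rewrite normsqJ.
Qed.

Lemma L4Z z f : L4 f -> L4 (fun t => z * f t).
Proof.
move=> [mf i]; apply: (L4_intro (cmfunZ z mf) (integrable_scale (normsq z ^+ 2) i)) => t.
by rewrite normsqM exprMn.
Qed.

Lemma L4D f g : L4 f -> L4 g -> L4 (fun t => f t + g t).
Proof.
move=> [mf i1] [mg i2].
apply: (L4_intro (cmfunD mf mg) (integrable_add (integrable_scale 8 i1) (integrable_scale 8 i2))) => t.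
have := normsqD (f t) (g t); have := normsq_ge0 (f t + g t).
set p := normsq (f t); set q := normsq (g t); set r := normsq _ => r0 h.
have : r ^+ 2 <= (2 * p + 2 * q) ^+ 2 by rewrite ler_sqr ?nnegrE// (le_trans r0).
by move=> /le_trans; apply; have := sqr_ge0 (p - q); nra.
Qed.

Lemma L4_cst z : @L4 (fun=> z).
Proof.
by apply: (L4_intro (cmfun_cst z) (integrable_cst1 (normsq z ^+ 2))).
Qed.

Lemma L4_expiM n f : L4 f -> L4 (fun t => expi n t * f t).
Proof.
move=> [mf i]; apply: (L4_intro (cmfunM (cmfun_expi n) mf) i) => t.
by rewrite normsqM normsq_expi mul1r.
Qed.

(** Functions in [H^{1/4}] are fourth-power integrable: the square has
    square-summable coefficients, and is determined by them among integrable
    functions. *)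
Lemma L2_mul_w4 f g A B : hardy f -> hardy g -> bd w4 (coefs f) A -> bd w4 (coefs g) B ->
  hardy (fun t => f t * g t) /\ coefs (fun t => f t * g t) = conv (coefs f) (coefs g).
Proof.
move=> hf hg fA gB.
have cb := bd_conv4 fA gB.
have [q hq cq] : exists2 q, hardy q & coefs q = conv (coefs f) (coefs g).
  by apply: synthesis; eexists; exact: cb.
have f2 := hardy_L2 hf; have g2 := hardy_L2 hg; have q2 := hardy_L2 hq.
have fg1 := L1M f2 g2.
have fq n : fourier (fun t => f t * g t) n = fourier q n.
  rewrite fourier_mul//; case: n => n; first by rewrite -cq.
  by have [_ ->] := hq.
have ae : aeq q (fun t => f t * g t).
  have := @fourier_uniqueness _ (fun t => f t * g t - q t); case.
  - by apply: L1B => //; exact: L2_L1.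
  - move=> n; rewrite fourierE.
    have -> : cmean (fun t => (f t * g t - q t) * expi (- n) t) =
        fourier (fun t => f t * g t) n - fourier q n.
      rewrite !fourierE -cmeanB.
      + by apply: eq_cmean => t; rewrite mulrBl.
      + under eq_fun do rewrite mulrC.
        apply: (@L1M_bounded _ _ _ 1) => //; first exact: cmfun_expi.
        by move=> t; rewrite normsq_expi expr1n.
      + by under eq_fun do rewrite mulrC; apply: L2_L1; exact: L2_expiM.
    by rewrite fq subrr.
  move=> N [mN N0 h]; exists N; split => // t ht; apply: h => h; apply: ht => ct.
  by apply/esym/eqP; rewrite -subr_eq0 h.
have L2fg : L2 (fun t => f t * g t).
  have mfg := cmfunM (L2_cmfun f2) (L2_cmfun g2).
  case: (mfg) => m1 m2; split => //.
  have mn : measurable_fun circle (fun t => (normsq (f t * g t))%:E).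
    by apply/measurable_EFinP; exact: (cmfun_normsq mfg).
  apply/integrableP; split => //.
  have [_ _ /integrableP[mq lq]] := q2; apply: le_lt_trans lq.
  rewrite le_eqVlt; apply/orP; left; apply/eqP.
  apply: ge0_ae_eq_integral => //; try exact: mcircle; try exact: measurableT_comp.
  by apply: (ae_mono ae) => t /[apply] ->.
split; last by apply/funext => n; rewrite -cq /coefs fq.
by split => // n n0; rewrite fq; have [_ ->] := hq.
Qed.

Lemma L4_w4 f A : hardy f -> bd w4 (coefs f) A -> L4 f.
Proof.
move=> hf fA; apply: L4_of_sq; first by apply: L2_cmfun; exact: hardy_L2.
by have [[]] := L2_mul_w4 hf hf fA fA.
Qed.

End Multiplication.

(** * From operators on functions to operators on sequences *)

Lemma fourier_ip (R : realType) (f : R -> R[i]) n : fourier f n = ip f (expi n).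
Proof. by []. Qed.

#[local] Opaque fourier cmean.

Section HankelOperators.
Context {R : realType}.
Implicit Types (f g h : R -> R[i]) (a b x y : nat -> R[i]).

(** The Hankel operator [H_u] on coefficients. *)
Definition Hseq (u a : nat -> R[i]) : nat -> R[i] := fun n => dot (fun k => u (k + n)%N) a.

Lemma Hseq_Kseq u a n : Hseq u a n.+1 = Kseq u a n.
Proof. by rewrite /Hseq KseqE. Qed.

Lemma Hseq_S u a : (fun k => Hseq u a k.+1) = Kseq u a.
Proof. by apply/funext => k; exact: Hseq_Kseq. Qed.

Lemma fourier_hankel f h n : hardy f -> hardy h ->
  fourier (fun t => f t * conjc (h t)) (Posz n) = Hseq (coefs f) (coefs h) n.
Proof.
move=> hf hh; have he := hardy_expiM n hh; have f2 := hardy_L2 hf; have h2_ := hardy_L2 hh.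
rewrite fourier_ip.
have -> : ip (fun t => f t * conjc (h t)) (expi (Posz n)) = ip f (fun t => expi (Posz n) t * h t).
  by apply: eq_cmean => t; rewrite conjcM -mulrA [conjc (h t) * _]mulrC.
rewrite (parseval_hardy f2 he) (coefs_expiM n hh).
by rewrite (dot_shiftr n (l2_coefs f2) (l2_coefs h2_)).
Qed.

Lemma l2_Hseq u a : h2 u -> l2 a -> l2 (Hseq u a).
Proof.
move=> hu a2; have [B /bd1E hB] := l2_Kseq hu a2.
exists (normsq (Hseq u a 0%N) + B); apply/bd1E => -[|N].
  by rewrite big_ord0 addr_ge0 ?normsq_ge0//; have := hB 0%N; rewrite big_ord0.
by rewrite big_ord_recl lerD2l; exact: hB.
Qed.

Lemma szegoP f g : hardy g -> coefs g = coefs f -> hardy (szego f) /\ coefs (szego f) = coefs f.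
Proof.
move=> hg e; have H : is_szego f g.
  split=> // -[n|n] //= _; exact: (congr1 (@^~ n) e).
rewrite /szego; case: xgetP => [k _ [hk kf]|/(_ g)]; last by case.
by split => //; apply/funext => n; exact: kf.
Qed.

Lemma szego_L2 f : L2 f -> hardy (szego f) /\ coefs (szego f) = coefs f.
Proof. by move=> f2; have [g hg e] := synthesis (l2_coefs f2); exact: szegoP hg e. Qed.

Lemma H12plus_h2 f : H12plus f -> h2 (coefs f).
Proof. by move=> /H12plus_bd ?; eexists; eassumption. Qed.

Lemma H12plus_hardy f : H12plus f -> hardy f. Proof. by case. Qed.

Lemma hankelP f h : H12plus f -> hardy h ->
  hardy (hankel f h) /\ coefs (hankel f h) = Hseq (coefs f) (coefs h).
Proof.
move=> hf hh; have l2H := l2_Hseq (H12plus_h2 hf) (l2_coefs (hardy_L2 hh)).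
have [g hg e] := synthesis l2H.
have eH : coefs (fun t => f t * conjc (h t)) = Hseq (coefs f) (coefs h).
  by apply/funext => n; apply: fourier_hankel => //; exact: H12plus_hardy.
have [h1 h2_] := szegoP hg (etrans e (esym eH)).
split; first exact: h1.
by rewrite /hankel h2_; exact: eH.
Qed.

Lemma shift_hardy h : hardy h -> hardy (Defs.shift h).
Proof. exact: (@hardy_expiM R 1). Qed.

Lemma coefs_shift h : hardy h -> coefs (Defs.shift h) = shiftr 1 (coefs h).
Proof. exact: coefs_expiM. Qed.

Lemma hardy_expi n : hardy (@expi R (Posz n)).
Proof.
split; first exact: L2_expi.
by move=> m m0; rewrite fourier_expi; case: m m0.
Qed.

Lemma shift_adjP f : hardy f ->
  hardy (shift_adj f) /\ coefs (shift_adj f) = fun k => coefs f k.+1.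
Proof.
move=> hf; have f2 := hardy_L2 hf; have l2f := l2_coefs f2.
have l2s : l2 (fun k => coefs f k.+1).
  by have := l2_shift 1 l2f; under eq_fun do rewrite addn1.
have [g hg e] := synthesis l2s.
have H : is_adjoint_shift f g.
  split => // h hh; have h2_ := hardy_L2 hh.
  rewrite (parseval_hardy (hardy_L2 hg) hh) (parseval_hardy f2 (shift_hardy hh)) e.
  rewrite (coefs_shift hh) [RHS](dot_shiftr 1 l2f (l2_coefs h2_)).
  by under [in RHS]eq_fun do rewrite addn1.
rewrite /shift_adj; case: xgetP => [k _ [hk kf]|/(_ g)]; last by case.
split => //; apply/funext => n.
have := kf _ (hardy_expi n); rewrite /coefs !fourier_ip => ->; congr ip.
by apply/funext => t; rewrite /Defs.shift -expiD.
Qed.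

Lemma KopP f h : H12plus f -> hardy h ->
  hardy (Kop f h) /\ coefs (Kop f h) = Kseq (coefs f) (coefs h).
Proof.
move=> hf hh; have [h1 e1] := hankelP hf hh; have [h2_ e2] := shift_adjP h1.
split; first exact: h2_.
by rewrite e2 e1; exact: Hseq_S.
Qed.

Lemma one_sub_xK2P (x : R) f w : H12plus f -> hardy w ->
  hardy (one_sub_xK2 x f w) /\ coefs (one_sub_xK2 x f w) = Aseq x (coefs f) (coefs w).
Proof.
move=> hf hw; have [k1 e1] := KopP hf hw; have [k2 e2] := KopP hf k1.
have kz := hardyZ x%:C%C k2.
split; first exact: hardyB.
rewrite /one_sub_xK2 (coefsB (hardy_L2 hw) (hardy_L2 kz)) (coefsZ _ (hardy_L2 k2)) e2 e1.
by [].
Qed.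

Lemma inv_seq_of_invertible (x : R) f : H12plus f -> invertible_at x f -> inv_seq x (coefs f).
Proof.
move=> hf [surj [C hC]]; split.
  move=> a a2; have [g hg eg] := synthesis a2.
  have [w hw ew] := surj g hg; have [ho eo] := one_sub_xK2P x hf hw.
  exists (coefs w); first by apply: l2_coefs; exact: hardy_L2.
  by rewrite -eo -eg; exact: (aeq_coefs (hardy_L2 ho) (hardy_L2 hg) ew).
exists (C ^+ 2) => a a2; have [w hw ew] := synthesis a2.
have [ho eo] := one_sub_xK2P x hf hw.
rewrite -ew -eo -!L2sq_nsq// /L2sq -!L2norm_sq.
rewrite -exprMn ler_sqr ?nnegrE ?L2norm_ge0//; first exact: hC.
exact: le_trans (L2norm_ge0 w) (hC w hw).
Qed.

Lemma inv_seq_inj (x : R) u a b : h2 u -> inv_seq x u -> l2 a -> l2 b ->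
  Aseq x u a = Aseq x u b -> a = b.
Proof.
move=> hu iu a2 b2 e; have [C C0 hC] := inv_seq_bd hu iu.
have ab2 := l2B a2 b2.
have e0 : Aseq x u (fun n => a n - b n) = fun=> 0.
  by rewrite (AseqB x hu a2 b2) e; apply/funext => n; rewrite subrr.
have h : bd w1 (fun n => a n - b n) (C * 0) by apply: (hC _ _ ab2); rewrite e0; exact: bd_zero.
rewrite mulr0 in h; have := nsq_eq0 ab2 (nsq_le h) => e1.
by apply/funext => n; have := congr1 (@^~ n) e1 => /= /eqP; rewrite subr_eq0 => /eqP.
Qed.

Lemma resolventP (x : R) f g a : H12plus f -> inv_seq x (coefs f) -> hardy g ->
  l2 a -> Aseq x (coefs f) a = coefs g ->
  hardy (resolvent x f g) /\ coefs (resolvent x f g) = a.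
Proof.
move=> hf iu hg a2 ea; have hu := H12plus_h2 hf.
have [w hw ew] := synthesis a2; have [ho eo] := one_sub_xK2P x hf hw.
have H : hardy w /\ aeq (one_sub_xK2 x f w) g.
  by split; [exact: hw|apply: (coefs_inj ho hg); rewrite eo ew ea].
rewrite /resolvent; case: xgetP => [k _ [hk kf]|/(_ w)]; last by case.
split=> //; have [hko eko] := one_sub_xK2P x hf hk.
apply: (inv_seq_inj hu iu (l2_coefs (hardy_L2 hk)) a2).
by rewrite -eko ea; exact: (aeq_coefs (hardy_L2 hko) (hardy_L2 hg) kf).
Qed.

(** The coefficients of the constant function [1]. *)
Definition one_seq : nat -> R[i] := fun k => (k == 0)%:R.

Lemma expi0E : @cst1 R = expi (Posz 0).
Proof. by apply/funext => t; rewrite expi0. Qed.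

Lemma hardy_cst1 : hardy (@cst1 R).
Proof. by rewrite expi0E; exact: hardy_expi. Qed.

Lemma coefs_cst1 : coefs (@cst1 R) = one_seq.
Proof. by apply/funext => k; rewrite /coefs expi0E fourier_expi eq_sym. Qed.

Lemma bd_one w : w 0%N = 1 -> bd w one_seq (1 : R).
Proof.
move=> w0 [|N]; first by rewrite big_ord0.
rewrite big_ord_recl w0 mul1r big1 ?addr0.
  by rewrite /one_seq eqxx /normsq /= expr1n expr0n addr0.
by move=> k _; rewrite /one_seq normsq0 mulr0.
Qed.

Lemma w4_0 : w4 0 = 1 :> R. Proof. by rewrite /w4 addr0 sqrtr1. Qed.

Lemma l2_one : l2 one_seq. Proof. by exists 1; exact: bd_one. Qed.

Lemma Lfun_seq (alpha x : R) f a b : H12plus f -> inv_seq x (coefs f) -> l2 a -> l2 b ->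
  Aseq x (coefs f) a = coefs f -> Aseq x (coefs f) b = one_seq ->
  Lfun_x alpha x f = dot a (coefs f) - alpha%:C%C * dot b one_seq.
Proof.
move=> hf iu a2 b2 ea eb; have hh := H12plus_hardy hf.
have [h1 e1] := resolventP hf iu hh a2 ea.
have [h2_ e2] := resolventP hf iu hardy_cst1 b2 (etrans eb (esym coefs_cst1)).
rewrite /Lfun_x (parseval_hardy (hardy_L2 h1) hh) e1.
by rewrite (parseval_hardy (hardy_L2 h2_) hardy_cst1) e2 coefs_cst1.
Qed.

(** ** The adjoint of [u |-> K_u a] *)

(** The coefficients of [z a b]. *)
Definition zc a b : nat -> R[i] := shiftr 1 (conv a b).

Lemma bd_zc a b A B : bd w4 a A -> bd w4 b B -> bd w1 (zc a b) (4 * (A * B)).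
Proof. by move=> aA bB; apply: bd_shiftr1; exact: bd_conv4. Qed.

Lemma l2_zc a b A B : bd w4 a A -> bd w4 b B -> l2 (zc a b).
Proof. by move=> aA bB; eexists; exact: bd_zc aA bB. Qed.

Lemma zcBl a a' b : zc (fun n => a n - a' n) b = fun n => zc a b n - zc a' b n.
Proof.
apply/funext => n; rewrite /zc /shiftr; case: ifP => _; first by rewrite subrr.
by rewrite /conv -sumrB; apply: eq_bigr => k _; rewrite mulrBl.
Qed.

Lemma zcBr a b b' : zc a (fun n => b n - b' n) = fun n => zc a b n - zc a b' n.
Proof.
apply/funext => n; rewrite /zc /shiftr; case: ifP => _; first by rewrite subrr.
by rewrite /conv -sumrB; apply: eq_bigr => k _; rewrite mulrBr.
Qed.

Lemma synth_w4 a A : bd w4 a A -> exists f, [/\ hardy f, coefs f = a & L4 f].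
Proof.
move=> aA; have [f hf e] := synthesis (bd4_l2 aA); exists f; split => //.
by apply: L4_w4 hf _; rewrite e; exact: aA.
Qed.

(** Both sides are the mean of [h conj (z a b)]. *)
Lemma dot_Kseq_zc (h : nat -> R[i]) a b A B : h2 h -> bd w4 a A -> bd w4 b B ->
  dot (Kseq h a) b = dot h (zc a b).
Proof.
move=> [D hD] aA bB.
have h4 : bd w4 h D by apply: bd_weight_le hD => k; exact: w4_le_w2.
have [fh [hh eh Lh]] := synth_w4 h4.
have [fa [ha ea La]] := synth_w4 aA; have [fb [hb eb Lb]] := synth_w4 bB.
have Lha : L2 (fun t => fh t * conjc (fa t)) by apply: L4M => //; exact: L4J.
have [hab eab] : hardy (fun t => fa t * fb t) /\ coefs (fun t => fa t * fb t) = conv a b.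
  by rewrite -ea -eb; apply: (@L2_mul_w4 _ _ _ A B); rewrite ?ea ?eb.
have a2 := bd4_l2 aA; have b2 := bd4_l2 bB.
have hu : h2 h by exists D.
have eH : coefs (fun t => fh t * conjc (fa t)) = Hseq h a.
  by apply/funext => n; rewrite -eh -ea; exact: fourier_hankel.
transitivity (ip (fun t => fh t * conjc (fa t)) (fun t => expi (Posz 1) t * fb t)).
  rewrite (parseval_hardy Lha (hardy_expiM 1 hb)) eH (coefs_expiM 1 hb) eb.
  rewrite (dot_shiftr 1 (l2_Hseq hu a2) b2).
  by under [in RHS]eq_fun do rewrite addn1; rewrite Hseq_S.
transitivity (ip fh (fun t => expi (Posz 1) t * (fa t * fb t))).
  by apply: eq_cmean => t; rewrite !conjcM; ring.
by rewrite (parseval_hardy (hardy_L2 hh) (hardy_expiM 1 hab)) (coefs_expiM 1 hab) eab eh.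
Qed.

(** First order expansion of [((K_{u+h}^2 - K_u^2) a' | b)] in [h], where [a'] may
    depend on [h]: the error is small compared with the [L^2] norm of [h] as soon
    as the [H^{1/2}] norm of [h] is small. *)
Lemma Eseq_expansion (u : nat -> R[i]) a b (U A B c : R) : bd w2 u U -> bd w4 a A -> bd w4 b B -> 0 <= c ->
  exists2 C : R, 0 <= C & forall (h a' : nat -> R[i]) (d d1 : R), d <= 1 -> bd w2 h d -> bd w1 h d1 -> l2 a' ->
    bd w4 (fun n => a' n - a n) (c * d) ->
    normsq (dot (Eseq u h a') b -
      (conjc (dot h (zc a (Kseq u b))) + dot h (zc b (Kseq u a)))) <= C * (d * d1).
Proof.
move=> uU aA bB c0; have U0 := bd_ge0 uU; have A0 := bd_ge0 aA; have B0 := bd_ge0 bB.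
pose c2 := 2 * (3 * (2 * U + 2) * c) + 2 * (3 * A).
have c20 : 0 <= c2 by rewrite !(addr_ge0, mulr_ge0).
pose C1 := 4 * (c * (3 * U * B)); pose C2 := 4 * (B * c2).
have C10 : 0 <= C1 by rewrite !(addr_ge0, mulr_ge0).
have C20 : 0 <= C2 by rewrite !mulr_ge0.
exists (2 * C1 + 2 * C2); first lra.
move=> h a' d d1 dle1 hd hd1 a'2 a'a.
have d0 := bd_ge0 hd; have d10 := bd_ge0 hd1.
have hu : h2 u by exists U. have hh : h2 h by exists d.
have a2 := bd4_l2 aA; have b2 := bd4_l2 bB.
have hv := h2D hu hh; pose v := fun k => u k + h k.
have vV : bd w2 v (2 * U + 2 * d) by apply: bdD => // k; exact: w2_ge0.
have u2 := h2_l2 hu; have hl2 := h2_l2 hh; have v2 := h2_l2 hv.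
have a'A : bd w4 a' (2 * (c * d) + 2 * A).
  have -> : a' = fun n => (a' n - a n) + a n by apply/funext => n; rewrite subrK.
  by apply: bdD => // k; exact: w4_ge0.
have Kub := bd_Kseq4 uU bB; have Kua := bd_Kseq4 uU aA; have Kva' := bd_Kseq4 vV a'A.
have l2Kub := bd4_l2 Kub; have l2Kha' := l2_Kseq hh a'2; have l2Kva' := l2_Kseq hv a'2.
have e1 : dot (Kseq u (Kseq h a')) b = conjc (dot h (zc a' (Kseq u b))).
  rewrite (dot_Kseq_sym hu l2Kha' b2) -(dotJ l2Kha' l2Kub).
  by rewrite (dot_Kseq_zc hh a'A Kub).
have e2 : dot (Kseq h (Kseq v a')) b = dot h (zc b (Kseq v a')).
  by rewrite (dot_Kseq_sym hh l2Kva' b2) (dot_Kseq_zc hh bB Kva').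
have eE : dot (Eseq u h a') b = conjc (dot h (zc a' (Kseq u b))) + dot h (zc b (Kseq v a')).
  by rewrite -e1 -e2 -(dotDl (l2_Kseq hu l2Kha') (l2_Kseq hh l2Kva') b2).
have z1 := l2_zc a'A Kub; have z2 := l2_zc aA Kub.
have z3 := l2_zc bB Kva'; have z4 := l2_zc bB Kua.
have eD : dot (Eseq u h a') b - (conjc (dot h (zc a (Kseq u b))) + dot h (zc b (Kseq u a))) =
   conjc (dot h (zc (fun n => a' n - a n) (Kseq u b))) +
   dot h (zc b (fun n => Kseq v a' n - Kseq u a n)).
  rewrite eE zcBl zcBr (dotBr z1 z2 hl2) (dotBr z3 z4 hl2) conjcB.
  by rewrite opprD addrACA.
rewrite eD; apply: le_trans (normsqD _ _) _; rewrite normsqJ.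
have t1 : normsq (dot h (zc (fun n => a' n - a n) (Kseq u b))) <= d1 * (4 * (c * d * (3 * U * B))).
  by apply: dot_CS => //; exact: bd_zc.
have dK : bd w4 (fun n => Kseq v a' n - Kseq u a n) (c2 * d).
  have -> : (fun n => Kseq v a' n - Kseq u a n) =
      fun n => Kseq v (fun k => a' k - a k) n + Kseq h a n.
    rewrite (KseqBr v2 a'2 a2) /v (KseqDl u2 hl2 a2); apply/funext => n.
    by rewrite opprD addrA addrNK.
  apply: (@bd_mono _ _ _ (2 * (3 * (2 * U + 2 * d) * (c * d)) + 2 * (3 * d * A))).
    rewrite -subr_ge0; have : 0 <= c * d * (1 - d) by rewrite !mulr_ge0// subr_ge0.
    rewrite /c2; lra.
  apply: bdD; first by move=> k; exact: w4_ge0.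
    exact: bd_Kseq4.
  exact: bd_Kseq4.
have t2 : normsq (dot h (zc b (fun n => Kseq v a' n - Kseq u a n))) <= d1 * (4 * (B * (c2 * d))).
  by apply: dot_CS => //; exact: bd_zc.
have -> : (2 * C1 + 2 * C2) * (d * d1) = 2 * (d1 * (4 * (c * d * (3 * U * B)))) + 2 * (d1 * (4 * (B * (c2 * d)))).
  by rewrite /C1 /C2; ring.
lra.
Qed.

End HankelOperators.

(** * Conjugate pairs *)

Section Involution.
Context {R : realType}.
Implicit Types (f g : R -> R[i]) (u : nat -> R[i]).

Lemma L1_expiM f n : L1 f -> L1 (fun t => f t * expi n t).
Proof.
move=> f1; under eq_fun do rewrite mulrC.
apply: (@L1M_bounded _ _ _ 1) => //; first exact: cmfun_expi.
by move=> t; rewrite normsq_expi expr1n.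
Qed.

Lemma fourierB1 f g n : L1 f -> L1 g ->
  fourier (fun t => f t - g t) n = fourier f n - fourier g n.
Proof.
move=> f1 g1; rewrite !fourierE -cmeanB; try exact: L1_expiM.
by apply: eq_cmean => t; rewrite mulrBl.
Qed.

Lemma fourierZ1 z f n : L1 f -> fourier (fun t => z * f t) n = z * fourier f n.
Proof.
move=> f1; rewrite !fourierE -cmeanZ; last exact: L1_expiM.
by apply: eq_cmean => t; rewrite mulrA.
Qed.

Lemma fourierJ1 f n : L1 f -> fourier (fun t => conjc (f t)) n = conjc (fourier f (- n)).
Proof.
move=> f1; rewrite !fourierE -cmeanJ; last exact: L1_expiM.
by apply: eq_cmean => t; rewrite conjcM conjc_expi !opprK.
Qed.

(** Antianalytic functions; the mean is unconstrained, so that constants are both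
    antianalytic and Hardy. *)
Definition anti f := L2 f /\ forall k : nat, fourier f (Posz k.+1) = 0.

Lemma anti_conj f : anti f -> hardy (fun t => conjc (f t)).
Proof.
move=> [f2 f0]; split; first exact: L2J.
by case=> // k _; rewrite fourierJ// NegzE opprK f0 conjc0.
Qed.

Lemma fourier_conj_mul f g k : hardy f -> hardy g ->
  fourier (fun t => conjc (f t * g t)) (Posz k.+1) = 0.
Proof.
move=> hf hg; rewrite fourierJ1; last by apply: L1M; exact: hardy_L2.
by rewrite -NegzE fourier_mul// conjc0.
Qed.

(** What is used of the functions [a] and [p = 1 + x z K_u a] attached to a
    resolvent at [x]: the symbol [f] exchanges them, up to nonpositive
    frequencies. *)
Definition conjugate_pair (x : R) f a p :=
  [/\ hardy a, hardy p, L4 a, L4 p & anti (fun t => f t * conjc (p t) - a t) /\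
      anti (fun t => x%:C%C * (f t * conjc (a t)) - p t)].

(** Substituting [y f conj b] for [q] and [f conj p] for [a] in the two products
    gives the same [y f conj p conj b]; the two corrections are conjugates of
    products of Hardy functions. *)
Lemma conjugate_pair_anti (x y : R) f a p b q :
  conjugate_pair x f a p -> conjugate_pair y f b q ->
  anti (fun t => y%:C%C * (a t * conjc (b t)) - conjc (p t) * q t).
Proof.
move=> [ha hp La Lp [A1 _]] [hb hq Lb Lq [_ B2]].
have L2ab : L2 (fun t => y%:C%C * (a t * conjc (b t)) - conjc (p t) * q t).
  by apply: L2B; [apply: L2Z; apply: L4M => //; exact: L4J|apply: L4M => //; exact: L4J].
split=> // k.
have h1 := anti_conj A1; have h2_ := anti_conj B2.
have e t : y%:C%C * (a t * conjc (b t)) - conjc (p t) * q t =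
  conjc (p t * conjc (y%:C%C * (f t * conjc (b t)) - q t)) -
  y%:C%C * conjc (b t * conjc (f t * conjc (p t) - a t)).
  by rewrite !conjcM !conjcK; ring.
under eq_fun do rewrite e.
have l1 : L1 (fun t => conjc (p t * conjc (y%:C%C * (f t * conjc (b t)) - q t))).
  by apply: L1J; apply: L1M; exact: hardy_L2.
have l2_ : L1 (fun t => conjc (b t * conjc (f t * conjc (p t) - a t))).
  by apply: L1J; apply: L1M; exact: hardy_L2.
rewrite (fourierB1 _ l1 (L1Z _ l2_)) (fourierZ1 _ _ l2_).
rewrite (fourier_conj_mul k hp h2_) (fourier_conj_mul k hb h1).
by rewrite mulr0 subr0.
Qed.

Lemma dot1 (x y : nat -> R[i]) : l2 x -> l2 y -> (forall k, x k.+1 = 0) ->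
  dot x y = x 0%N * conjc (y 0%N).
Proof.
move=> x2 y2 x0; rewrite (@dot_finite _ _ _ 1) ?big_ord1// => k.
by case: k => // k _; exact: x0.
Qed.

(** With [Z = a conj b] and [G = q conj p], the function [y Z - G] is antianalytic
    and, by exchanging the two pairs, [x Z - G] is Hardy. Their inner product is
    the product of their means. Expanding it in [|Z|^2], [|G|^2] and [(Z | G)] on
    one side, in the means of [Z] and [G] on the other, the imaginary parts
    differ by [x - y] times the difference to be shown to vanish. *)
Lemma conjugate_pair_Im (x y : R) f a p b q : x <> y ->
  conjugate_pair x f a p -> conjugate_pair y f b q ->
  Im (ip (fun t => a t * p t) (fun t => b t * q t)) = Im (ip a b * conjc (ip q p)).
Proof.
move=> xy ab cd; have [ha hp La Lp _] := ab; have [hb hq Lb Lq _] := cd.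
pose Z t := a t * conjc (b t); pose G t := conjc (p t) * q t.
have Z2 : L2 Z by apply: L4M => //; exact: L4J.
have G2 : L2 G by apply: L4M => //; exact: L4J.
have eT : ip (fun t => a t * p t) (fun t => b t * q t) = ip Z G.
  by apply: eq_cmean => t; rewrite /Z /G !conjcM conjcK; ring.
pose P1 t := y%:C%C * Z t - G t; pose P2 t := x%:C%C * Z t - G t.
have [L2P1 a1] : anti P1 := conjugate_pair_anti ab cd.
have hP2 : hardy P2.
  have := anti_conj (conjugate_pair_anti cd ab); congr hardy; apply/funext => t.
  by rewrite /P2 /Z /G conjcB !conjcM !conjcK conjc_real; ring.
have yZ := L2Z y%:C%C Z2; have xZ := L2Z x%:C%C Z2.
have e1 : ip P1 P2 = y%:C%C * x%:C%C * ip Z Z - y%:C%C * ip Z G - x%:C%C * ip G Z + ip G G.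
  rewrite /P2 (ipBr xZ G2 L2P1) (ipZr _ Z2 L2P1) /P1.
  rewrite (ipBl yZ G2 Z2) (ipBl yZ G2 G2) (ipZl _ Z2 Z2) (ipZl _ Z2 G2) conjc_real.
  ring.
have e2 : ip P1 P2 = (y%:C%C * ip a b - ip q p) * conjc (x%:C%C * ip a b - ip q p).
  rewrite (parseval_hardy L2P1 hP2) (dot1 (l2_coefs L2P1) (l2_coefs (hardy_L2 hP2)) a1).
  have c0 (z : R[i]) : coefs (fun t => z * Z t - G t) 0%N = z * ip a b - ip q p.
    rewrite /coefs (fourierB _ (L2Z z Z2) G2) (fourierZ _ _ Z2).
    rewrite !fourierE; congr (_ * _ - _).
      by apply: eq_cmean => t; rewrite oppr0 expi0 mulr1.
    by apply: eq_cmean => t; rewrite oppr0 expi0 mulr1 /G mulrC.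
  by rewrite !c0.
rewrite eT; have := congr1 (@Im R) (etrans (esym e1) e2).
rewrite -(ipJ Z2 G2) (ipE Z) (ipE G).
set T := ip Z G; set m := ip a b; set k := ip q p.
rewrite !(ImD, ImN, ReD, ReN, ImM, ReM, ReJ, ImJ) /=.
move: (Im T) (Re T) (Im m) (Re m) (Im k) (Re k) (Re (ip Z Z)) (Re (ip G G)) => i1 r1 i2 r2 i3 r3 zz gg h.
have : (x - y) * (i1 - (r2 * - i3 + i2 * r3)) = 0 by lra.
move/eqP; rewrite mulf_eq0 subr_eq0 => /orP[/eqP //|/eqP]; lra.
Qed.

Lemma coefs_mul_expi1 f g A B : hardy f -> hardy g -> bd w4 (coefs f) A -> bd w4 (coefs g) B ->
  hardy (fun t => expi (Posz 1) t * (f t * g t)) /\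
  coefs (fun t => expi (Posz 1) t * (f t * g t)) = zc (coefs f) (coefs g).
Proof.
move=> hf hg fA gB; have [h e] := L2_mul_w4 hf hg fA gB.
by split; [exact: hardy_expiM|rewrite (coefs_expiM 1 h) e].
Qed.

Lemma cst1J t : conjc (@cst1 R t) = 1.
Proof. exact: conjc1. Qed.

(** The equation [(1 - x K_u^2) a = e u], required only up to constants, gives the
    pair [a], [e + x z K_u a]. The case [e = 1] covers the resolvent of [u] and
    the case [e = 0] the resolvent of [1]. *)
Lemma conjugate_pair_resolvent (x e A : R) f u a U : hardy f -> coefs f = u ->
  bd w2 u U -> bd w4 a A ->
  (forall k, a k.+1 - x%:C%C * Kseq u (Kseq u a) k.+1 = e%:C%C * u k.+1) ->
  exists fa p, [/\ conjugate_pair x f fa p, coefs fa = a,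
     coefs p = (fun k => e%:C%C * one_seq k + x%:C%C * shiftr 1 (Kseq u a) k),
     hardy (fun t => fa t * p t) &
     coefs (fun t => fa t * p t) = fun k => e%:C%C * a k + x%:C%C * zc a (Kseq u a) k].
Proof.
move=> hf ef uU aA ea; have Ka := bd_Kseq4 uU aA.
have u4 : bd w4 u U by apply: bd_weight_le uU => k; exact: w4_le_w2.
have Lf : L4 f by apply: (L4_w4 (A := U) hf); rewrite ef.
have f2 := hardy_L2 hf.
have [fa [ha ca La]] := synth_w4 aA; have [k [hk ck Lk]] := synth_w4 Ka.
pose zk t := expi (Posz 1) t * k t.
have hzk : hardy zk by exact: hardy_expiM.
have czk : coefs zk = shiftr 1 (Kseq u a) by rewrite (coefs_expiM 1 hk) ck.
have Lzk : L4 zk by exact: L4_expiM.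
pose c t := e%:C%C * @cst1 R t.
pose p t := c t + x%:C%C * zk t.
have hc : hardy c by apply: hardyZ; exact: hardy_cst1.
have cc : coefs c = fun k => e%:C%C * one_seq k.
  by rewrite (coefsZ _ (hardy_L2 hardy_cst1)) coefs_cst1.
have hp : hardy p by apply: hardyD => //; exact: hardyZ.
have cp : coefs p = (fun k => e%:C%C * one_seq k + x%:C%C * shiftr 1 (Kseq u a) k).
  rewrite (coefsD (hardy_L2 hc) (L2Z _ (hardy_L2 hzk))) cc.
  by rewrite (coefsZ _ (hardy_L2 hzk)) czk.
have Lc : L4 c by apply: L4Z; exact: L4_cst.
have Lp : L4 p by apply: L4D => //; exact: L4Z.
have L2fzk : L2 (fun t => f t * conjc (zk t)) by apply: L4M => //; exact: L4J.
have L2ffa : L2 (fun t => f t * conjc (fa t)) by apply: L4M => //; exact: L4J.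
have a2 := hardy_L2 ha; have p2 := hardy_L2 hp.
have l2Ka := bd4_l2 Ka; have l2u : l2 u := bd4_l2 u4.
have ezc := @coefs_mul_expi1 fa k A (3 * U * A) ha hk.
rewrite ca ck in ezc; have [hz cz] := ezc aA Ka.
have efp : (fun t => fa t * p t) =
    (fun t => e%:C%C * fa t + x%:C%C * (expi (Posz 1) t * (fa t * k t))).
  by apply/funext => t; rewrite /p /c /zk /cst1; ring.
exists fa, p; split; [|exact: ca|exact: cp| |].
- split; [exact: ha|exact: hp|exact: La|exact: Lp|].
  split; split.
  + by apply: L2B => //; apply: L4M => //; exact: L4J.
  + move=> n.
    have -> : (fun t => f t * conjc (p t) - fa t) =
        (fun t => (e%:C%C * f t + x%:C%C * (f t * conjc (zk t))) - fa t).
      apply/funext => t; rewrite /p /c conjcD !conjcM cst1J (conjc_real e) (conjc_real x); ring.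
    rewrite (fourierB _ (L2D (L2Z _ f2) (L2Z _ L2fzk)) a2).
    rewrite (fourierD _ (L2Z _ f2) (L2Z _ L2fzk)) (fourierZ _ _ f2) (fourierZ _ _ L2fzk).
    rewrite (fourier_hankel n.+1 hf hzk) -[fourier f _]/(coefs f n.+1) -[fourier fa _]/(coefs fa n.+1).
    rewrite ef ca czk /Hseq (dot_shiftr 1 (l2_shift n.+1 l2u) l2Ka).
    have -> : dot (fun k0 => u (k0 + 1 + n.+1)%N) (Kseq u a) = Kseq u (Kseq u a) n.+1.
      rewrite KseqE.
      by under eq_fun do rewrite addn1 addSnnS.
    by rewrite -ea; ring.
  + by apply: L2B => //; exact: L2Z.
  + move=> n; rewrite (fourierB _ (L2Z _ L2ffa) p2) (fourierZ _ _ L2ffa).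
    rewrite (fourier_hankel n.+1 hf ha) -[fourier p _]/(coefs p n.+1) ef ca cp.
    rewrite /one_seq /shiftr /= mulr0 add0r subSS subn0.
    by rewrite Hseq_Kseq subrr.
- by rewrite efp; apply: hardyD; exact: hardyZ.
- rewrite efp (coefsD (L2Z _ a2) (L2Z _ (hardy_L2 hz))) (coefsZ _ a2) (coefsZ _ (hardy_L2 hz)).
  by rewrite ca cz.
Qed.

End Involution.

(** * Orthogonality of the gradients *)

Section GradientInvolution.
Context {R : realType}.
Implicit Types (a b u : nat -> R[i]) (x y alpha : R).

Lemma Kseq2_Aseq x u a : h2 u -> l2 a ->
  Kseq u (Kseq u (Aseq x u a)) = Aseq x u (Kseq u (Kseq u a)).
Proof.
move=> hu a2; have u2 := h2_l2 hu; have k1 := l2_Kseq hu a2; have k2 := l2_Kseq hu k1.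
have k3 := l2_Kseq hu k2; have xk2 := l2Z x%:C%C k2.
rewrite {1}/Aseq (KseqBr u2 a2 xk2) (KseqZr _ u2 k2).
rewrite (KseqBr u2 k1 (l2Z _ k3)) (KseqZr _ u2 k3) conjcK.
by apply/funext => n; rewrite /Aseq.
Qed.

Lemma Aseq_comm x y u a : h2 u -> l2 a ->
  Aseq x u (Aseq y u a) = Aseq y u (Aseq x u a).
Proof.
move=> hu a2; have k2 := l2_Kseq hu (l2_Kseq hu a2).
apply/funext => n; rewrite {1}/Aseq (Kseq2_Aseq y hu a2) [in RHS]/Aseq (Kseq2_Aseq x hu a2).
rewrite /Aseq.
by move: (Kseq u _ n) (Kseq u _ n) (a n) => z1 z2 z3; ring.
Qed.

(** The resolvents at [x] and [y] are symmetric and commute with each other and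
    with [K_u^2]. *)
Lemma resolvent_exchange x y u f g a a' b b' : h2 u -> inv_seq y u ->
  l2 a -> l2 a' -> l2 b -> l2 b' ->
  Aseq x u a = f -> Aseq x u a' = g -> Aseq y u b = f -> Aseq y u b' = g ->
  dot a' b = dot b' a /\ dot (Kseq u (Kseq u a')) b = dot (Kseq u (Kseq u b')) a.
Proof.
move=> hu iy a2 a'2 b2 b'2 ea ea' eb eb'.
have [surj _] := iy; have [c c2 ec] := surj a' a'2.
have xc2 := l2_Aseq x hu c2.
have ecb : Aseq x u c = b'.
  apply: (inv_seq_inj hu iy xc2 b'2).
  by rewrite -(Aseq_comm x y hu c2) ec ea' eb'.
have Kc := l2_Kseq hu (l2_Kseq hu c2).
split.
  by rewrite -ec (dot_Aseq_sym y hu c2 b2) eb -ea -(dot_Aseq_sym x hu c2 a2) ecb.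
rewrite -ec (Kseq2_Aseq y hu c2) (dot_Aseq_sym y hu Kc b2) eb -ea -(dot_Aseq_sym x hu Kc a2).
by rewrite -(Kseq2_Aseq x hu c2) ecb.
Qed.

Lemma dot_one_r a : l2 a -> dot a (@one_seq R) = a 0%N.
Proof.
move=> a2; rewrite -(dotJ (@l2_one R) a2) (dot1 (@l2_one R) a2) //.
by rewrite conjcM conjcK conjc1 mul1r.
Qed.

Lemma dot_one_shiftr (e1 e2 x y : R) ka kb : l2 ka -> l2 kb ->
  dot (fun k => e2%:C%C * one_seq k + y%:C%C * shiftr 1 kb k)
      (fun k => e1%:C%C * one_seq k + x%:C%C * shiftr 1 ka k) =
  (e1 * e2)%:C%C + (x * y)%:C%C * dot kb ka.
Proof.
move=> ka2 kb2; have o2 := @l2_one R; have sa := l2_shiftr 1 ka2; have sb := l2_shiftr 1 kb2.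
have X2 := l2D (l2Z e2%:C%C o2) (l2Z y%:C%C sb).
rewrite (dotDr (l2Z _ o2) (l2Z _ sa) X2) (dotZr _ o2 X2) (dotZr _ sa X2) !conjc_real.
rewrite (dot_one_r X2) (dot_shiftr 1 X2 ka2).
have -> : (fun k => e2%:C%C * one_seq (k + 1)%N + y%:C%C * shiftr 1 kb (k + 1)%N) =
  (fun k => y%:C%C * kb k).
  by apply/funext => k; rewrite addn1 /one_seq /shiftr /= mulr0 add0r subSS subn0.
by rewrite (dotZl _ kb2 ka2) /one_seq /shiftr /= mulr1 mulr0 addr0 mulrA -!rmorphM.
Qed.

(** The gradient of [L_x] at [u] for the real inner product [2 Re (.|.)], from
    the solutions [a] and [b] of [(1 - x K_u^2) a = u] and [(1 - x K_u^2) b = 1]. *)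
Definition gradient x alpha u a b : nat -> R[i] := fun k =>
  (a k + x%:C%C * zc a (Kseq u a) k) - alpha%:C%C * (x%:C%C * zc b (Kseq u b) k).

(** Resolvents of smooth data are smooth. *)
Lemma solution_w4 x u (F : R) a f : h2 u -> inv_seq x u -> l2 a -> Aseq x u a = f ->
  bd w4 f F -> exists A, bd w4 a A.
Proof.
move=> hu iu a2 ea fF; have [C C0 hC] := inv_seq_bd4 hu iu.
by exists (C * F); apply: hC => //; rewrite ea.
Qed.

Lemma Im_realM (c : R) (z : R[i]) : Im (c%:C%C * z) = c * Im z.
Proof. by rewrite ImM /= mul0r addr0. Qed.

Lemma Re_realM (c : R) (z : R[i]) : Re (c%:C%C * z) = c * Re z.
Proof. by rewrite ReM /= mul0r subr0. Qed.

Lemma Im_bilinear (c p' q' r' s' : R) (p q r s : R[i]) :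
  Im p = p' -> Im q = q' -> Im r = r' -> Im s = s' ->
  (p' - c * q') - c * (r' - c * s') = 0 ->
  Im ((p - c%:C%C * q) - c%:C%C * (r - c%:C%C * s)) = 0.
Proof. by move=> <- <- <- <- <-; rewrite !ImB !Im_realM !ImB !Im_realM. Qed.

Lemma Im0_conjc (z : R[i]) : z = conjc z -> Im z = 0.
Proof. by move=> /(congr1 (@Im R)); rewrite ImJ; lra. Qed.

(** By [conjugate_pair_Im] the four pairings reduce to scalar products of
    resolvents: those of [a] with [a'] and of [b] with [b'] are real by symmetry,
    and the two mixed ones are conjugate to each other by [resolvent_exchange].
    For [x = y] the two gradients are equal. *)
Lemma gradient_real x y alpha u a b a' b' : h2 u -> inv_seq x u -> inv_seq y u ->
  l2 a -> l2 b -> l2 a' -> l2 b' ->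
  Aseq x u a = u -> Aseq x u b = one_seq -> Aseq y u a' = u -> Aseq y u b' = one_seq ->
  Im (dot (gradient x alpha u a b) (gradient y alpha u a' b')) = 0.
Proof.
move=> hu ix iy a2 b2 a'2 b'2 ea eb ea' eb'.
have [U uU] := hu; have l2u := h2_l2 hu.
have u4 : bd w4 u U by apply: bd_weight_le uU => k; exact: w4_le_w2.
have o4 : bd w4 (@one_seq R) 1 by apply: bd_one; exact: w4_0.
have [A aA] := solution_w4 hu ix a2 ea u4; have [B bB] := solution_w4 hu ix b2 eb o4.
have [A' aA'] := solution_w4 hu iy a'2 ea' u4; have [B' bB'] := solution_w4 hu iy b'2 eb' o4.
have [exy|xy] := pselect (x = y).
  rewrite -exy in ea' eb' *.
  have <- : a = a' by apply: (inv_seq_inj hu ix a2 a'2); rewrite ea ea'.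
  have <- : b = b' by apply: (inv_seq_inj hu ix b2 b'2); rewrite eb eb'.
  have za := l2_zc aA (bd_Kseq4 uU aA); have zb := l2_zc bB (bd_Kseq4 uU bB).
  by rewrite dot_selfE//; apply: l2B; [apply: l2D => //; exact: l2Z|do 2 apply: l2Z].
have [f hf ef] := synthesis l2u.
have Ea c z k : Aseq z u c = u -> c k.+1 - z%:C%C * Kseq u (Kseq u c) k.+1 = 1%:C%C * u k.+1.
  by move=> e; rewrite -[in RHS]e mul1r.
have Eb c z k : Aseq z u c = one_seq -> c k.+1 - z%:C%C * Kseq u (Kseq u c) k.+1 = 0%:C%C * u k.+1.
  by move=> e; rewrite mul0r -[LHS]/(Aseq z u c k.+1) e.
have [fa [p [cpa ca cp hap gap]]] := conjugate_pair_resolvent hf ef uU aA (fun k => Ea _ _ k ea).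
have [fb [q [cpb cb cq hbq gbq]]] := conjugate_pair_resolvent hf ef uU bB (fun k => Eb _ _ k eb).
have [fa' [p' [cpa' ca' cp' hap' gap']]] :=
  conjugate_pair_resolvent hf ef uU aA' (fun k => Ea _ _ k ea').
have [fb' [q' [cpb' cb' cq' hbq' gbq']]] :=
  conjugate_pair_resolvent hf ef uU bB' (fun k => Eb _ _ k eb').
set G1 := coefs (fun t => fa t * p t) in gap.
set G2 := coefs (fun t => fb t * q t) in gbq.
set G1' := coefs (fun t => fa' t * p' t) in gap'.
set G2' := coefs (fun t => fb' t * q' t) in gbq'.
have l1 : l2 G1 := l2_coefs (hardy_L2 hap); have l2_ : l2 G2 := l2_coefs (hardy_L2 hbq).
have l1' : l2 G1' := l2_coefs (hardy_L2 hap'); have l2' : l2 G2' := l2_coefs (hardy_L2 hbq').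
have eg : gradient x alpha u a b = fun k => G1 k - alpha%:C%C * G2 k.
  by apply/funext => k; rewrite /gradient gap gbq mul1r mul0r add0r.
have eg' : gradient y alpha u a' b' = fun k => G1' k - alpha%:C%C * G2' k.
  by apply/funext => k; rewrite /gradient gap' gbq' mul1r mul0r add0r.
have lg' := l2B l1' (l2Z alpha%:C%C l2').
rewrite eg eg' (dotBl l1 (l2Z _ l2_) lg') (dotZl _ l2_ lg').
rewrite (dotBr l1' (l2Z _ l2') l1) (dotBr l1' (l2Z _ l2') l2_).
rewrite (dotZr _ l2' l1) (dotZr _ l2' l2_) conjc_real.
have l2K c : l2 c -> l2 (Kseq u c) by exact: l2_Kseq.
have key ga pa gc pc (e1 e2 : R) (c d : nat -> R[i]) : l2 c -> l2 d ->
    conjugate_pair x f ga pa -> conjugate_pair y f gc pc -> coefs ga = c -> coefs gc = d ->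
    coefs pa = (fun k => e1%:C%C * one_seq k + x%:C%C * shiftr 1 (Kseq u c) k) ->
    coefs pc = (fun k => e2%:C%C * one_seq k + y%:C%C * shiftr 1 (Kseq u d) k) ->
    hardy (fun t => ga t * pa t) -> hardy (fun t => gc t * pc t) ->
    Im (dot (coefs (fun t => ga t * pa t)) (coefs (fun t => gc t * pc t))) =
    Im (dot c d * conjc ((e1 * e2)%:C%C + (x * y)%:C%C * dot (Kseq u d) (Kseq u c))).
  move=> c2 d2 pr1 pr2 e_c e_d e_pc e_pd h1 h2_.
  rewrite -(parseval_hardy (hardy_L2 h1) h2_) (conjugate_pair_Im xy pr1 pr2).
  have [hga hpa _ _ _] := pr1; have [hgc hpc _ _ _] := pr2.
  rewrite (parseval_hardy (hardy_L2 hga) hgc) (parseval_hardy (hardy_L2 hpc) hpa).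
  by rewrite e_c e_d e_pc e_pd (dot_one_shiftr e1 e2 x y (l2K _ c2) (l2K _ d2)).
have T11 := key _ _ _ _ _ _ _ _ a2 a'2 cpa cpa' ca ca' cp cp' hap hap'.
have T12 := key _ _ _ _ _ _ _ _ a2 b'2 cpa cpb' ca cb' cp cq' hap hbq'.
have T21 := key _ _ _ _ _ _ _ _ b2 a'2 cpb cpa' cb ca' cq cp' hbq hap'.
have T22 := key _ _ _ _ _ _ _ _ b2 b'2 cpb cpb' cb cb' cq cq' hbq hbq'.
have [m11 k11] := resolvent_exchange hu iy a2 a2 a'2 a'2 ea ea ea' ea'.
have [m22 k22] := resolvent_exchange hu iy b2 b2 b'2 b'2 eb eb eb' eb'.
have [m21 k21] := resolvent_exchange hu iy a2 b2 a'2 b'2 ea eb ea' eb'.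
have Kd c d : l2 c -> l2 d -> dot (Kseq u d) (Kseq u c) = dot (Kseq u (Kseq u c)) d.
  by move=> c2 d2; rewrite (dot_Kseq_sym hu d2 (l2K _ c2)).
have Kd' c d : l2 c -> l2 d -> dot (Kseq u (Kseq u d)) c = conjc (dot (Kseq u (Kseq u c)) d).
  move=> c2 d2; rewrite -(Kd _ _ c2 d2) (dotJ (l2K _ d2) (l2K _ c2)).
  by rewrite (Kd _ _ d2 c2).
rewrite -/G1 -/G1' in T11; rewrite -/G1 -/G2' in T12.
rewrite -/G2 -/G1' in T21; rewrite -/G2 -/G2' in T22.
apply: (Im_bilinear T11 T12 T21 T22).
rewrite (Kd _ _ a2 a'2) (Kd _ _ a2 b'2) (Kd _ _ b2 a'2) (Kd _ _ b2 b'2).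
have r1 : Im (dot a a') = 0.
  by apply: Im0_conjc; rewrite (dotJ a2 a'2); exact: m11.
have r2 : Im (dot b b') = 0.
  by apply: Im0_conjc; rewrite (dotJ b2 b'2); exact: m22.
have r3 : Im (dot (Kseq u (Kseq u a)) a') = 0.
  by apply: Im0_conjc; rewrite -(Kd' _ _ a2 a'2); exact: k11.
have r4 : Im (dot (Kseq u (Kseq u b)) b') = 0.
  by apply: Im0_conjc; rewrite -(Kd' _ _ b2 b'2); exact: k22.
have c1 : dot b a' = conjc (dot a b') by rewrite m21 (dotJ a2 b'2).
have c2 : dot (Kseq u (Kseq u b)) a' = conjc (dot (Kseq u (Kseq u a)) b').
  by rewrite k21 (Kd' _ _ a2 b'2).
rewrite c1 c2.
move: r1 r2 r3 r4.
move: (dot a a') (dot b b') (dot a b') (dot (Kseq u (Kseq u a)) a')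
  (dot (Kseq u (Kseq u b)) b') (dot (Kseq u (Kseq u a)) b') => z1 z2 z3 z4 z5 z6 r1 r2 r3 r4.
clear -r1 r2 r3 r4.
rewrite !ImM !ImJ !ReJ !ReD !ImD !Re_realM !Im_realM ?ImJ ?ReJ r1 r2 r3 r4 /=.
ring.
Qed.

End GradientInvolution.

(** * First order expansion *)

Section Differential.
Context {R : realType}.
Implicit Types (a b u s h : nat -> R[i]) (x alpha : R).

Lemma sqr_Re_le (z : R[i]) (B : R) : normsq z <= B -> Re z ^+ 2 <= B.
Proof. by apply: le_trans; rewrite /normsq lerDl sqr_ge0. Qed.

Lemma sqr_add_le (p q P Q : R) : p ^+ 2 <= P -> q ^+ 2 <= Q -> (p + q) ^+ 2 <= 2 * P + 2 * Q.
Proof. by move=> hp hq; have := sqr_ge0 (p - q); rewrite sqrrB sqrrD; lra. Qed.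

(** Self-adjointness of [1 - x K_u^2] removes the unknown [a'] from the
    zeroth-order terms. *)
Lemma dot_increment x u h f s a a' : h2 u -> h2 h -> l2 f -> l2 s -> l2 a -> l2 a' ->
  Aseq x u a = f -> Aseq x (fun k => u k + h k) a' = (fun k => f k + s k) ->
  dot a' (fun k => f k + s k) - dot a f =
  dot s a + dot a' s + x%:C%C * dot (Eseq u h a') a.
Proof.
move=> hu hh f2 s2 a2 a'2 ea ea'.
have E2 := l2_Eseq hu hh a'2.
have eA : Aseq x u a' = fun k => (f k + s k) + x%:C%C * Eseq u h a' k.
  apply/funext => k; have := congr1 (fun g => g k) ea'.
  rewrite (Aseq_perturb x hu hh a'2).
  by move: (Aseq x u a' k) (Eseq u h a' k) => z1 z2 /= <-; rewrite subrK.
have e1 : dot a' f = dot f a + dot s a + x%:C%C * dot (Eseq u h a') a.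
  rewrite -{1}ea -(dot_Aseq_sym x hu a'2 a2) eA.
  by rewrite (dotDl (l2D f2 s2) (l2Z _ E2) a2) (dotDl f2 s2 a2) (dotZl _ E2 a2).
have e2 : dot a f = dot f a by rewrite -ea (dot_Aseq_sym x hu a2 a2).
rewrite (dotDr f2 s2 a'2) e1 e2.
by move: (dot f a) (dot s a) (dot a' s) (dot _ a) => z1 z2 z3 z4; ring.
Qed.

Lemma dot_increment_bd x u U f F a : bd w2 u U -> inv_seq x u -> bd w4 f F ->
  l2 a -> Aseq x u a = f ->
  exists d0 C, [/\ 0 < d0, 0 <= C & forall h s (d d1 : R), d <= d0 ->
    bd w2 h d -> bd w1 h d1 -> bd w4 s d -> bd w1 s d1 ->
    inv_seq x (fun k => u k + h k) /\
    exists a', [/\ l2 a', Aseq x (fun k => u k + h k) a' = (fun k => f k + s k) &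
      (Re (dot a' (fun k => f k + s k)) - Re (dot a f) -
       2 * (Re (dot s a) + x * Re (dot h (zc a (Kseq u a))))) ^+ 2 <= C * (d * d1)]].
Proof.
move=> uU ix fF a2 ea; have hu : h2 u by exists U.
have [A aA] := solution_w4 hu ix a2 ea fF.
have [d1 d1_gt0 pert] := inv_seq_perturb uU ix.
have [d2 [C [d2_gt0 C0 res]]] := resolvent_perturb uU ix.
have A0 := bd_ge0 aA; have c0 : 0 <= C * (1 + A) by rewrite mulr_ge0// addr_ge0.
have [C' C'0 expan] := Eseq_expansion uU aA aA c0.
exists (Num.min 1 (Num.min d1 d2)), (2 * (C * (1 + A)) + 2 * (x ^+ 2 * C')); split.
- by rewrite !lt_min ltr01 d1_gt0.
- by rewrite addr_ge0// mulr_ge0// mulr_ge0// sqr_ge0.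
move=> h s d e1; rewrite !le_min => /and3P[d_le1 dd1 dd2] hd he sd se.
have hh : h2 h by exists d.
have ihx : inv_seq x (fun k => u k + h k) by apply: pert; exact: bd_mono dd1 hd.
split=> //.
have s2 : l2 s by exists e1.
have f2 := bd4_l2 fF.
have [surj _] := ihx; have [a' a'2 ea'] := surj _ (l2D f2 s2).
exists a'; split=> //.
have da : bd w4 (fun n => a' n - a n) (C * (1 + A) * d).
  have -> : C * (1 + A) * d = C * (d + d * A) by ring.
  apply: (res h d dd2 hd a a' A d (2 * F + 2 * d)) => //.
    rewrite ea'; exact: (bdD w4_ge0 fF sd).
  rewrite ea' ea; suff -> : (fun n => f n + s n - f n) = s by [].
  by apply/funext => n; rewrite addrAC subrr add0r.
have E := expan h a' d e1 d_le1 hd he a'2 da.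
have da1 := bd_w1 (@w1_le_w4 R) da.
have D := dot_CS se da1.
have da2 : l2 (fun n => a' n - a n) by exists (C * (1 + A) * d).
have := dot_increment hu hh f2 s2 a2 a'2 ea ea'.
rewrite -(dotJ s2 a'2).
have -> : dot s a' = dot s a + dot s (fun n => a' n - a n).
  by rewrite (dotBr a'2 a2 s2) addrC subrK.
move: D E.
move: (dot s a) (dot s _) (dot (Eseq u h a') a) (dot h _) (dot a' _) (dot a f) => z1 z2 z3 z4 z5 z6.
move=> /sqr_Re_le D /sqr_Re_le E /(congr1 (@Re R)).
rewrite ReB !ReD ReJ Re_realM => ->; rewrite ReD.
move: E; rewrite ReB ReD ReJ => E.
have -> : Re z1 + (Re z1 + Re z2) + x * Re z3 - 2 * (Re z1 + x * Re z4) =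
  Re z2 + x * (Re z3 - (Re z4 + Re z4)) by ring.
have -> : (2 * (C * (1 + A)) + 2 * (x ^+ 2 * C')) * (d * e1) =
  2 * (e1 * (C * (1 + A) * d)) + 2 * (x ^+ 2 * (C' * (d * e1))) by ring.
apply: sqr_add_le D _.
by rewrite exprMn ler_wpM2l// sqr_ge0.
Qed.

(** The second-order remainder is controlled by the product of the [H^(1/2)] and
    [L^2] norms of the increment, so that it is small for the [L^2] norm as
    soon as the increment is small in [H^(1/2)]. *)
Lemma gradient_expansion x alpha u U a b : bd w2 u U -> inv_seq x u -> l2 a -> l2 b ->
  Aseq x u a = u -> Aseq x u b = one_seq ->
  exists d0 C, [/\ 0 < d0, 0 <= C & forall h (d d1 : R), d <= d0 ->
    bd w2 h d -> bd w1 h d1 ->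
    inv_seq x (fun k => u k + h k) /\
    exists a' b', [/\ l2 a', l2 b', Aseq x (fun k => u k + h k) a' = (fun k => u k + h k),
      Aseq x (fun k => u k + h k) b' = one_seq &
      (Re (dot a' (fun k => u k + h k) - alpha%:C%C * dot b' one_seq) -
       Re (dot a u - alpha%:C%C * dot b one_seq) -
       2 * Re (dot h (gradient x alpha u a b))) ^+ 2 <= C * (d * d1)]].
Proof.
move=> uU ix a2 b2 ea eb; have hu : h2 u by exists U.
have u4 : bd w4 u U by apply: bd_weight_le uU => k; exact: w4_le_w2.
have o4 : bd w4 (@one_seq R) 1 by apply: bd_one; exact: w4_0.
have [A aA] := solution_w4 hu ix a2 ea u4; have [B bB] := solution_w4 hu ix b2 eb o4.
have za := l2_zc aA (bd_Kseq4 uU aA); have zb := l2_zc bB (bd_Kseq4 uU bB).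
have [d1 [C1 [d1_gt0 C10 H1]]] := dot_increment_bd uU ix u4 a2 ea.
have [d2 [C2 [d2_gt0 C20 H2]]] := dot_increment_bd uU ix o4 b2 eb.
exists (Num.min d1 d2), (2 * C1 + 2 * (alpha ^+ 2 * C2)); split.
- by rewrite !lt_min d1_gt0.
- by rewrite addr_ge0// mulr_ge0// mulr_ge0// sqr_ge0.
move=> h d e1; rewrite !le_min => /andP[dd1 dd2] hd he.
have h4 : bd w4 h d by apply: bd_weight_le hd => k; exact: w4_le_w2.
have z4 : bd w4 (fun=> 0 : R[i]) d by apply: bd_mono (bd_zero _); exact: bd_ge0 hd.
have z1 : bd w1 (fun=> 0 : R[i]) e1 by apply: bd_mono (bd_zero _); exact: bd_ge0 he.
have h2_ : l2 h by exists e1.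
have [ihx [a' [a'2 ea' ineq1]]] := H1 h h d e1 dd1 hd he h4 he.
have [_ [b' [b'2 eb' ineq2]]] := H2 h (fun=> 0) d e1 dd2 hd he z4 z1.
split=> //; exists a', b'.
have e0 : (fun k => one_seq k + 0) = @one_seq R by apply/funext => k; rewrite addr0.
rewrite e0 in eb' ineq2; split=> //.
have d0 : dot (fun=> 0) b = 0.
  have -> : (fun=> 0) = (fun k => 0 * b k) by apply/funext => k; rewrite mul0r.
  by rewrite (dotZl 0 b2 b2) mul0r.
rewrite d0 in ineq2.
have -> : dot h (gradient x alpha u a b) =
  dot h a + x%:C%C * dot h (zc a (Kseq u a)) - (alpha * x)%:C%C * dot h (zc b (Kseq u b)).
  rewrite /gradient.
  rewrite (dotBr (l2D a2 (l2Z _ za)) (l2Z _ (l2Z _ zb)) h2_) (dotDr a2 (l2Z _ za) h2_).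
  rewrite (dotZr _ za h2_) (dotZr _ (l2Z _ zb) h2_) (dotZr _ zb h2_) !conjc_real.
  by rewrite mulrA -rmorphM.
move: ineq1 ineq2.
move: (dot h a) (dot h (zc a _)) (dot h (zc b _)) (dot a' _) (dot a u) (dot b' _) (dot b _).
move=> p1 p2 p3 p4 p5 p6 p7 i1 i2.
rewrite !ReB !ReD !Re_realM.
set X := (X in X ^+ 2 <= _) in i1; set Y := (X in X ^+ 2 <= _) in i2.
have -> : Re p4 - alpha * Re p6 - (Re p5 - alpha * Re p7) -
    2 * (Re p1 + x * Re p2 - alpha * x * Re p3) = X + (- alpha) * Y.
  by rewrite /X /Y /=; ring.
have -> : (2 * C1 + 2 * (alpha ^+ 2 * C2)) * (d * e1) =
  2 * (C1 * (d * e1)) + 2 * ((- alpha) ^+ 2 * (C2 * (d * e1))) by ring.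
apply: sqr_add_le i1 _.
by rewrite exprMn ler_wpM2l// sqr_ge0.
Qed.

End Differential.

(** * The Poisson bracket *)

Section Bracket.
Context {R : realType}.
Implicit Types (u h f g : R -> R[i]) (x y alpha : R).

Lemma norm_le_of_sqr (r B : R) : 0 <= B -> r ^+ 2 <= B ^+ 2 -> `|r| <= B.
Proof.
move=> B0; rewrite -(real_normK (num_real r)) => h.
by rewrite -(ler_pXn2r (_ : (0 < 2)%N))// nnegrE.
Qed.

Lemma H12plusD u h : H12plus u -> H12plus h -> H12plus (fun t => u t + h t).
Proof.
move=> hu hh; have hu1 := H12plus_hardy hu; have hh1 := H12plus_hardy hh.
have [B uB] := h2D (H12plus_h2 hu) (H12plus_h2 hh).
have [] // := @bd_H12plus _ (fun t => u t + h t) B (hardyD hu1 hh1) _.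
by rewrite (coefsD (hardy_L2 hu1) (hardy_L2 hh1)).
Qed.

Lemma Lfun_expansion x alpha u a b : H12plus u -> inv_seq x (coefs u) -> l2 a -> l2 b ->
  Aseq x (coefs u) a = coefs u -> Aseq x (coefs u) b = one_seq ->
  exists d0 C, [/\ 0 < d0, 0 <= C & forall h (d d1 : R), H12plus h -> d <= d0 ->
    bd w2 (coefs h) d -> bd w1 (coefs h) d1 ->
    (Re (Lfun_x alpha x (fun t => u t + h t)) - Re (Lfun_x alpha x u) -
       2 * Re (dot (coefs h) (gradient x alpha (coefs u) a b))) ^+ 2 <= C * (d * d1)].
Proof.
move=> hu ix a2 b2 ea eb.
have [d0 [C [d0_gt0 C0 H]]] := gradient_expansion alpha (H12plus_bd hu) ix a2 b2 ea eb.
exists d0, C; split=> // h d d1 hh dd0 hd hd1.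
have [ixh [a' [b' [a'2 b'2 ea' eb' ineq]]]] := H _ d d1 dd0 hd hd1.
have e := coefsD (hardy_L2 (H12plus_hardy hu)) (hardy_L2 (H12plus_hardy hh)).
rewrite -e in ixh ea' eb' ineq.
rewrite (Lfun_seq alpha (H12plusD hu hh) ixh a'2 b'2 ea' eb').
by rewrite (Lfun_seq alpha hu ix a2 b2 ea eb).
Qed.

Lemma Lfun_differential x alpha u a b g : H12plus u -> inv_seq x (coefs u) -> l2 a -> l2 b ->
  Aseq x (coefs u) a = coefs u -> Aseq x (coefs u) b = one_seq ->
  hardy g -> coefs g = gradient x alpha (coefs u) a b ->
  is_differential (fun v => Re (Lfun_x alpha x v)) u (fun h => 2 * Re (ip h g)).
Proof.
move=> hu ix a2 b2 ea eb hg eg; have g2 := hardy_L2 hg; split.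
- move=> r f k /hardy_L2 f2 /hardy_L2 k2.
  by rewrite (ipDl (L2Z _ f2) k2 g2) (ipZl _ f2 g2) ReD Re_realM; ring.
- exists (2 * L2norm g) => f /hardy_L2 f2.
  have G0 := L2norm_ge0 g; have F0 := L2norm_ge0 f.
  apply: norm_le_of_sqr; first by rewrite !mulr_ge0.
  have := sqr_Re_le (ip_CS f2 g2); rewrite -(L2norm_sq f) -(L2norm_sq g).
  move: (ip f g) (L2norm f) (L2norm g) => z F G h.
  by rewrite !exprMn -mulrA ler_wpM2l ?exprn_ge0// mulrC.
- move=> e e0.
  have [d0 [C [d0_gt0 C0 H]]] := Lfun_expansion alpha hu ix a2 b2 ea eb.
  (* The squared remainder is at most [C] times the fourth power of the norm. *)
  exists (Num.min 1 (Num.min d0 (e ^+ 2 / (C + 1)))).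
    by rewrite !lt_min ltr01 d0_gt0 divr_gt0 ?exprn_gt0// ltr_wpDl.
  move=> h hh; rewrite !lt_min => /and3P[N1 Nd Ne].
  have N0 : 0 <= H12norm h by rewrite sqrtr_ge0.
  have NN : H12norm h ^+ 2 <= H12norm h.
    by rewrite expr2 -[leRHS]mul1r ler_wpM2r// ltW.
  have bh := H12plus_bd hh.
  have := H h _ _ hh (le_trans NN (ltW Nd)) bh (bd_w1 (@w1_le_w2 R) bh).
  rewrite (parseval_hardy (hardy_L2 (H12plus_hardy hh)) hg) eg => ineq.
  apply: norm_le_of_sqr; first by rewrite mulr_ge0// ltW.
  apply: le_trans ineq _.
  rewrite exprMn mulrA ler_wpM2r ?sqr_ge0//.
  have C1 : 0 < C + 1 by rewrite ltr_wpDl.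
  apply: (@le_trans _ _ ((C + 1) * (e ^+ 2 / (C + 1)))); last first.
    by rewrite mulrC divfK// gt_eqF.
  apply: ler_pM => //; first exact: sqr_ge0.
    by rewrite lerDl.
  exact: le_trans NN (ltW Ne).
Qed.

Lemma gradient_hardy x alpha u a b : H12plus u -> inv_seq x (coefs u) -> l2 a -> l2 b ->
  Aseq x (coefs u) a = coefs u -> Aseq x (coefs u) b = one_seq ->
  exists2 g, hardy g & coefs g = gradient x alpha (coefs u) a b.
Proof.
move=> hu ix a2 b2 ea eb; have uU := H12plus_bd hu; have hu2 := H12plus_h2 hu.
have u4 : bd w4 (coefs u) (H12norm u ^+ 2).
  by apply: bd_weight_le uU => k; exact: w4_le_w2.
have o4 : bd w4 (@one_seq R) 1 by apply: bd_one; exact: w4_0.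
have [A aA] := solution_w4 hu2 ix a2 ea u4; have [B bB] := solution_w4 hu2 ix b2 eb o4.
have za := l2_zc aA (bd_Kseq4 uU aA); have zb := l2_zc bB (bd_Kseq4 uU bB).
apply: synthesis; exact: l2B (l2D a2 (l2Z _ za)) (l2Z _ (l2Z _ zb)).
Qed.

(** The Hamiltonian vector of [2 Re (. | g)] for the form [4 Im (. | .)] is
    [- i g / 2], so that the bracket is [Im (g | g')]. *)
Lemma poisson_bracket_zero x y alpha u : H12plus u -> invertible_at x u -> invertible_at y u ->
  is_poisson_bracket (fun v => Re (Lfun_x alpha x v)) (fun v => Re (Lfun_x alpha y v)) u 0.
Proof.
move=> hu /(inv_seq_of_invertible hu) ix /(inv_seq_of_invertible hu) iy.
have hu2 := H12plus_h2 hu; have u2 := h2_l2 hu2.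
have [a a2 ea] := ix.1 _ u2; have [b b2 eb] := ix.1 _ (@l2_one R).
have [a' a'2 ea'] := iy.1 _ u2; have [b' b'2 eb'] := iy.1 _ (@l2_one R).
have [g hg eg] := gradient_hardy alpha hu ix a2 b2 ea eb.
have [g' hg' eg'] := gradient_hardy alpha hu iy a'2 b'2 ea' eb'.
have g2 := hardy_L2 hg; have g'2 := hardy_L2 hg'.
have G := gradient_real alpha hu2 ix iy a2 b2 a'2 b'2 ea eb ea' eb'.
rewrite -eg -eg' -(parseval_hardy g2 hg') in G.
exists (fun h => 2 * Re (ip h g)), (fun h => 2 * Re (ip h g')),
  (fun t => Complex 0 (- 2^-1) * g t); split.
- exact: Lfun_differential ix a2 b2 ea eb hg eg.
- exact: Lfun_differential iy a'2 b'2 ea' eb' hg' eg'.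
- split; first exact: hardyZ.
  move=> h /hardy_L2 hh; rewrite /omega (ipZr _ g2 hh) ImM /=.
  by move: (ip h g) => z; field.
- rewrite (ipZl _ g2 g'2) ReM G /=; ring.
Qed.

End Bracket.

(** * The gradient along the flow *)

Section CubicPairing.
Context {R : realType}.
Implicit Types (f a p : R -> R[i]) (x y alpha : R).

(** [f^2] lies in [H^(1/4)], hence in [L^4]. *)
Lemma L4_normsq f U : hardy f -> bd w2 (coefs f) U -> L4 (fun t => (normsq (f t))%:C%C).
Proof.
move=> hf fU; have f4 : bd w4 (coefs f) U.
  by apply: bd_weight_le fU => k; exact: w4_le_w2.
have [hff cff] := L2_mul_w4 hf hf f4 f4.
have := bd_conv2 fU fU; rewrite -cff => ff4.
have [cm int] := L4_w4 hff ff4.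
have mf := L2_cmfun (hardy_L2 hf).
apply: (L4_intro _ int) => [|t]; last by rewrite normsqR normsqM expr2.
by split; [exact: cmfun_normsq|exact: measurable_cst].
Qed.

Lemma coef0_mul f a : hardy f -> hardy a ->
  coefs (fun t => f t * a t) 0%N = coefs f 0%N * coefs a 0%N.
Proof. by move=> hf ha; rewrite /coefs (fourier_mul _ hf ha) /conv big_ord1. Qed.

Lemma ip_conj_hardy f a : hardy (fun t => conjc (f t)) -> hardy a ->
  ip f a = conjc (coefs (fun t => conjc (f t)) 0%N * coefs a 0%N).
Proof.
move=> hf ha; rewrite -(cmean_mul hf ha) -cmeanJ; last first.
  exact: L1M (hardy_L2 hf) (hardy_L2 ha).
by apply: eq_cmean => t; rewrite conjcM conjcK.
Qed.

(** Writing [f conj p = a + k] and [y f conj a = p + n] with [k] and [n]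
    carrying only nonpositive frequencies, the density
    [y^2 |f|^2 f conj (a p)] is
    [y |f|^2 |p|^2 + n conj p + n conj n + y n conj (f conj k)]: two terms are
    real and the means of the two others only see zeroth coefficients. *)
Lemma cubic_pairing y f a p U : hardy f -> bd w2 (coefs f) U -> conjugate_pair y f a p ->
  y ^+ 2 * Im (ip (fun t => (normsq (f t))%:C%C * f t) (fun t => a t * p t)) =
  - Im ((y%:C%C * (coefs f 0%N * conjc (fourier (fun t => f t * conjc (p t) - a t) 0)) +
         coefs p 0%N) *
        conjc (fourier (fun t => y%:C%C * (f t * conjc (a t)) - p t) 0)).
Proof.
move=> hf fU [ha hp a4 p4 [ak an]].
have f4 : L4 f.
  by apply: (@L4_w4 _ f U hf); apply: bd_weight_le fU => k; exact: w4_le_w2.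
have N4 := L4_normsq hf fU.
set k := (fun t => f t * conjc (p t) - a t) in ak *.
set n := (fun t => y%:C%C * (f t * conjc (a t)) - p t) in an *.
have n2 : L2 n := an.1; have k2 : L2 k := ak.1.
have hL := anti_conj ak; have hM := anti_conj an.
have Np2 := L4M N4 p4; have Nf2 := L4M N4 f4; have ap2 := L4M a4 p4.
have p2 := hardy_L2 hp.
have hfL : hardy (fun t => f t * conjc (k t)).
  split; last by move=> [m|m] // _; rewrite (fourier_mul _ hf hL).
  have -> : (fun t => f t * conjc (k t)) =
      (fun t => (normsq (f t))%:C%C * p t - f t * conjc (a t)).
    by apply/funext => t; rewrite /k conjcB conjcM conjcK normsqE mulrBr mulrA.
  by apply: L2B Np2 _; apply: L4M f4 (L4J a4).
have fL2 := hardy_L2 hfL.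
have E : (y ^+ 2)%:C%C * ip (fun t => (normsq (f t))%:C%C * f t) (fun t => a t * p t) =
  y%:C%C * ip (fun t => (normsq (f t))%:C%C * p t) p + ip n p + ip n n +
  y%:C%C * ip n (fun t => f t * conjc (k t)).
  have I1 := L1_ip Np2 p2; have I2 := L1_ip n2 p2; have I3 := L1_ip n2 n2.
  have I4 := L1_ip n2 fL2; have I5 := L1_ip Nf2 ap2.
  rewrite /ip -(cmeanZ _ I5) -(cmeanZ _ I1) -(cmeanZ _ I4).
  rewrite -(cmeanD (L1Z _ I1) I2) -(cmeanD (L1D (L1Z _ I1) I2) I3).
  rewrite -(cmeanD (L1D (L1D (L1Z _ I1) I2) I3) (L1Z _ I4)).
  apply: eq_cmean => t; rewrite /k /n normsqE rmorphXn /=.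
  rewrite !(conjcM, conjcB, conjcK) !conjc_real.
  by move: (f t) (a t) (p t) => z1 z2 z3; ring.
have r1 : Im (ip (fun t => (normsq (f t))%:C%C * p t) p) = 0.
  apply: Im0_conjc; rewrite (ipJ Np2 p2); apply: eq_cmean => t.
  by rewrite conjcM conjc_real mulrA (mulrC (p t)) -!mulrA.
have e0 (g : R -> R[i]) : L2 g -> coefs (fun t => conjc (g t)) 0%N = conjc (fourier g 0).
  by move=> g2; rewrite /coefs (fourierJ _ g2) oppr0.
have := congr1 (@Im R) E; rewrite Im_realM => ->.
rewrite (ip_conj_hardy hM hp) (ip_conj_hardy hM hfL) (coef0_mul hf hL) (e0 _ n2) (e0 _ k2).
rewrite !ImD !Im_realM r1 Im_ip.
move: (coefs f 0) (fourier k 0) (fourier n 0) (coefs p 0) => z1 z2 z3 z4.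
rewrite !(ImJ, ImM, ImD, ReM, ReJ, ReD) /=; ring.
Qed.

(** The Hamiltonian field of the equation annihilates [L_y]: with [a], [b] the
    resolvents at [y] of [u] and [1], the cubic term pairs to a real number with
    the part of the gradient built from [a], and its pairing with the part built
    from [b] is compensated by the rank-one term [alpha (u|1)]. *)
Lemma gradient_conserved alpha y (u : R -> R[i]) (a b : nat -> R[i]) : y != 0 ->
  H12plus u -> inv_seq y (coefs u) -> l2 a -> l2 b ->
  Aseq y (coefs u) a = coefs u -> Aseq y (coefs u) b = one_seq ->
  hardy (szego_rhs alpha u) /\
    Im (dot (coefs (szego_rhs alpha u)) (gradient y alpha (coefs u) a b)) = 0.
Proof.
move=> y0 hu iy a2 b2 ea eb; have hf := H12plus_hardy hu; have uU := H12plus_bd hu.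
have hu2 := H12plus_h2 hu; have u2 := h2_l2 hu2.
move: (H12norm u ^+ 2) uU => U uU.
have u4 : bd w4 (coefs u) U by apply: bd_weight_le uU => k; exact: w4_le_w2.
have o4 : bd w4 (@one_seq R) 1 by apply: bd_one; exact: w4_0.
have o2 := @l2_one R.
have [A aA] := solution_w4 hu2 iy a2 ea u4; have [B bB] := solution_w4 hu2 iy b2 eb o4.
have Ka2 := l2_Kseq hu2 a2; have Kb2 := l2_Kseq hu2 b2.
have Ea k : a k.+1 - y%:C%C * Kseq (coefs u) (Kseq (coefs u) a) k.+1 = 1%:C%C * coefs u k.+1.
  by rewrite -[in RHS]ea mul1r.
have Eb k : b k.+1 - y%:C%C * Kseq (coefs u) (Kseq (coefs u) b) k.+1 = 0%:C%C * coefs u k.+1.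
  by rewrite mul0r -[LHS]/(Aseq y (coefs u) b k.+1) eb.
have [fa [p [cpa ca cp hap gap]]] := conjugate_pair_resolvent hf erefl uU aA Ea.
have [fb [q [cpb cb cq hbq gbq]]] := conjugate_pair_resolvent hf erefl uU bB Eb.
set c3 := fun t => (normsq (u t))%:C%C * u t.
have c32 : L2 c3 by exact: L4M (L4_normsq hf uU) (L4_w4 hf u4).
have [hs es] := szego_L2 c32.
set G1 := coefs (fun t => fa t * p t) in gap; set G2 := coefs (fun t => fb t * q t) in gbq.
have l1 : l2 G1 := l2_coefs (hardy_L2 hap); have l2_ : l2 G2 := l2_coefs (hardy_L2 hbq).
have eg : gradient y alpha (coefs u) a b = fun k => G1 k - alpha%:C%C * G2 k.
  by apply/funext => k; rewrite /gradient gap gbq mul1r mul0r add0r.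
have zeroth g r (c : nat -> R[i]) (e : R) : conjugate_pair y u g r -> coefs g = c -> l2 c ->
    coefs r = (fun k => e%:C%C * one_seq k + y%:C%C * shiftr 1 (Kseq (coefs u) c) k) ->
    [/\ fourier (fun t => u t * conjc (r t) - g t) 0 =
         e%:C%C * coefs u 0 + y%:C%C * Kseq (coefs u) (Kseq (coefs u) c) 0 - c 0%N,
      fourier (fun t => y%:C%C * (u t * conjc (g t)) - r t) 0 =
         y%:C%C * dot (coefs u) c - e%:C%C & coefs r 0 = e%:C%C].
  move=> [hg hr g4 r4 _] e_g c2 e_r.
  have uL := L4_w4 hf u4.
  have ur := L4M uL (L4J r4); have ug := L4M uL (L4J g4).
  have r0 : coefs r 0 = e%:C%C by rewrite e_r /one_seq /shiftr /= mulr0 addr0 mulr1.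
  have Kc2 := l2_Kseq hu2 c2; have sc := l2_shiftr 1 Kc2.
  have e_u : (fun k => coefs u (k + 0)%N) = coefs u by apply/funext => k; rewrite addn0.
  split=> //.
    rewrite (fourierB _ ur (hardy_L2 hg)) (fourier_hankel 0 hf hr) /Hseq e_u.
    rewrite -[fourier g 0]/(coefs g 0%N) e_g e_r.
    rewrite (dotDr (l2Z _ o2) (l2Z _ sc) u2) (dotZr _ o2 u2) (dotZr _ sc u2) !conjc_real.
    by rewrite (dot_one_r u2) (dot_shiftr 1 u2 Kc2) (KseqE _ _ 0).
  rewrite (fourierB _ (L2Z _ ug) (hardy_L2 hr)) (fourierZ _ _ ug) (fourier_hankel 0 hf hg).
  by rewrite /Hseq e_u e_g -[fourier r 0]/(coefs r 0%N) r0.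
have [ka na pa] := zeroth _ _ _ _ cpa ca a2 cp.
have [kb nb pb] := zeroth _ _ _ _ cpb cb b2 cq.
have ua : Im (dot (coefs u) a) = 0.
  by apply: Im0_conjc; rewrite (dotJ u2 a2) -{1}ea (dot_Aseq_sym y hu2 a2 a2) ea.
have ub : dot (coefs u) b = a 0%N.
  by rewrite -{1}ea (dot_Aseq_sym y hu2 a2 b2) eb (dot_one_r a2).
have y2 : y ^+ 2 != 0 by rewrite expf_neq0.
have P1 := cubic_pairing hf uU cpa; have P2 := cubic_pairing hf uU cpb.
have s1 : Im (dot (coefs (szego c3)) G1) = 0.
  rewrite es -(parseval_hardy c32 hap); apply: (mulfI y2); rewrite P1 ka na pa mulr0.
  have -> : 1%:C%C * coefs u 0 + y%:C%C * Kseq (coefs u) (Kseq (coefs u) a) 0 - a 0%N = 0.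
    by rewrite -{1}ea /Aseq mul1r subrK subrr.
  rewrite conjc0 !mulr0 add0r mul1r ImJ ImB Im_realM ua mulr0 /=; ring.
have s2 : Im (dot (coefs (szego c3)) G2) = Im (coefs u 0 * conjc (a 0%N)).
  rewrite es -(parseval_hardy c32 hbq); apply: (mulfI y2); rewrite P2 kb nb pb ub.
  have -> : 0%:C%C * coefs u 0 + y%:C%C * Kseq (coefs u) (Kseq (coefs u) b) 0 - b 0%N = -1.
    rewrite -[X in _ = - X]/(one_seq 0%N) -eb /Aseq mul0r add0r.
    by move: (Kseq _ _ _) (b 0%N) => z1 z2; ring.
  move: (coefs u 0) (a 0%N) => z1 z2.
  rewrite !(ImJ, ReJ, ImM, ImD, ImN, ReM, ReD, ReN) /=; ring.
have -> : szego_rhs alpha u = (fun t => szego c3 t + alpha%:C%C * coefs u 0 * cst1 t).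
  apply/funext => t; rewrite /szego_rhs /cst1 mulr1 /coefs fourier_ip.
  congr (_ + _ * ip u _); by rewrite -expi0E.
have hc := @hardy_cst1 R.
have hr := hardyZ (alpha%:C%C * coefs u 0) hc.
split; first exact: hardyD.
rewrite (coefsD (hardy_L2 hs) (hardy_L2 hr)) (coefsZ _ (hardy_L2 hc)) coefs_cst1 eg.
have S2 := l2_coefs (hardy_L2 hs); have lg := l2Z alpha%:C%C l2_.
rewrite (dotDl S2 (l2Z _ o2) (l2B l1 lg)) (dotZl _ o2 (l2B l1 lg)).
rewrite -(dotJ (l2B l1 lg) o2) (dot_one_r (l2B l1 lg)).
rewrite (dotBr l1 lg S2) (dotZr _ l2_ S2) conjc_real.
have -> : G1 0%N - alpha%:C%C * G2 0%N = a 0%N.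
  by rewrite gap gbq /zc /shiftr /= mulr0 !addr0 mul0r mulr0 subr0 mul1r.
move: s1 s2; move: (dot (coefs (szego c3)) G1) (dot (coefs (szego c3)) G2).
move: (coefs u 0) (a 0%N) => z1 z2 z3 z4 s1 s2.
rewrite ImD ImB Im_realM s1 s2.
rewrite -mulrA Im_realM; ring.
Qed.

End CubicPairing.

(** * Moments *)

Section Moments.
Context {R : realType}.
Implicit Types (a b u v f w : nat -> R[i]) (x y alpha rho : R) (m n N : nat).

Definition Ksq u a := Kseq u (Kseq u a).

(** Linear in the pair [(a, b)]: at [(u, 1)] these are the moments and, for
    [m = 0], at the resolvents of [u] and [1] this is [L_x]. Relations between
    them thus follow from relations between vectors. *)
Definition moment alpha u m a b : R :=
  Re (dot (iter m (Ksq u) a) u) - alpha * Re (dot (iter m (Ksq u) b) one_seq).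

Lemma l2_Ksq u a : h2 u -> l2 a -> l2 (Ksq u a).
Proof. by move=> hu a2; exact: l2_Kseq hu (l2_Kseq hu a2). Qed.

Lemma l2_iter_Ksq m u a : h2 u -> l2 a -> l2 (iter m (Ksq u) a).
Proof. by move=> hu a2; elim: m => // m; rewrite iterS; exact: l2_Ksq. Qed.

Lemma Ksq_lin u a b (z : R[i]) : h2 u -> l2 a -> l2 b ->
  Ksq u (fun k => a k + z * b k) = fun k => Ksq u a k + z * Ksq u b k.
Proof.
move=> hu a2 b2; have u2 := h2_l2 hu; have Ka := l2_Kseq hu a2; have Kb := l2_Kseq hu b2.
rewrite /Ksq (KseqDr u2 a2 (l2Z z b2)) (KseqZr z u2 b2).
by rewrite (KseqDr u2 Ka (l2Z _ Kb)) (KseqZr _ u2 Kb) conjcK.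
Qed.

Lemma iter_Ksq_lin m u a b (z : R[i]) : h2 u -> l2 a -> l2 b ->
  iter m (Ksq u) (fun k => a k + z * b k) =
  fun k => iter m (Ksq u) a k + z * iter m (Ksq u) b k.
Proof.
move=> hu a2 b2; elim: m => // m IH; rewrite !iterS IH.
exact: (Ksq_lin z hu (l2_iter_Ksq m hu a2) (l2_iter_Ksq m hu b2)).
Qed.

Lemma moment_lin alpha u m a a' b b' (c : R) : h2 u -> l2 a -> l2 a' -> l2 b -> l2 b' ->
  moment alpha u m (fun k => a k + c%:C%C * a' k) (fun k => b k + c%:C%C * b' k) =
  moment alpha u m a b + c * moment alpha u m a' b'.
Proof.
move=> hu a2 a'2 b2 b'2; have u2 := h2_l2 hu; have o2 := @l2_one R.
have I z (z2 : l2 z) := l2_iter_Ksq m hu z2.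
rewrite /moment (iter_Ksq_lin m _ hu a2 a'2) (iter_Ksq_lin m _ hu b2 b'2).
rewrite (dotDl (I _ a2) (l2Z _ (I _ a'2)) u2) (dotZl _ (I _ a'2) u2).
rewrite (dotDl (I _ b2) (l2Z _ (I _ b'2)) o2) (dotZl _ (I _ b'2) o2).
move: (dot _ u) (dot _ u) (dot _ one_seq) (dot _ one_seq) => z1 z2 z3 z4.
rewrite !ReD !Re_realM; ring.
Qed.

Lemma moment_Ksq alpha u m a b :
  moment alpha u m (Ksq u a) (Ksq u b) = moment alpha u m.+1 a b.
Proof. by rewrite /moment !iterSr. Qed.

Lemma AseqE x u a : Aseq x u a = fun k => a k + (- x)%:C%C * Ksq u a k.
Proof. by apply/funext => k; rewrite /Aseq rmorphN mulNr. Qed.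

Lemma moment_Aseq alpha x u m a b : h2 u -> l2 a -> l2 b ->
  moment alpha u m (Aseq x u a) (Aseq x u b) =
  moment alpha u m a b - x * moment alpha u m.+1 a b.
Proof.
move=> hu a2 b2; rewrite !AseqE.
by rewrite (moment_lin alpha m _ hu a2 (l2_Ksq hu a2) b2 (l2_Ksq hu b2)) moment_Ksq mulNr.
Qed.

Lemma bd_iter_Ksq m u U a A : bd w2 u U -> bd w1 a A ->
  bd w1 (iter m (Ksq u) a) ((U * U) ^+ m * A).
Proof.
move=> uU aA; elim: m => [|m IH]; first by rewrite expr0 mul1r.
rewrite iterS exprS -!mulrA; exact: bd_Kseq1 uU (bd_Kseq1 uU IH).
Qed.

Lemma moment_bd alpha u U m : bd w2 u U -> exists2 M, 0 <= M &
  forall a b A B, bd w1 a A -> bd w1 b B -> moment alpha u m a b ^+ 2 <= M * (A + B).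
Proof.
move=> uU; have U0 := bd_ge0 uU; have u1 := bd_w1 (@w1_le_w2 R) uU.
have o1 : bd w1 (@one_seq R) 1 by exact: bd_one.
set V := (U * U) ^+ m; have V0 : 0 <= V by rewrite exprn_ge0// mulr_ge0.
exists (2 * (V * U) + 2 * (alpha ^+ 2 * V)).
  by rewrite addr_ge0// mulr_ge0// mulr_ge0// sqr_ge0.
move=> a b A B aA bB; have A0 := bd_ge0 aA; have B0 := bd_ge0 bB.
have := dot_CS (bd_iter_Ksq m uU aA) u1; have := dot_CS (bd_iter_Ksq m uU bB) o1.
rewrite -/V /moment; move: (dot _ u) (dot _ one_seq) => z1 z2.
move=> /sqr_Re_le; rewrite mulr1 => h2 /sqr_Re_le h1.
rewrite -mulNr; apply: (@le_trans _ _ (2 * (V * A * U) + 2 * (alpha ^+ 2 * (V * B)))).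
  apply: sqr_add_le h1 _.
  by rewrite exprMn sqrrN ler_wpM2l// sqr_ge0.
have -> : (2 * (V * U) + 2 * (alpha ^+ 2 * V)) * (A + B) =
  2 * (V * A * U) + 2 * (alpha ^+ 2 * (V * B)) + (2 * (V * U) * B + 2 * (alpha ^+ 2 * V) * A).
  by ring.
have a0 := sqr_ge0 alpha.
have p1 : 0 <= V * U by exact: mulr_ge0.
have p2 : 0 <= alpha ^+ 2 * V by exact: mulr_ge0.
by rewrite lerDl addr_ge0// mulr_ge0// mulr_ge0.
Qed.

(** The gradient descent for [|f - (1 - x K_u^2) w|^2], which produces
    polynomials in [K_u^2] converging to the inverse of [1 - x K_u^2] although
    that operator need not have a sign. *)
Definition landweber rho x u f N : nat -> R[i] :=
  iter N (fun w k => w k + rho%:C%C * Aseq x u (fun j => f j + (-1)%:C%C * Aseq x u w j) k)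
    (fun=> 0).

Lemma landweberS rho x u f N : landweber rho x u f N.+1 = fun k =>
  landweber rho x u f N k +
  rho%:C%C * Aseq x u (fun j => f j + (-1)%:C%C * Aseq x u (landweber rho x u f N) j) k.
Proof. by []. Qed.

Lemma l2_zero : l2 (fun=> 0 : R[i]). Proof. by exists 0; exact: bd_zero. Qed.

Lemma l2_landweber rho x u f N : h2 u -> l2 f -> l2 (landweber rho x u f N).
Proof.
move=> hu f2; rewrite /landweber; elim: N => [|N IH]; first exact: l2_zero.
rewrite iterS; apply: (l2D IH) (l2Z _ (l2_Aseq x hu _)).
exact: (l2D f2 (l2Z _ (l2_Aseq x hu IH))).
Qed.

(** The iterates are polynomials in [K_u^2] applied to [u] and to [1], with
    coefficients independent of [u]. *)
Lemma moment_landweber rho x alpha u v : h2 u -> h2 v ->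
  (forall m, moment alpha u m u one_seq = moment alpha v m v one_seq) ->
  forall N m,
    moment alpha u m (landweber rho x u u N) (landweber rho x u one_seq N) =
    moment alpha v m (landweber rho x v v N) (landweber rho x v one_seq N).
Proof.
move=> hu hv E; have o2 := @l2_one R.
have step u' N m : h2 u' ->
    moment alpha u' m (landweber rho x u' u' N.+1) (landweber rho x u' one_seq N.+1) =
    moment alpha u' m (landweber rho x u' u' N) (landweber rho x u' one_seq N) + rho *
    ((moment alpha u' m u' one_seq - (moment alpha u' m (landweber rho x u' u' N)
        (landweber rho x u' one_seq N) - x * moment alpha u' m.+1 (landweber rho x u' u' N)
        (landweber rho x u' one_seq N))) -
     x * (moment alpha u' m.+1 u' one_seq - (moment alpha u' m.+1 (landweber rho x u' u' N)
        (landweber rho x u' one_seq N) - x * moment alpha u' m.+2 (landweber rho x u' u' N)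
        (landweber rho x u' one_seq N)))).
  move=> hu'; have u2 := h2_l2 hu'.
  have w := l2_landweber rho x N hu' u2; have w' := l2_landweber rho x N hu' o2.
  rewrite !landweberS.
  have Aw := l2_Aseq x hu' w; have Aw' := l2_Aseq x hu' w'.
  have d := l2D u2 (l2Z (-1)%:C%C Aw); have d' := l2D o2 (l2Z (-1)%:C%C Aw').
  rewrite (moment_lin alpha m _ hu' w (l2_Aseq x hu' d) w' (l2_Aseq x hu' d')).
  rewrite (moment_Aseq alpha x m hu' d d') (moment_lin alpha m (-1) hu' u2 Aw o2 Aw').
  rewrite (moment_lin alpha m.+1 (-1) hu' u2 Aw o2 Aw').
  rewrite (moment_Aseq alpha x m hu' w w') (moment_Aseq alpha x m.+1 hu' w w').
  move: (moment _ _ _ _ _) (moment _ _ m.+1 _ _) (moment _ _ m.+2 _ _) => p0 p1 p2.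
  by rewrite !mulN1r.
elim=> [|N IH] m.
  have z u' : h2 u' -> moment alpha u' m (fun=> 0) (fun=> 0) = 0.
    move=> hu'; have := moment_lin alpha m (-1) hu' l2_zero l2_zero l2_zero l2_zero.
    have -> : (fun=> 0 + (-1)%:C%C * 0) = (fun=> 0) :> (nat -> R[i]).
      by apply/funext => k; rewrite mulr0 addr0.
    by rewrite mulN1r subrr.
  by rewrite /landweber /= !z.
by rewrite (step u N m hu) (step v N m hv) (E m) (E m.+1) (IH m) (IH m.+1) (IH m.+2).
Qed.

Lemma nsq_descent rho e k M q : l2 e -> l2 k -> dot e k = q%:C%C -> 0 <= q ->
  0 <= rho -> rho * M <= 1 -> nsq k <= M * q ->
  nsq (fun n => e n - rho%:C%C * k n) <= nsq e - rho * q.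
Proof.
move=> e2 k2 s1 q0 rho0 rM hM; have r2 := l2Z rho%:C%C k2.
have s2 : dot k e = q%:C%C by rewrite -(dotJ e2 k2) s1 conjc_real.
rewrite {1}/nsq (dotBl e2 r2 (l2B e2 r2)) (dotBr e2 r2 e2) (dotZl _ k2 (l2B e2 r2)).
rewrite (dotBr e2 r2 k2) (dotZr _ k2 e2) (dotZr _ k2 k2) s1 s2 (dot_selfE e2) (dot_selfE k2).
rewrite conjc_real; move: hM; move: (nsq e) (nsq k) => p r hM.
rewrite -!rmorphM -!rmorphB -!rmorphM -!rmorphB /=.
have : rho * (rho * r) <= rho * q.
  apply: ler_wpM2l => //; apply: (@le_trans _ _ (rho * (M * q))); first exact: ler_wpM2l.
  by rewrite mulrA -[leRHS]mul1r ler_wpM2r.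
lra.
Qed.

Lemma contraction_step (P p q r rho C D : R) : P <= p - rho * q -> p <= C * q -> 0 <= q ->
  0 < rho -> rho <= 1 -> 1 <= D -> C <= D -> p <= r -> P <= (1 - rho / D) * r.
Proof.
move=> hP hp q0 rho0 rho1 D1 CD pr; have D0 : 0 < D by apply: lt_le_trans D1.
apply: le_trans hP _; apply: (@le_trans _ _ ((1 - rho / D) * p)); last first.
  apply: ler_wpM2l pr; rewrite subr_ge0 ler_pdivrMr// mul1r; exact: le_trans rho1 D1.
rewrite mulrBl mul1r lerD2l lerN2 -mulrA; apply: ler_wpM2l (ltW rho0) _ _ _.
rewrite mulrC ler_pdivrMr// mulrC; apply: le_trans hp _.
exact: ler_wpM2r.
Qed.

(** The error obeys [e - rho A^2 e], with [A = 1 - x K_u^2] symmetric, bounded and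
    bounded below; its squared norm decreases geometrically for small [rho]. *)
Lemma landweber_cvg x u : h2 u -> inv_seq x u ->
  exists2 rho0, 0 < rho0 & forall rho, 0 < rho -> rho <= rho0 ->
  exists q, [/\ 0 <= q, q < 1 & forall f a, l2 f -> l2 a -> Aseq x u a = f ->
    forall N, nsq (fun k => a k - landweber rho x u f N k) <= q ^+ N * nsq a].
Proof.
move=> hu [_ [C hC]]; have [U uU] := hu; have U0 := bd_ge0 uU.
set M := 2 + 2 * (x ^+ 2 * (U * U)).
have M2 : 2 <= M by rewrite lerDl mulr_ge0// mulr_ge0 ?sqr_ge0// mulr_ge0.
have M0 : 0 < M by apply: lt_le_trans M2.
have hM a : l2 a -> nsq (Aseq x u a) <= M * nsq a.
  move=> a2; apply: nsq_le; have b1 := bd_nsq a2.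
  have b2 := bdZ x%:C%C (bd_Kseq1 uU (bd_Kseq1 uU b1)).
  have -> : M * nsq a = 2 * nsq a + 2 * (normsq x%:C%C * (U * (U * nsq a))).
    by rewrite normsqR /M; ring.
  exact: bdB (@w1_ge0 R) b1 b2.
set D := Num.max C 1.
have D1 : 1 <= D by rewrite le_max lexx orbT.
have D0 : 0 < D by apply: lt_le_trans D1.
have CD : C <= D by rewrite le_max lexx.
(* [M] bounds the square of the norm of [A]. *)
exists M^-1; first by rewrite invr_gt0.
move=> rho rho0 rhoM.
have rM : rho * M <= 1 by rewrite -ler_pdivlMr// div1r.
have rho1 : rho <= 1.
  apply: le_trans rhoM _; rewrite invf_le1//; apply: le_trans M2; by rewrite ler1n.
exists (1 - rho / D); split.
- rewrite subr_ge0 ler_pdivrMr// mul1r; exact: le_trans rho1 D1.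
- by rewrite gtrBl divr_gt0.
move=> f a f2 a2 ea; elim=> [|N IH].
  rewrite expr0 mul1r /landweber /=.
  suff -> : (fun k => a k - 0) = a by [].
  by apply/funext => k; rewrite subr0.
have w2 := l2_landweber rho x N hu f2.
set e := (fun k => a k - landweber rho x u f N k) in IH.
have e2 : l2 e by exact: l2B.
have -> : (fun k => a k - landweber rho x u f N.+1 k) =
    (fun k => e k - rho%:C%C * Aseq x u (Aseq x u e) k).
  rewrite landweberS.
  have -> : (fun j => f j + (-1)%:C%C * Aseq x u (landweber rho x u f N) j) = Aseq x u e.
    rewrite /e (AseqB x hu a2 w2) ea; apply/funext => j.
    by rewrite rmorphN rmorph1 mulN1r.
  by apply/funext => k; rewrite opprD addrA.
have g2 := l2_Aseq x hu e2; have k2 := l2_Aseq x hu g2.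
have s1 : dot e (Aseq x u (Aseq x u e)) = (nsq (Aseq x u e))%:C%C.
  by rewrite -(dot_Aseq_sym x hu e2 g2) (dot_selfE g2).
rewrite exprS -mulrA.
exact: (contraction_step (nsq_descent e2 k2 s1 (nsq_ge0 g2) (ltW rho0) rM (hM _ g2))
  (hC _ e2) (nsq_ge0 g2) rho0 rho1 D1 CD IH).
Qed.

Lemma resolvent_of_moments x alpha u v a b a' b' : h2 u -> h2 v -> inv_seq x u -> inv_seq x v ->
  l2 a -> l2 b -> l2 a' -> l2 b' ->
  Aseq x u a = u -> Aseq x u b = one_seq -> Aseq x v a' = v -> Aseq x v b' = one_seq ->
  (forall m, moment alpha u m u one_seq = moment alpha v m v one_seq) ->
  moment alpha u 0 a b = moment alpha v 0 a' b'.
Proof.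
move=> hu hv ix iv a2 b2 a'2 b'2 ea eb ea' eb' E.
have [r1 r1_gt0 L1] := landweber_cvg hu ix; have [r2 r2_gt0 L2] := landweber_cvg hv iv.
(* The same step for [u] and [v], so that the same polynomials are used. *)
set rho := Num.min r1 r2.
have rho0 : 0 < rho by rewrite lt_min r1_gt0.
have [|q1 [q10 q11 c1]] := L1 rho rho0; first by rewrite ge_min lexx.
have [|q2 [q20 q21 c2]] := L2 rho rho0; first by rewrite ge_min lexx orbT.
have o2 := @l2_one R.
have lim u' c d q : h2 u' -> 0 <= q -> q < 1 -> l2 c -> l2 d ->
   (forall N, nsq (fun k => c k - landweber rho x u' u' N k) <= q ^+ N * nsq c) ->
   (forall N, nsq (fun k => d k - landweber rho x u' one_seq N k) <= q ^+ N * nsq d) ->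
   moment alpha u' 0 (landweber rho x u' u' N) (landweber rho x u' one_seq N) @[N --> \oo]
     --> moment alpha u' 0 c d.
  move=> hu' q_ge0 q_lt1 c2_ d2 hc hd; have [U uU] := hu'; have u2 := h2_l2 hu'.
  have [M M0 hM] := moment_bd alpha 0 uU.
  have W N := l2_landweber rho x N hu' u2; have W' N := l2_landweber rho x N hu' o2.
  set B := M * (nsq c + nsq d).
  have lim0 : q ^+ N * B @[N --> \oo] --> (0 : R).
    rewrite -[X in _ --> X](mul0r B); apply: cvgMl.
    by apply: cvg_expr; rewrite ger0_norm.
  apply/cvgrPdist_le => e e0; move/cvgrPdist_le/(_ (e ^+ 2) (exprn_gt0 2 e0)): lim0.
  apply: filterS => N; rewrite sub0r normrN => /(le_trans (ler_norm _)) qB.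
  apply: norm_le_of_sqr (ltW e0) _; apply: le_trans qB.
  have -> : moment alpha u' 0 c d -
      moment alpha u' 0 (landweber rho x u' u' N) (landweber rho x u' one_seq N) =
      moment alpha u' 0 (fun k => c k - landweber rho x u' u' N k)
        (fun k => d k - landweber rho x u' one_seq N k).
    have := moment_lin alpha 0 (-1) hu' c2_ (W N) d2 (W' N); rewrite mulN1r => <-.
    by congr (moment _ _ _ _ _); apply/funext => k; rewrite rmorphN rmorph1 mulN1r.
  apply: le_trans (hM _ _ _ _ (bd_nsq (l2B c2_ (W N))) (bd_nsq (l2B d2 (W' N)))) _.
  rewrite /B [leRHS]mulrCA; apply: (ler_wpM2l M0); rewrite [leRHS]mulrDr.
  exact: lerD (hc N) (hd N).
have lu := lim _ _ _ _ hu q10 q11 a2 b2 (c1 _ _ (h2_l2 hu) a2 ea) (c1 _ _ o2 b2 eb).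
have lv := lim _ _ _ _ hv q20 q21 a'2 b'2 (c2 _ _ (h2_l2 hv) a'2 ea') (c2 _ _ o2 b'2 eb').
have e : (fun N => moment alpha u 0 (landweber rho x u u N) (landweber rho x u one_seq N)) =
    (fun N => moment alpha v 0 (landweber rho x v v N) (landweber rho x v one_seq N)).
  by apply/funext => N; exact: moment_landweber.
by rewrite e in lu; exact: (cvg_unique _ lu lv).
Qed.

Lemma KseqZl u a (z : R[i]) : l2 u -> l2 a ->
  Kseq (fun k => z * u k) a = fun n => z * Kseq u a n.
Proof.
by move=> u2 a2; apply/funext => n; rewrite !KseqE (dotZl z (l2_shift n.+1 u2) a2).
Qed.

Lemma inv_seq_zero : inv_seq 1 (fun=> 0 : R[i]).
Proof.
have K0 a : l2 a -> Aseq 1 (fun=> 0) a = a.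
  move=> a2; apply/funext => k; rewrite /Aseq.
  have K0 (c : nat -> R[i]) : l2 c -> Kseq (fun=> 0) c = fun=> 0.
    move=> c2; have := KseqZl 0 l2_zero c2.
    have -> : (fun _ : nat => 0 * 0 : R[i]) = fun=> 0 by apply/funext => j; rewrite mul0r.
    by move=> ->; apply/funext => j; rewrite mul0r.
  by rewrite K0 ?mulr0 ?subr0//; rewrite K0//; exact: l2_zero.
split; first by move=> f f2; exists f => //; exact: K0.
by exists 1 => a a2; rewrite K0// mul1r.
Qed.

(** [(y, u)] enters [1 - y K_u^2] only through [sqrt y u], so that smallness of
    [y] is smallness of the symbol. *)
Lemma inv_seq_small (U : R) : 0 <= U -> exists y0, [/\ 0 < y0, y0 ^+ 2 * (U * U) <= 4^-1 &
  forall y u, 0 < y -> y <= y0 -> bd w2 u U -> inv_seq y u].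
Proof.
move=> U0.
have [d0 d0_gt0 H] := inv_seq_perturb (bd_zero w2) inv_seq_zero.
have U1 : 0 < U + 1 by rewrite ltr_wpDl.
set y0 := Num.min (d0 / (U + 1)) (2^-1 / (U + 1)).
have y0_gt0 : 0 < y0 by rewrite lt_min !divr_gt0.
exists y0; split => //.
  have : y0 * U <= 2^-1.
    apply: (@le_trans _ _ (2^-1 / (U + 1) * (U + 1))); last by rewrite divfK// gt_eqF.
    apply: ler_pM => //; [exact: ltW|by rewrite /y0 ge_min lexx orbT|by rewrite lerDl].
  have y0U : 0 <= y0 * U by rewrite mulr_ge0// ltW.
  move=> h; have -> : y0 ^+ 2 * (U * U) = (y0 * U) * (y0 * U) by ring.
  have -> : 4^-1 = 2^-1 * 2^-1 :> R by field.
  by apply: ler_pM.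
move=> y u y_gt0 yy0 uU; have hu : h2 u by exists U.
have u2 := h2_l2 hu; set s := Num.sqrt y.
have ss : s%:C%C * s%:C%C = y%:C%C by rewrite -rmorphM -expr2 sqr_sqrtr// ltW.
have hs : bd w2 (fun k => s%:C%C * u k) d0.
  apply: bd_mono (bdZ s%:C%C uU); rewrite normsqR (sqr_sqrtr (ltW y_gt0)).
  apply: (@le_trans _ _ (d0 / (U + 1) * (U + 1))); last by rewrite divfK// gt_eqF.
  apply: ler_pM => //; [exact: ltW| |by rewrite lerDl].
  by apply: le_trans yy0 _; rewrite ge_min lexx.
have := H _ hs.
have -> : (fun k => 0 + s%:C%C * u k) = (fun k => s%:C%C * u k).
  by apply/funext => k; rewrite add0r.
have E a : l2 a -> Aseq 1 (fun k => s%:C%C * u k) a = Aseq y u a.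
  move=> a2; have Ka := l2_Kseq hu a2; apply/funext => k; rewrite /Aseq.
  rewrite (KseqZl _ u2 a2) (KseqZl _ u2 (l2Z _ Ka)) (KseqZr _ u2 Ka) conjc_real.
  by rewrite mul1r [s%:C%C * (_ * _)]mulrA ss.
move=> [surj [C hC]]; split.
  by move=> f f2; have [a a2 ea] := surj f f2; exists a; [exact: a2|rewrite -(E a a2)].
by exists C => a a2; rewrite -(E a a2); exact: hC.
Qed.

(** Uniform in [y], unlike the bound contained in the invertibility. *)
Lemma small_resolvent_bd y u U f F a : bd w2 u U -> y ^+ 2 * (U * U) <= 4^-1 -> l2 a ->
  Aseq y u a = f -> bd w1 f F -> bd w1 a (4 * F).
Proof.
move=> uU small a2 ea fF; have aA := bd_nsq a2; have n0 := nsq_ge0 a2.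
apply: bd_mono (aA).
have b2 := bdZ y%:C%C (bd_Kseq1 uU (bd_Kseq1 uU aA)).
have := nsq_le (bdD (@w1_ge0 R) fF b2).
have -> : (fun k => f k + y%:C%C * Kseq u (Kseq u a) k) = a.
  by rewrite -ea; apply/funext => k; rewrite /Aseq subrK.
rewrite normsqR => h.
have : y ^+ 2 * (U * (U * nsq a)) <= 4^-1 * nsq a.
  by rewrite [U * _]mulrA mulrA ler_wpM2r.
by move: h; lra.
Qed.

Lemma quotient_bd (p p' s s' y e B S S' : R) : 0 < y -> y <= e / (B + 1) -> 0 <= B ->
  2 * S + 2 * S' <= B -> s ^+ 2 <= S -> s' ^+ 2 <= S' -> p + y * s = p' + y * s' ->
  `|p - p'| <= e.
Proof.
move=> y_gt0 ye B0 hB hs hs' E.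
have -> : p - p' = y * (s' - s) by rewrite mulrBr -(addrK (y * s) p) E; ring.
have B1 : 0 < B + 1 by rewrite ltr_wpDl.
rewrite normrM (gtr0_norm y_gt0).
apply: (@le_trans _ _ (e / (B + 1) * (B + 1))); last by rewrite divfK// gt_eqF.
apply: ler_pM => //; first exact: ltW.
apply: norm_le_of_sqr; first exact: ltW.
have n2 : (- s) ^+ 2 <= S by rewrite sqrrN.
apply: le_trans (sqr_add_le hs' n2) _.
by have := sqr_ge0 B; rewrite sqrrD; lra.
Qed.

(** As [y] tends to [0], [(K^(2n) (1 - y K^2)^(-1) f | f)] tends to the moment
    [(K^(2n) f | f)], and their difference divided by [y] is the same quantity
    at [n + 1]. *)
Lemma moments_of_small_resolvents alpha u v (U y0 : R) : bd w2 u U -> bd w2 v U ->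
  0 < y0 -> y0 ^+ 2 * (U * U) <= 4^-1 ->
  (forall y, 0 < y -> y <= y0 -> inv_seq y u /\ inv_seq y v) ->
  (forall y a b a' b', 0 < y -> y <= y0 -> l2 a -> l2 b -> l2 a' -> l2 b' ->
    Aseq y u a = u -> Aseq y u b = one_seq -> Aseq y v a' = v -> Aseq y v b' = one_seq ->
    moment alpha u 0 a b = moment alpha v 0 a' b') ->
  forall n, moment alpha u n u one_seq = moment alpha v n v one_seq.
Proof.
move=> uU vU y0_gt0 small inv E0.
have hu : h2 u by exists U. have hv : h2 v by exists U.
have u2 := h2_l2 hu; have v2 := h2_l2 hv; have o2 := @l2_one R; have U0 := bd_ge0 uU.
have small' y : 0 < y -> y <= y0 -> y ^+ 2 * (U * U) <= 4^-1.
  move=> y_gt0 yy0; apply: le_trans small; apply: ler_wpM2r; first exact: mulr_ge0.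
  by rewrite ler_pXn2r// nnegrE ltW.
have rec n y w a b : h2 w -> l2 a -> l2 b -> Aseq y w a = w -> Aseq y w b = one_seq ->
    moment alpha w n a b = moment alpha w n w one_seq + y * moment alpha w n.+1 a b.
  move=> hw a2 b2 ea eb; rewrite -{3}ea -eb (moment_Aseq alpha y n hw a2 b2); ring.
have key n : (forall y a b a' b', 0 < y -> y <= y0 -> l2 a -> l2 b -> l2 a' -> l2 b' ->
    Aseq y u a = u -> Aseq y u b = one_seq -> Aseq y v a' = v -> Aseq y v b' = one_seq ->
    moment alpha u n a b = moment alpha v n a' b') ->
    moment alpha u n u one_seq = moment alpha v n v one_seq.
  move=> En.
  have u1 := bd_w1 (@w1_le_w2 R) uU; have v1 := bd_w1 (@w1_le_w2 R) vU.
  have o1 : bd w1 (@one_seq R) 1 by exact: bd_one.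
  have [M M0 hM] := moment_bd alpha n.+1 uU; have [M' M'0 hM'] := moment_bd alpha n.+1 vU.
  set B := 2 * (M * (4 * U + 4 * 1)) + 2 * (M' * (4 * U + 4 * 1)).
  have B0 : 0 <= B by rewrite /B addr_ge0// mulr_ge0// mulr_ge0// addr_ge0// mulr_ge0.
  apply/eqP; rewrite -subr_eq0 -normr_eq0 -[_ == 0]/(_ == _) eq_le normr_ge0 andbT.
  apply/ler_addgt0Pl => e e0; rewrite addr0.
  set y := Num.min y0 (e / (B + 1)).
  have B1 : 0 < B + 1 by rewrite ltr_wpDl.
  have y_gt0 : 0 < y by rewrite lt_min y0_gt0 divr_gt0.
  have yy0 : y <= y0 by rewrite ge_min lexx.
  have [iu iv] := inv y y_gt0 yy0.
  have [a a2 ea] := iu.1 _ u2; have [b b2 eb] := iu.1 _ o2.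
  have [a' a'2 ea'] := iv.1 _ v2; have [b' b'2 eb'] := iv.1 _ o2.
  have := En y a b a' b' y_gt0 yy0 a2 b2 a'2 b'2 ea eb ea' eb'.
  rewrite (rec n y u a b hu a2 b2 ea eb) (rec n y v a' b' hv a'2 b'2 ea' eb').
  have sm := small' y y_gt0 yy0.
  have h1 := hM _ _ _ _ (small_resolvent_bd uU sm a2 ea u1) (small_resolvent_bd uU sm b2 eb o1).
  have h2_ := hM' _ _ _ _ (small_resolvent_bd vU sm a'2 ea' v1) (small_resolvent_bd vU sm b'2 eb' o1).
  apply: (quotient_bd y_gt0 _ B0 _ h1 h2_); [by rewrite ge_min lexx orbT|].
  by rewrite /B.
move=> n; apply: (key n).
elim: n => [|n IH]; first exact: E0.
move=> y a b a' b' y_gt0 yy0 a2 b2 a'2 b'2 ea eb ea' eb'.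
have := IH y a b a' b' y_gt0 yy0 a2 b2 a'2 b'2 ea eb ea' eb'.
rewrite (rec n y u a b hu a2 b2 ea eb) (rec n y v a' b' hv a'2 b'2 ea' eb') (key n IH).
by move=> /addrI; apply: mulfI; rewrite gt_eqF.
Qed.

End Moments.

(** * Conservation along the flow *)

Section Flow.
Context {R : realType}.
Implicit Types (x y alpha r s : R).

Lemma H12plusB (u h : R -> R[i]) : H12plus u -> H12plus h -> H12plus (fun t => u t - h t).
Proof.
move=> hu hh; have hu1 := H12plus_hardy hu; have hh1 := H12plus_hardy hh.
have b := bdB (@w2_ge0 R) (H12plus_bd hu) (H12plus_bd hh).
rewrite -(coefsB (hardy_L2 hu1) (hardy_L2 hh1)) in b.
exact: (bd_H12plus (hardyB hu1 hh1) b).1.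
Qed.

Lemma quotient_arith (z1 z2 : R[i]) (F1 F2 C P G p q r : R) : r != 0 ->
  0 <= C -> 0 <= P -> 0 <= G -> 0 <= p -> 0 <= q -> Im z1 = 0 -> normsq z2 <= q * G ->
  (F1 - F2 - 2 * Re (Complex 0 (- r) * (z1 + z2))) ^+ 2 <=
    C * (p * (r ^+ 2 * (2 * P + 2 * q))) ->
  (r^-1 * (F1 - F2)) ^+ 2 <=
    (4 * (C * (P + 1)) + 8 * G) * p * (1 + q) + (4 * (C * (P + 1)) + 8 * G) * q.
Proof.
move=> r0 C0 P0 G0 p0 q0 i1 w ineq.
have {}w := le_trans (Im_le_normsq z2) w.
have e3 : Re (Complex 0 (- r) * (z1 + z2)) = r * Im z2 by rewrite ReM ImD i1 /=; ring.
rewrite e3 in ineq.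
set X := F1 - F2 - 2 * (r * Im z2) in ineq.
have -> : F1 - F2 = X + 2 * (r * Im z2) by rewrite /X subrK.
have S : (2 * (r * Im z2)) ^+ 2 <= 4 * (r ^+ 2 * (q * G)).
  have -> : (2 * (r * Im z2)) ^+ 2 = 4 * (r ^+ 2 * Im z2 ^+ 2) by ring.
  by rewrite ler_wpM2l// ler_wpM2l// sqr_ge0.
rewrite exprMn.
apply: le_trans (ler_wpM2l (sqr_ge0 r^-1) (sqr_add_le ineq S)) _.
have -> : r^-1 ^+ 2 * (2 * (C * (p * (r ^+ 2 * (2 * P + 2 * q)))) +
    2 * (4 * (r ^+ 2 * (q * G)))) = 4 * (C * p * (P + q)) + 8 * (q * G).
  by field.
have m1 : 0 <= C * (P * (p * q)) by rewrite !mulr_ge0.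
have m2 : 0 <= C * p by rewrite !mulr_ge0.
have m3 : 0 <= G * (p * (1 + q)) by rewrite !mulr_ge0// addr_ge0.
have m4 : 0 <= C * (P + 1) * q by rewrite !mulr_ge0// addr_ge0.
rewrite -subr_ge0.
have -> : (4 * (C * (P + 1)) + 8 * G) * p * (1 + q) + (4 * (C * (P + 1)) + 8 * G) * q -
    (4 * (C * p * (P + q)) + 8 * (q * G)) =
  4 * (C * (P * (p * q))) + 4 * (C * p) + 8 * (G * (p * (1 + q))) + 4 * (C * (P + 1) * q).
  by ring.
by rewrite !addr_ge0// mulr_ge0.
Qed.

Section Quotient.
Variables (alpha y : R) (f g Phi : R -> R[i]) (a b : nat -> R[i]).
Hypotheses (hf : H12plus f) (iy : inv_seq y (coefs f)) (a2 : l2 a) (b2 : l2 b).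
Hypotheses (ea : Aseq y (coefs f) a = coefs f) (eb : Aseq y (coefs f) b = one_seq).
Hypotheses (hg : hardy g) (eg : coefs g = gradient y alpha (coefs f) a b).
Hypotheses (hPhi : hardy Phi) (conserved : Im (dot (coefs Phi) (coefs g)) = 0).

(** The time derivative of the flow exists only in [L^2], while [L_y] is
    differentiable on [H^(1/2)]; the product of the two norms in the remainder
    makes up for it: the increment divided by the time step is bounded in [L^2],
    and the increment is small in [H^(1/2)]. *)
Lemma Lfun_quotient_bd : exists d0 C, [/\ 0 < d0, 0 <= C & forall r (v : R -> R[i]) (N eta : R),
  r != 0 -> H12plus v -> H12norm (fun t => v t - f t) <= N -> N ^+ 2 <= d0 ->
  L2norm (fun t => 'i%C * ((r^-1)%:C%C * (v t - f t)) - Phi t) <= eta ->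
  (r^-1 * (Re (Lfun_x alpha y v) - Re (Lfun_x alpha y f))) ^+ 2 <=
  C * N ^+ 2 * (1 + eta ^+ 2) + C * eta ^+ 2].
Proof.
have [d0 [C [d0_gt0 C0 expan]]] := Lfun_expansion alpha hf iy a2 b2 ea eb.
set P := L2sq Phi; set G := nsq (coefs g).
have P0 : 0 <= P := L2sq_ge0 Phi.
have G2 : l2 (coefs g) := l2_coefs (hardy_L2 hg).
have G0 : 0 <= G := nsq_ge0 G2.
exists d0, (4 * (C * (P + 1)) + 8 * G); split => //.
  by rewrite addr_ge0// mulr_ge0// mulr_ge0// addr_ge0.
move=> r v N eta r0 hv hN Nd heta.
set h := fun t => v t - f t; set eps := fun t => 'i%C * ((r^-1)%:C%C * h t) - Phi t.
have hh : H12plus h := H12plusB hv hf.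
have h2_ := hardy_L2 (H12plus_hardy hh); have P2 := hardy_L2 hPhi.
have he : hardy eps by apply: hardyB hPhi; do 2 apply: hardyZ; exact: H12plus_hardy.
have e2 := hardy_L2 he.
have hN0 : 0 <= H12norm h by rewrite sqrtr_ge0.
have N0 : 0 <= N := le_trans hN0 hN.
have hN2 : H12norm h ^+ 2 <= N ^+ 2 by rewrite ler_pXn2r// nnegrE.
have hd : bd w2 (coefs h) (N ^+ 2) := bd_mono hN2 (H12plus_bd hh).
have e_sq : L2sq eps <= eta ^+ 2.
  have n0 := L2norm_ge0 eps; rewrite /L2sq -L2norm_sq ler_pXn2r// nnegrE//.
  exact: le_trans heta.
(* [h = - i r (Phi + eps)] is the equation solved for the increment. *)
pose c : R[i] := Complex 0 (- r).
have hE : h = fun t => c * (Phi t + eps t).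
  apply/funext => t; rewrite /eps addrC subrK !mulrA.
  suff -> : c * 'i%C * (r^-1)%:C%C = 1 by rewrite mul1r.
  apply: complexP; rewrite !(ReM, ImM) /=; field => //.
have hsq : L2sq h <= r ^+ 2 * (2 * P + 2 * eta ^+ 2).
  rewrite {1}hE L2sqZ; last exact: L2D.
  have -> : normsq c = r ^+ 2 by rewrite /normsq /= sqrrN expr0n add0r.
  apply: ler_wpM2l; first exact: sqr_ge0.
  apply: le_trans (L2sqD_le P2 e2) _; rewrite lerD2l.
  exact: ler_wpM2l e_sq.
have h1 := bd_mono hsq (bd_coefs h2_).
have := expan h _ _ hh Nd hd h1.
have -> : (fun t => f t + h t) = v by apply/funext => t; rewrite /h addrC subrK.
have -> : dot (coefs h) (gradient y alpha (coefs f) a b) =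
    c * (dot (coefs Phi) (coefs g) + dot (coefs eps) (coefs g)).
  rewrite -eg {1}hE (coefsZ _ (L2D P2 e2)) (coefsD P2 e2).
  have l1 := l2_coefs P2; have l2_ := l2_coefs e2.
  by rewrite (dotZl _ (l2D l1 l2_) G2) (dotDl l1 l2_ G2).
have w := dot_CS (bd_mono e_sq (bd_coefs e2)) (bd_nsq G2).
move=> ineq.
exact: (quotient_arith r0 C0 P0 G0 (sqr_ge0 N) (sqr_ge0 eta) conserved w ineq).
Qed.

End Quotient.

Lemma Lfun_is_derive alpha y (u : R -> R -> R[i]) s : is_solution alpha u -> y != 0 ->
  inv_seq y (coefs (u s)) ->
  is_derive s (1 : R) (fun t => Re (Lfun_x alpha y (u t))) 0.
Proof.
move=> [hu cont deriv] y0 iy; have hf := hu s; have u2 := h2_l2 (H12plus_h2 hf).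
have [a a2 ea] := iy.1 _ u2; have [b b2 eb] := iy.1 _ (@l2_one R).
have [g hg eg] := gradient_hardy alpha hf iy a2 b2 ea eb.
have [hPhi] := gradient_conserved alpha y0 hf iy a2 b2 ea eb; rewrite -eg => cons.
have [d0 [C [d0_gt0 C0 bound]]] := Lfun_quotient_bd hf iy a2 b2 ea eb hg eg hPhi cons.
set F := fun t => Re (Lfun_x alpha y (u t)).
suff lim : (fun r : R => r^-1 *: ((F \o shift s) (r *: (1 : R)) - F s)) @ 0^' --> (0 : R).
  by apply: DeriveDef; [apply/cvg_ex; exists 0|exact: cvg_lim lim].
apply/cvgrPdist_le => e e_gt0.
have C1 : 0 < C + 1 by rewrite ltr_wpDl.
have e2 : 0 < e ^+ 2 by exact: exprn_gt0.
set k := Num.min 1 (Num.min d0 (e ^+ 2 / (3 * (C + 1)))).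
have k_gt0 : 0 < k by rewrite !lt_min ltr01 d0_gt0 divr_gt0// mulr_gt0.
have k1 : k <= 1 by rewrite ge_min lexx.
have kd : k <= d0 by rewrite !ge_min lexx orbT.
have ke : k <= e ^+ 2 / (3 * (C + 1)) by rewrite !ge_min lexx !orbT.
have kk : k ^+ 2 <= k by rewrite expr2 -[leRHS]mul1r ler_wpM2r// ltW.
have nearN : \forall r \near 0^', H12norm (fun t => u (s + r) t - u s t) <= k.
  have /cvgrPdist_le/(_ k k_gt0) H := cont s.
  move: H => /nbhs_ballP[del /= del0 H].
  apply/nbhs_ballP; exists del => //= r; rewrite /ball /= sub0r normrN => hr _.
  have := H (s + r); rewrite /ball /= opprD addrA subrr sub0r normrN => /(_ hr).
  by rewrite sub0r normrN => /(le_trans (ler_norm _)).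
have nearE : \forall r \near 0^', L2norm (fun t => 'i%C * ((r^-1)%:C%C * (u (s + r) t - u s t))
                         - szego_rhs alpha (u s) t) <= k.
  have /cvgrPdist_le/(_ k k_gt0) := deriv s.
  by apply: filterS => r; rewrite sub0r normrN => /(le_trans (ler_norm _)).
have near0 : \forall r \near (0 : R)^', r != 0 by exact: nbhs_dnbhs_neq.
apply: filterS3 near0 nearN nearE => r r0 hN hE.
rewrite sub0r normrN /= -[r *: _]/(r * 1) mulr1 -[_ *: _]/(r^-1 * _) (addrC r s).
apply: norm_le_of_sqr (ltW e_gt0) _.
apply: le_trans (bound r (u (s + r)) k k r0 (hu _) hN (le_trans kk kd) hE) _.
have -> : C * k ^+ 2 * (1 + k ^+ 2) + C * k ^+ 2 = C * (k ^+ 2 * (2 + k ^+ 2)) by ring.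
apply: (@le_trans _ _ ((C + 1) * (e ^+ 2 / (3 * (C + 1)) * 3))); last first.
  have -> : (C + 1) * (e ^+ 2 / (3 * (C + 1)) * 3) = e ^+ 2 by field; rewrite gt_eqF.
  exact: lexx.
apply: ler_pM => //; first by rewrite mulr_ge0 ?sqr_ge0// addr_ge0// sqr_ge0.
  by rewrite lerDl.
apply: ler_pM; [exact: sqr_ge0|by rewrite addr_ge0// sqr_ge0|exact: le_trans ke|].
by have := le_trans kk k1; lra.
Qed.

Lemma Lfun_constant alpha y (u : R -> R -> R[i]) (s t : R) : is_solution alpha u -> y != 0 ->
  s <= t -> (forall r, s <= r <= t -> inv_seq y (coefs (u r))) ->
  Re (Lfun_x alpha y (u s)) = Re (Lfun_x alpha y (u t)).
Proof.
move=> sol y0 st inv; set F := fun r => Re (Lfun_x alpha y (u r)).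
have dF r : s <= r <= t -> is_derive r (1 : R) F 0.
  by move=> /inv; exact: Lfun_is_derive.
have [||c _] := @MVT_segment R F (fun=> 0) s t st.
- by move=> r; rewrite in_itv /= => /andP[/ltW h1 /ltW h2]; apply: dF; rewrite h1.
- apply: derivable_within_continuous => r; rewrite in_itv /= => /dF d.
  exact: ex_derive.
- by rewrite mul0r => /eqP; rewrite subr_eq0 => /eqP/esym.
Qed.

(** Only [L_y] with [y] small compared with the size of [u] is known to exist
    along the whole trajectory near a given time. *)
Lemma moments_locally_constant alpha (u : R -> R -> R[i]) s : is_solution alpha u ->
  \forall r \near s, forall n,
    moment alpha (coefs (u r)) n (coefs (u r)) one_seq =
    moment alpha (coefs (u s)) n (coefs (u s)) one_seq.
Proof.
move=> sol; have [hu cont _] := sol.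
(* A bound for the squared norms at all times where the solution is at distance
   at most [1] from its value at [s]. *)
set B := 2 * H12norm (u s) ^+ 2 + 2 * 1.
have B0 : 0 <= B by rewrite addr_ge0// mulr_ge0// sqr_ge0.
have [y0 [y0_gt0 small inv]] := inv_seq_small B0.
have /cvgrPdist_le/(_ 1 ltr01)/nbhs_ballP[del /= del0 H] := cont s.
have bdB_ r : `|s - r| < del -> bd w2 (coefs (u r)) B.
  move=> hr; have := H r hr; rewrite sub0r normrN => /(le_trans (ler_norm _)) n1.
  have hh := H12plusB (hu r) (hu s).
  have n0 : 0 <= H12norm (fun t => u r t - u s t) by rewrite sqrtr_ge0.
  have n2 : H12norm (fun t => u r t - u s t) ^+ 2 <= 1 by rewrite expr_le1.
  have := bdD (@w2_ge0 R) (H12plus_bd (hu s)) (bd_mono n2 (H12plus_bd hh)).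
  rewrite -(coefsD (hardy_L2 (H12plus_hardy (hu s))) (hardy_L2 (H12plus_hardy hh))).
  by congr (bd _ (coefs _) _); apply/funext => t; rewrite addrC subrK.
apply/nbhs_ballP; exists del; first exact: del0.
move=> r hr; have {}hr : `|s - r| < del := hr.
have bs : bd w2 (coefs (u s)) B by apply: bdB_; rewrite subrr normr0.
apply: (moments_of_small_resolvents (bdB_ r hr) bs y0_gt0 small).
  move=> y y_gt0 yy0; split; apply: (inv y _ y_gt0 yy0); [exact: bdB_|exact: bs].
move=> y a b a' b' y_gt0 yy0 a2 b2 a'2 b'2 ea eb ea' eb'.
have iy t : `|s - t| < del -> inv_seq y (coefs (u t)).
  by move=> /bdB_; exact: inv.
have y_neq0 : y != 0 by rewrite gt_eqF.
have E : Re (Lfun_x alpha y (u r)) = Re (Lfun_x alpha y (u s)).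
  have [rs|sr] := leP r s.
    apply: (Lfun_constant sol y_neq0 rs) => t /andP[rt ts]; apply: iy.
    rewrite ger0_norm ?subr_ge0//; apply: le_lt_trans hr.
    by rewrite ger0_norm ?subr_ge0// lerD2l lerN2.
  apply/esym; apply: (Lfun_constant sol y_neq0 (ltW sr)) => t /andP[st tr]; apply: iy.
  rewrite distrC ger0_norm ?subr_ge0//; apply: le_lt_trans hr.
  by rewrite distrC ger0_norm ?subr_ge0 ?(ltW sr)// lerD2r.
have ir := iy r hr; have is_ : inv_seq y (coefs (u s)) by apply: iy; rewrite subrr normr0.
rewrite (Lfun_seq alpha (hu r) ir a2 b2 ea eb) (Lfun_seq alpha (hu s) is_ a'2 b'2 ea' eb') in E.
move: E; rewrite /moment /=.
by move: (dot a _) (dot b _) (dot a' _) (dot b' _) => z1 z2 z3 z4; rewrite !ReB !Re_realM.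
Qed.

(** A locally constant function has a vanishing derivative. *)
Lemma moments_constant alpha (u : R -> R -> R[i]) n (s t : R) : is_solution alpha u ->
  moment alpha (coefs (u s)) n (coefs (u s)) one_seq =
  moment alpha (coefs (u t)) n (coefs (u t)) one_seq.
Proof.
move=> sol; set J := fun r => moment alpha (coefs (u r)) n (coefs (u r)) one_seq.
rewrite -[LHS]/(J s) -[RHS]/(J t); apply: is_derive_0_is_cst => r.
apply: (near_eq_is_derive (f := cst (J r))).
by apply: filterS (moments_locally_constant r sol) => r' E; exact/esym/(E n).
Qed.

Lemma Lfun_conserved alpha x (u : R -> R -> R[i]) : is_solution alpha u ->
  forall t1 t2 : R, invertible_at x (u t1) -> invertible_at x (u t2) ->
  Lfun_x alpha x (u t1) = Lfun_x alpha x (u t2).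
Proof.
move=> sol t1 t2; have [hu _ _] := sol.
move=> /(inv_seq_of_invertible (hu t1)) i1 /(inv_seq_of_invertible (hu t2)) i2.
have h1 := H12plus_h2 (hu t1); have h2_ := H12plus_h2 (hu t2); have o2 := @l2_one R.
have u1 := h2_l2 h1; have u2 := h2_l2 h2_.
have [a a2 ea] := i1.1 _ u1; have [b b2 eb] := i1.1 _ o2.
have [a' a'2 ea'] := i2.1 _ u2; have [b' b'2 eb'] := i2.1 _ o2.
have := resolvent_of_moments h1 h2_ i1 i2 a2 b2 a'2 b'2 ea eb ea' eb'
  (fun m => moments_constant m t1 t2 sol).
rewrite (Lfun_seq alpha (hu t1) i1 a2 b2 ea eb) (Lfun_seq alpha (hu t2) i2 a'2 b'2 ea' eb').
have real v f c : h2 v -> l2 f -> l2 c -> Aseq x v c = f -> Im (dot c f) = 0.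
  by move=> hv f2 c2 e; apply: Im0_conjc; rewrite (dotJ c2 f2) -{1}e -(dot_Aseq_sym x hv c2 c2) e.
have := real _ _ _ h1 u1 a2 ea; have := real _ _ _ h1 o2 b2 eb.
have := real _ _ _ h2_ u2 a'2 ea'; have := real _ _ _ h2_ o2 b'2 eb'.
rewrite /moment /=.
move: (dot a _) (dot b _) (dot a' _) (dot b' _) => z1 z2 z3 z4 r4 r3 r2 r1 E.
by apply: complexP; rewrite ?ReB ?ImB ?Re_realM ?Im_realM // r1 r2 r3 r4.
Qed.

End Flow.

(* L_x(u) is real because K_u^2 is self-adjoint; the bracket is that of the
   real-valued functions Re L_x = L_x. *)
Theorem theorem3p2 (R : realType) (alpha : R) :
  (forall (x : R) (u : R -> R -> R[i]), is_solution alpha u ->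
     forall t1 t2 : R, invertible_at x (u t1) -> invertible_at x (u t2) ->
       Lfun_x alpha x (u t1) = Lfun_x alpha x (u t2)) /\
  (forall (x y : R) (u : R -> R[i]), H12plus u ->
     invertible_at x u -> invertible_at y u ->
     is_poisson_bracket (fun v => complex.Re (Lfun_x alpha x v))
                        (fun v => complex.Re (Lfun_x alpha y v)) u 0).
Proof.
split=> [x u sol|x y u hu ix iy]; first exact: Lfun_conserved.
exact: poisson_bracket_zero.
Qed.
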